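(* Let $1<p<\infty$, and let $\Omega\subset\mathbb{R}^N$ be open (possibly unbounded) and such that $W^{1,p}(\Omega)$ is continuously embedded in $L^{p^*}(\Omega)$. Let $j:\Omega\times\mathbb{R}\times\mathbb{R}^N\to\mathbb{R}$ be a Carathéodory function. Assume that there exist a constant $C>0$ and a function $h\in L^1(\Omega)$ such that for a.e. $x\in\Omega$, every $\mu\in\mathbb{R}$ and every $\xi\in\mathbb{R}^N$, $$j(x,\mu,\xi)\geq -C\big(|\xi|^p+|\mu|^{p^*}+|\mu|^p\big)-|h(x)|,$$ and that for a.e. $x\in\Omega$ and every $\mu\in\mathbb{R}$ the function $\xi\mapsto j(x,\mu,\xi)$ is strictly convex on $\mathbb{R}^N$. For $u\in W^{1,p}(\Omega)$ let $$J(u):=\int_\Omega j(x,u,Du)\,dx\in\mathbb{R}\cup\{+\infty\}.$$ Let $(u_n)\subset W^{1,p}(\Omega)$ be a bounded sequence weakly converging to a function $u\in W^{1,p}(\Omega)$, and suppose that $(u_n)$ is $p$-equiintegrable and $p^*$-equiintegrable and that $(Du_n)$ is $p$-equiintegrable. Then $$\liminf_{n\to\infty} J(u_n)\geq J(u).$$ If, in addition, $\limsup_{n\to\infty} J(u_n)\leq J(u)<\infty$, then $u_n\to u$ strongly in $W^{1,1}_{\mathrm{loc}}(\Omega)$, and moreover $Du_n\to Du$ in $L^p(\Omega;\mathbb{R}^N)$ and $u_n\to u$ in $L^{p^*}(\Omega)\cap L^p(\Omega)$.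
   Context: The exponent $p^*$ is $p^*=\frac{pN}{N-p}$ if $p<N$; if $p\geq N$, $p^*\in(p,\infty)$ is arbitrary but fixed. Carathéodory function: $j(x,\mu,\xi)$ is measurable in $x\in\Omega$ for every $(\mu,\xi)\in\mathbb{R}\times\mathbb{R}^N$ and continuous in $(\mu,\xi)$ for a.e. $x\in\Omega$. Equiintegrability: for $1\leq r<\infty$, an open set $\Omega\subset\mathbb{R}^N$ and a sequence $(U_n)\subset L^r(\Omega)^m$, $(U_n)$ is called $r$-equiintegrable if $$\sup\Big\{\int_E|U_n|^r\,dx \;\Big|\; n\in\mathbb{N},\ E\subset\Omega \text{ measurable},\ |E|\leq\delta\Big\}\to 0 \text{ as } \delta\to0^+,$$ and $$\sup\Big\{\int_{\Omega\setminus B_R}|U_n|^r\,dx \;\Big|\; n\in\mathbb{N}\Big\}\to 0 \text{ as } R\to\infty,$$ where $B_R\subset\mathbb{R}^N$ is the ball of radius $R$ centered at zero and $|E|$ is Lebesgue measure. *)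

(* Defs.v *)
From HB Require Import structures.
From mathcomp Require Import all_boot all_order all_algebra.
From mathcomp Require Import all_classical all_reals all_analysis.

Set Implicit Arguments.
Unset Strict Implicit.
Unset Printing Implicit Defensive.
Import Order.TTheory GRing.Theory Num.Theory.
Import numFieldNormedType.Exports.

Local Open Scope classical_set_scope.
Local Open Scope ring_scope.

(* Euclidean norm; the library norm of 'rV[R]_N is the sup norm and serves only
   for its (identical) topology. *)
Definition enorm (R : realType) (N : nat) (x : 'rV[R]_N) : R :=
  Num.sqrt (\sum_(i < N) x 0 i ^+ 2).

(* The ambient space R^N is 'rV[R]_n.+1, that is, N = n.+1 >= 1. *)

Section lebesgue_outer.
Variables (R : realType) (n : nat).
Implicit Types (a b : 'rV[R]_n.+1) (X : set 'rV[R]_n.+1).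

Definition box a b : set 'rV[R]_n.+1 :=
  [set x | forall i, a 0 i < x 0 i <= b 0 i].

Definition box_volume a b : R := \prod_(i < n.+1) Num.max 0 (b 0 i - a 0 i).

Definition box_cover X (ab : nat -> 'rV[R]_n.+1 * 'rV[R]_n.+1) : Prop :=
  X `<=` \bigcup_k box (ab k).1 (ab k).2.

Local Open Scope ereal_scope.

Definition lebesgue_outer X : \bar R :=
  ereal_inf [set \sum_(k <oo) (box_volume (ab k).1 (ab k).2)%:E
            | ab in box_cover X].

Let box_volume_ge0 a b : 0 <= (box_volume a b)%:E.
Proof. by rewrite lee_fin; apply: prodr_ge0 => i _; rewrite le_max lexx. Qed.

Let lebesgue_outer_ge0 X : 0 <= lebesgue_outer X.
Proof.
by apply: le_ereal_inf_tmp => _ [ab _ <-]; apply: nneseries_ge0 => k _ _.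
Qed.

Let le_lebesgue_outer : {homo lebesgue_outer : A B / A `<=` B >-> A <= B}.
Proof.
move=> A B AB; apply/ereal_inf_le_tmp => _ [ab Bab <-]; exists ab => //.
exact: subset_trans AB Bab.
Qed.

Let lebesgue_outer0 : lebesgue_outer set0 = 0.
Proof.
apply/eqP; rewrite eq_le lebesgue_outer_ge0 andbT.
apply: ereal_inf_lbound; exists (fun=> (0, 0)%R) => //=.
apply: eseries0 => k _ _; congr EFin.
by rewrite /box_volume big_ord_recl subrr maxxx mul0r.
Qed.

Let lebesgue_outer_sigma_subadditive : sigma_subadditive lebesgue_outer.
Proof.
move=> A; have [[i ioo]|] := pselect (exists i, lebesgue_outer (A i) = +oo).
  rewrite (eseries_pinfty _ _ ioo) ?leey// => k _.
  by rewrite -ltNye (lt_le_trans _ (lebesgue_outer_ge0 _)).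
rewrite -forallNE => Aoo.
suff add2e (e : {posnum R}) : lebesgue_outer (\bigcup_k A k) <=
    \sum_(i <oo) lebesgue_outer (A i) + e%:num%:E.
  by apply/lee_addgt0Pr => _/posnumP[].
rewrite (le_trans _ (epsilon_trick _ _ _))//.
pose vol (ab : 'rV[R]_n.+1 * 'rV[R]_n.+1) := (box_volume ab.1 ab.2)%:E.
pose P k ab := box_cover (A k) ab /\
  \sum_(i <oo) vol (ab i) <= lebesgue_outer (A k) + (e%:num / (2 ^ k.+1)%:R)%:E.
have [G PG] : {G : nat -> nat -> 'rV[R]_n.+1 * 'rV[R]_n.+1 &
    forall k, P k (G k)}.
  apply: (@choice _ _ P) => k; rewrite /P /lebesgue_outer.
  set S := (X in ereal_inf X); move infS : (ereal_inf S) => iS.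
  case: iS infS => [r Sr|Soo|Soo].
  - have en1 : (0 < e%:num / (2 ^ k.+1)%:R)%R by [].
    have /(lb_ereal_inf_adherent en1) : ereal_inf S \is a fin_num by rewrite Sr.
    move=> [x [B AnB muBx] xS].
    by exists B; split => //; rewrite -Sr; apply/ltW; rewrite muBx.
  - by have := Aoo k; rewrite /lebesgue_outer Soo.
  - by have := lebesgue_outer_ge0 (A k); rewrite /lebesgue_outer -/S Soo.
have /card_esym/ppcard_eqP[f] := card_nat2.
apply: (@le_trans _ _ (\esum_(i in setT) (vol \o uncurry G) i)).
  apply: ereal_inf_lbound => /=; exists (uncurry G \o f).
    move=> t [i _ /(PG i).1 [j _ Bijt]]; exists (f^-1%FUN (i, j)) => //=.
    by rewrite invK ?inE.
  rewrite -(esum_pred_image (vol \o uncurry G) _ xpredT) ?[fun=> _]set_true//.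
    by rewrite image_eq.
  by move=> k _; exact: box_volume_ge0.
rewrite (_ : esum _ _ = \sum_(i <oo) \sum_(j <oo ) vol (G i j)); last first.
  pose J : nat -> set (nat * nat) := fun i => [set (i, j) | j in setT].
  rewrite (_ : setT = \bigcup_k J k); last first.
    by rewrite predeqE => -[a b]; split => // _; exists a => //; exists b.
  rewrite esum_bigcupT /=; last 2 first.
    - apply/trivIsetP => i j _ _ ij.
      rewrite predeqE => -[n1 m] /=; split => //= -[] [_] _ [<-{n1} _].
      by move=> [m' _] [] /esym/eqP; rewrite (negbTE ij).
    - by move=> [k m]; exact: box_volume_ge0.
  rewrite -(image_id [set: nat]) -fun_true esum_pred_image//; last first.
    by move=> k _; apply: esum_ge0 => -[k1 m] _; exact: box_volume_ge0.
  apply: eq_eseriesr => /= j _.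
  rewrite -(esum_pred_image (vol \o uncurry G) (pair j) predT)//=.
  - by congr esum; rewrite predeqE => -[a b]; split; move=> [i _ <-]; exists i.
  - by move=> k _; exact: box_volume_ge0.
  - by move=> ? ? _ _; exact: (@can_inj _ _ _ snd).
apply: lee_lim.
- apply: is_cvg_nneseries => k *.
  by apply: nneseries_ge0 => m *; exact: box_volume_ge0.
- by apply: is_cvg_nneseries => k *; apply: adde_ge0.
- by near=> k; apply: lee_sum => i _; exact: (PG i).2.
Unshelve. all: by end_near. Qed.

HB.instance Definition _ := isOuterMeasure.Build R 'rV[R]_n.+1 lebesgue_outer
  lebesgue_outer0 lebesgue_outer_ge0 le_lebesgue_outer
  lebesgue_outer_sigma_subadditive.

End lebesgue_outer.

(* R^N with the sigma-algebra of Lebesgue measurable sets and the (complete)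
   Lebesgue measure. *)
Definition Rn (R : realType) (n : nat) : Type :=
  caratheodory_type (@lebesgue_outer R n).

HB.instance Definition _ (R : realType) (n : nat) :=
  Measurable.copy (Rn R n) (caratheodory_type (@lebesgue_outer R n)).

Definition leb {R : realType} {n : nat} : set (Rn R n) -> \bar R :=
  @lebesgue_outer R n.

HB.instance Definition _ (R : realType) (n : nat) :=
  isMeasure.Build _ (Rn R n) R (@leb R n)
    (@caratheodory_measure0 _ _ (@lebesgue_outer R n))
    (@caratheodory_measure_ge0 _ _ (@lebesgue_outer R n))
    (@caratheodory_measure_sigma_additive _ _ (@lebesgue_outer R n)).

Section lebesgue_spaces.
Variables (R : realType) (n : nat).
Implicit Types (Om : set 'rV[R]_n.+1) (f : 'rV[R]_n.+1 -> R) (r : R).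

(* Functions on Om are total functions whose values outside Om are discarded:
   f \_ Om is the extension of f by zero. *)
Definition Lp_norm Om r f : \bar R := 'N[@leb R n]_(r%:E)[EFin \o (f \_ Om)]%E.

Definition in_Lp Om r f : Prop :=
  (f \_ Om : Rn R n -> R) \in Lfun (@leb R n) r%:E.

Definition loc_integrable Om f : Prop :=
  measurable_fun (Om : set (Rn R n)) f /\
  forall K, compact K -> K `<=` Om -> leb.-integrable K (EFin \o f).

(* Only the magnitudes f k = |U k| of the sequence U enter, so that scalar and
   vector valued sequences are treated at once. *)
Definition equiintegrable Om r (f : nat -> 'rV[R]_n.+1 -> R) : Prop :=
  (ereal_sup [set s | exists k (E : set (Rn R n)),
       [/\ measurable E, E `<=` Om, (leb E <= d%:E)%E &
           s = (\int[leb]_(x in E) (`|f k x| `^ r)%:E)%E]]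
     @[d --> 0^'+] --> 0%E) /\
  (ereal_sup [set (\int[leb]_(x in Om `\` [set x | (enorm x < rho)%R])
                     (`|f k x| `^ r)%:E)%E | k in [set: nat]]
     @[rho --> +oo%R] --> 0%E).

End lebesgue_spaces.

Section sobolev.
Variables (R : realType) (n : nat).
Implicit Types (Om : set 'rV[R]_n.+1) (u phi : 'rV[R]_n.+1 -> R).
Implicit Types (g : 'rV[R]_n.+1 -> 'rV[R]_n.+1) (p : R).

Definition partials (s : seq 'I_n.+1) phi : 'rV[R]_n.+1 -> R :=
  foldr (fun i f => 'D_(delta_mx 0 i) f) phi s.

Definition smooth phi : Prop := forall s : seq 'I_n.+1,
  continuous (partials s phi) /\
  forall x i, derivable (partials s phi) x (delta_mx 0 i).

Definition test_function Om phi : Prop :=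
  [/\ smooth phi, compact (closure [set x | phi x != 0]) &
      closure [set x | phi x != 0] `<=` Om].

Definition weak_gradient Om u g : Prop :=
  [/\ loc_integrable Om u,
      forall i, loc_integrable Om (fun x => g x 0 i) &
      forall phi i, test_function Om phi ->
        \int[leb]_(x in Om) (u x * 'D_(delta_mx 0 i) phi x) =
        - \int[leb]_(x in Om) (g x 0 i * phi x)].

(* Du: a choice of the weak gradient, which is unique up to null sets. *)
Definition wgrad Om u : 'rV[R]_n.+1 -> 'rV[R]_n.+1 :=
  xget (fun=> 0) [set g | weak_gradient Om u g].

Definition W1p Om p u : Prop :=
  in_Lp Om p u /\ exists g,
    weak_gradient Om u g /\ forall i, in_Lp Om p (fun x => g x 0 i).

Definition W1p_norm Om p u : \bar R :=
  (Lp_norm Om p u + Lp_norm Om p (fun x => enorm (wgrad Om u x)))%E.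

Definition W1p_dual Om p (F : ('rV[R]_n.+1 -> R) -> R) : Prop :=
  [/\ forall u v, W1p Om p u -> W1p Om p v -> F (u \+ v) = F u + F v,
      forall c u, W1p Om p u -> F (fun x => c * u x) = c * F u &
      exists M : R, forall u, W1p Om p u ->
        (`|F u|%:E <= M%:E * W1p_norm Om p u)%E].

Definition W1p_weak_cvg Om p (u_ : nat -> 'rV[R]_n.+1 -> R) u : Prop :=
  forall F, W1p_dual Om p F -> F (u_ k) @[k --> \oo] --> F u.

Definition W1p_bounded Om p (u_ : nat -> 'rV[R]_n.+1 -> R) : Prop :=
  exists M : R, forall k, (W1p_norm Om p (u_ k) <= M%:E)%E.

Definition W1p_embedded_Lp Om p q : Prop :=
  exists K : R, forall u, W1p Om p u ->
    in_Lp Om q u /\ (Lp_norm Om q u <= K%:E * W1p_norm Om p u)%E.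

Definition W11_loc_cvg Om (u_ : nat -> 'rV[R]_n.+1 -> R) u : Prop :=
  forall Om', open Om' -> compact (closure Om') -> closure Om' `<=` Om ->
    W1p_norm Om' 1 (u_ k \- u) @[k --> \oo] --> 0%E.

End sobolev.

Definition sobolev_exponent (R : realType) (N : nat) (p ps : R) : Prop :=
  if p < N%:R then ps = p * N%:R / (N%:R - p) else p < ps.

Definition strictly_convex (R : realType) (V : lmodType R) (f : V -> R) : Prop :=
  forall (x y : V) (t : R), x != y -> 0 < t < 1 ->
    f (t *: x + (1 - t) *: y) < t * f x + (1 - t) * f y.

Section integrand.
Variables (R : realType) (n : nat).
Implicit Types (Om : set 'rV[R]_n.+1) (j : 'rV[R]_n.+1 -> R -> 'rV[R]_n.+1 -> R).

Definition caratheodory_function Om j : Prop :=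
  (forall mu xi, measurable_fun (Om : set (Rn R n)) (fun x => j x mu xi)) /\
  \forall x \ae leb, Om x ->
    continuous (fun z : R * 'rV[R]_n.+1 => j x z.1 z.2).

(* The library integral is the integral of the positive part minus that of the
   negative part; a lower bound of order -(|xi|^p + |mu|^ps + |mu|^p) - |h| on j
   makes the latter finite, so that the value lies in R or is +oo. *)
Definition Jfun j Om (u : 'rV[R]_n.+1 -> R) : \bar R :=
  (\int[leb]_(x in Om) (j x (u x) (wgrad Om u x))%:E)%E.

End integrand.

(* Main.v *)
Require Import Defs.
From HB Require Import structures.
From mathcomp Require Import all_boot all_order all_algebra.
From mathcomp Require Import all_classical all_reals all_analysis.
From mathcomp Require Import measurable_realfun.
From mathcomp Require Import ring lra.

Set Implicit Arguments.
Unset Strict Implicit.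
Unset Printing Implicit Defensive.
Import Order.TTheory GRing.Theory Num.Theory.
Import numFieldNormedType.Exports.
Local Open Scope classical_set_scope.
Local Open Scope ring_scope.


(** Write [w_n = Du_n] and [w = Du].  Along a subsequence [u_n] converges almost
    everywhere, by Rellich's theorem on boxes, while [w_n] converges only weakly.
    Let [a x] be a subgradient of [j x (u x)] at [w x] and consider the gap
    [G_n = j x u_n w_n - j x u w - a . (w_n - w)].  With [u] in the place of [u_n]
    it would be nonnegative, and strict convexity keeps it above a positive
    constant outside any ball around [w x].  This bound away from [w x] persists,
    uniformly in the gradient variable, when [u x] is replaced by a nearby value
    ([convex_gap_away]).  Hence, although [w_n x] may be unbounded:
    - the negative part of [G_n] tends to 0 pointwise ([convex_gap_neg_cvg]);
    - where [G_n] tends to 0, [w_n] tends to [w] ([convex_gap_cvg]).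

    Equiintegrability of the lower bound of [j] turns the first fact into
    convergence in [L^1] on sets where [a], [w] and [j x u w] are bounded.  There
    the linear term disappears in the limit by weak convergence, and outside
    these sets the negative part of [j x u_n w_n] is uniformly small.  This gives
    lower semicontinuity ([semicontinuity_integral]).  If the energies converge,
    the same count makes [|G_n|] tend to 0 in [L^1] on those sets, so that [w_n]
    tends to [w] almost everywhere along a subsequence ([semicontinuity_strong]).
    The theorem of Vitali ([unif_small_vitali]) then gives convergence in [L^p]
    and [L^p*], and since every subsequence has a further subsequence of this
    kind, the whole sequence converges.

    The subgradient has to depend measurably on [x].  It is therefore given by a
    formula: directional derivatives of a convex function are sublinear, and
    differentiating a sublinear function successively along the coordinate
    directions makes it linear without ever increasing it ([subgradP]).  Every
    derivative is a limit over a countable set, hence measurable in [x].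

    Rellich's theorem and the uniqueness of weak gradients (needed because [Du]
    is a choice) both rest on cutting boxes into halves.  The difference of the
    integrals of a function over the two halves is an integral against the
    derivative of a hat function, hence is controlled by the length of the side
    times the integral of the gradient ([halving]).  Repeated cutting yields a
    sum of integrals over small cells, which approximates the [L^1] norm
    ([fine_cells]) and, up to an error proportional to the cell size, depends on
    finitely many box integrals only ([cell_sum_refine_le]); these converge by
    weak convergence. *)
(** * Equiintegrability and Vitali's theorem *)
Lemma cvge0_lt (R : realType) (T : Type) (F : set_system T) {FF : Filter F}
    (u : T -> \bar R) (e : R) :
  u @ F --> 0%E -> 0 < e -> \forall k \near F, (u k < e%:E)%E.
Proof.
move=> /fine_cvgP[fin /cvgrPdist_lt cv] e0; have {}cv := cv _ e0.
near=> k; have ufin : u k \is a fin_num by near: k.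
have : `|0 - fine (u k)| < e by near: k.
rewrite sub0r normrN -(fineK ufin) lte_fin; exact: le_lt_trans (ler_norm _).
Unshelve. all: end_near. Qed.

Lemma cvge0P (R : realType) (u : nat -> \bar R) : (forall k, 0 <= u k)%E ->
  (forall e : R, 0 < e -> \forall k \near \oo, (u k <= e%:E)%E) ->
  u @ \oo --> 0%E.
Proof.
move=> u0 H; apply/fine_cvgP; split.
  by near=> k; rewrite ge0_fin_numE// (@le_lt_trans _ _ 1%E) ?ltry//; near: k; exact: H.
apply/cvgrPdist_le => e e0; have {}H := H _ e0.
near=> k; rewrite sub0r normrN ger0_norm ?fine_ge0//.
have ue : (u k <= e%:E)%E by near: k.
by rewrite -lee_fin fineK// ge0_fin_numE// (le_lt_trans ue)// ltry.
Unshelve. all: end_near. Qed.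


Section uniform_integrability.
Context d (T : measurableType d) (R : realType).
Variable mu : {measure set T -> \bar R}.
Variables (D : set T) (mD : measurable D).
Implicit Types (Phi Psi : nat -> T -> R) (g : T -> R).

(** Equiintegrability and tightness in one condition: the integral of [Phi n] over
    a set is small, uniformly in [n], as soon as the set has small measure inside
    a fixed set [F] of finite measure.  In this form domination and sums are
    immediate, and no metric on [T] is involved. *)
Definition unif_small Phi : Prop := forall e : R, 0 < e ->
  exists (F : set T) (dl : R), [/\ measurable F, F `<=` D, (mu F < +oo)%E,
    0 < dl & forall n E, measurable E -> E `<=` D ->
      (mu (E `&` F) <= dl%:E -> \int[mu]_(x in E) (Phi n x)%:E <= e%:E)%E].

Definition nonneg_mfun Phi : Prop :=
  (forall n, measurable_fun D (Phi n)) /\ (forall n x, D x -> 0 <= Phi n x).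

Lemma nonneg_mfunS Phi E n : measurable E -> E `<=` D -> nonneg_mfun Phi ->
  measurable_fun E (EFin \o Phi n) /\
  forall x, E x -> (0 <= (EFin \o Phi n) x)%E.
Proof.
move=> mE ED [mP P0]; split.
  by apply/measurable_EFinP; apply: measurable_funS (mP n).
by move=> x /ED Dx; rewrite lee_fin P0.
Qed.

Lemma nonneg_mfunD Phi Psi : nonneg_mfun Phi -> nonneg_mfun Psi ->
  nonneg_mfun (fun n => Phi n \+ Psi n).
Proof.
move=> [a b] [a' b']; split=> n; first exact: measurable_funD.
by move=> x Dx; rewrite /= addr_ge0 ?b ?b'.
Qed.

Lemma nonneg_mfunZ Phi (c : R) : 0 <= c -> nonneg_mfun Phi ->
  nonneg_mfun (fun n x => c * Phi n x).
Proof.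
move=> c0 [a b]; split=> n; first exact: measurable_funM.
by move=> x Dx; rewrite mulr_ge0 ?b.
Qed.

Lemma unif_small_le Phi Psi : nonneg_mfun Phi -> nonneg_mfun Psi ->
  (forall n x, D x -> Phi n x <= Psi n x) -> unif_small Psi -> unif_small Phi.
Proof.
move=> hP hQ PQ uQ e e0; have [F [dl [mF FD Foo dl0 H]]] := uQ e e0.
exists F, dl; split=> // n E mE ED small.
apply: le_trans (H n E mE ED small).
have [mP P0] := nonneg_mfunS n mE ED hP; have [mQ Q0] := nonneg_mfunS n mE ED hQ.
by apply: ge0_le_integral => // x Ex; rewrite lee_fin PQ//; exact: ED.
Qed.

Lemma unif_smallD Phi Psi : nonneg_mfun Phi -> nonneg_mfun Psi ->
  unif_small Phi -> unif_small Psi -> unif_small (fun n => Phi n \+ Psi n).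
Proof.
move=> hP hQ uP uQ e e0.
have e20 : 0 < e / 2 by rewrite divr_gt0.
have [F [dl [mF FD Foo dl0 H]]] := uP _ e20.
have [F' [dl' [mF' FD' Foo' dl0' H']]] := uQ _ e20.
exists (F `|` F'), (Num.min dl dl'); split.
- exact: measurableU.
- by rewrite subUset.
- by rewrite (le_lt_trans (measureU2 _ _ _))// lte_add_pinfty.
- by rewrite lt_min dl0.
move=> n E mE ED small.
have [mP P0] := nonneg_mfunS n mE ED hP; have [mQ Q0] := nonneg_mfunS n mE ED hQ.
rewrite (_ : (fun x => _) = (fun x => (EFin \o Phi n) x + (EFin \o Psi n) x)%E);
  last by apply/funext => x; rewrite /= EFinD.
rewrite ge0_integralD// (splitr e) EFinD; apply: leeD; [apply: H|apply: H'] => //.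
  apply: le_trans (le_trans small _); last by rewrite lee_fin ge_min lexx.
  apply: le_measure; rewrite ?inE; [exact: measurableI| |].
    by apply: measurableI => //; exact: measurableU.
  by apply: setIS; left.
apply: le_trans (le_trans small _); last by rewrite lee_fin ge_min lexx orbT.
apply: le_measure; rewrite ?inE; [exact: measurableI| |].
  by apply: measurableI => //; exact: measurableU.
by apply: setIS; right.
Qed.

Lemma unif_smallZ Phi (c : R) : 0 <= c -> nonneg_mfun Phi -> unif_small Phi ->
  unif_small (fun n x => c * Phi n x).
Proof.
move=> c0 hP uP e e0.
have c1 : 0 < c + 1 by rewrite ltr_wpDl.
have [F [dl [mF FD Foo dl0 H]]] := uP (e / (c + 1)) (divr_gt0 e0 c1).
exists F, dl; split=> // n E mE ED small.
have [mP P0] := nonneg_mfunS n mE ED hP.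
under eq_integral do rewrite EFinM.
rewrite ge0_integralZl_EFin//.
apply: le_trans (lee_wpmul2l _ (H n E mE ED small)) _; first by rewrite lee_fin.
rewrite -EFinM lee_fin mulrCA ger_pMr// ler_pdivrMr// mul1r; lra.
Qed.

Lemma unif_small_sub Phi (s : nat -> nat) : unif_small Phi ->
  unif_small (fun n => Phi (s n)).
Proof.
move=> uP e e0; have [F [dl [mF FD Foo dl0 H]]] := uP e e0.
by exists F, dl; split=> // n; exact: H.
Qed.

(** The traces on [F] of the complements of an exhaustion decrease to the empty
    set, and [F] has finite measure. *)
Lemma unif_small_tail Phi (A : nat -> set T) : nonneg_mfun Phi ->
  unif_small Phi -> (forall k, measurable (A k)) -> nondecreasing_seq A ->
  D `<=` \bigcup_k A k -> forall e : R, 0 < e ->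
  \forall k \near \oo, forall n,
    (\int[mu]_(x in D `\` A k) (Phi n x)%:E <= e%:E)%E.
Proof.
move=> hP uP mA ndA DA e e0; have [F [dl [mF FD Foo dl0 H]]] := uP e e0.
have : mu \o (fun k => F `\` A k) @ \oo --> mu (\bigcap_k (F `\` A k)).
  apply: nonincreasing_cvg_mu.
  - apply: le_lt_trans Foo; apply: le_measure; rewrite ?inE//.
    exact: measurableD.
  - by move=> k; exact: measurableD.
  - by apply: bigcapT_measurable => k; exact: measurableD.
  - move=> m k mk; apply/subsetPset; apply: setDS.
    by apply/subsetPset; exact: ndA.
rewrite (_ : \bigcap_k _ = set0); last first.
  apply/seteqP; split=> // x FA; have [//|Fx _] := FA 0%N.
  by have [k _ Akx] := DA _ (FD _ Fx); have [] := FA k.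
rewrite measure0 => /cvge0_lt/(_ dl0) small.
near=> k; move=> n; apply: H.
- exact: measurableD.
- by move=> x [].
- by rewrite setIC setIDA setIidl// ltW//; near: k; exact: small.
Unshelve. all: end_near. Qed.

(** Egorov's theorem on [F] leaves an exceptional set of small measure in [F];
    it joins the complement of [F], where the integrals are small anyway. *)
Lemma unif_small_vitali Phi : nonneg_mfun Phi -> unif_small Phi ->
  {ae mu, forall x, D x -> Phi ^~ x @ \oo --> (0 : R)} ->
  (fun n => \int[mu]_(x in D) (Phi n x)%:E)%E @ \oo --> 0%E.
Proof.
move=> hP uP ae0; apply: cvge0P => [n|e e0].
  by apply: integral_ge0 => x Dx; rewrite lee_fin; apply: hP.2.
have e20 : 0 < e / 2 by rewrite divr_gt0.
have [F [dl [mF FD Foo dl0 H]]] := uP _ e20.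
have [|||B [mB Bdl unif]] :=
  @ae_pointwise_almost_uniform _ _ _ mu Phi (cst 0) F dl _ _ mF Foo _ dl0.
- by move=> n; apply: measurable_funS (hP.1 n).
- exact: measurable_cst.
- by apply: filterS ae0 => x h Fx; apply: h; exact: FD.
have mFfin : mu F \is a fin_num by rewrite ge0_fin_numE.
(* The 1 avoids a division by zero when [F] is null. *)
pose eta := e / 2 / (fine (mu F) + 1).
have eta0 : 0 < eta.
  by rewrite divr_gt0// ltr_wpDl// fine_ge0.
have nearu : \forall n \near \oo, forall x, (F `\` B) x -> Phi n x < eta.
  apply: (unif [set g : {uniform` F `\` B -> R} | forall x, (F `\` B) x -> g x < eta]).
  apply/uniform_nbhs; exists [set xy | ball xy.1 eta xy.2]; split.
    exact: (entourage_ball _ (PosNum eta0)).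
  move=> g /= gE x FBx; have := gE x FBx.
  by rewrite /ball/= sub0r normrN; apply: le_lt_trans; exact: ler_norm.
near=> n.
have nu : forall x, (F `\` B) x -> Phi n x < eta by near: n.
pose E := D `\` (F `\` B).
have mE : measurable E by apply: measurableD => //; exact: measurableD.
have ED : E `<=` D by move=> x [].
have DE : D = E `|` (F `\` B).
  by rewrite /E setUC setDUK// => x [/FD].
have [mP P0] := nonneg_mfunS n mD (@subset_refl _ D) hP.
rewrite [X in integral _ X]DE ge0_integral_setU//; last 4 first.
- exact: measurableD.
- by rewrite -DE.
- by rewrite -DE.
- by rewrite disj_set2E /E setIC setDIK.
rewrite (splitr e) EFinD; apply: leeD.
  apply: H => //; apply: le_trans (ltW Bdl); apply: le_measure; rewrite ?inE//.
    exact: measurableI.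
  by move=> x [[Dx h] Fx]; apply: contrapT => Bx; apply: h.
apply: (@le_trans _ _ (\int[mu]_(x in F `\` B) (cst eta%:E x))%E).
  apply: ge0_le_integral => //.
  - exact: measurableD.
  - by move=> x [/FD Dx _]; apply: P0.
  - by apply: measurable_funS mP => // x [/FD].
  - by move=> x FBx; rewrite lee_fin ltW// nu.
rewrite integral_cst//; last exact: measurableD.
apply: (@le_trans _ _ (eta%:E * mu F)%E).
  apply: lee_wpmul2l; first by rewrite lee_fin ltW.
  by apply: le_measure; rewrite ?inE//; exact: measurableD.
rewrite -(fineK mFfin) -EFinM lee_fin /eta mulrAC.
by rewrite ler_pdivrMr ?ltr_wpDl ?fine_ge0// ler_pM2l// lerDl.
Unshelve. all: end_near. Qed.

(** The set [F] is a level set on which [g] lies between [1/(k+1)] and [k+1]: it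
    has finite measure, [g] is bounded on it, and by dominated convergence its
    complement carries little of the integral. *)
Lemma unif_small_integrable g : (forall x, D x -> 0 <= g x) ->
  mu.-integrable D (EFin \o g) -> unif_small (fun=> g).
Proof.
move=> g0 ig e e0; have mg : measurable_fun D g.
  by apply/measurable_EFinP; exact: measurable_int ig.
have e20 : 0 < e / 2 by rewrite divr_gt0.
pose F k := D `&` [set x | k.+1%:R^-1 < g x <= k.+1%:R].
have mF k : measurable (F k).
  rewrite /F (_ : [set x | _] = g @^-1` `]k.+1%:R^-1, k.+1%:R]) //.
  exact: mg.
have FD k : F k `<=` D by move=> x [].
have hg : nonneg_mfun (fun=> g) by [].
have : (fun k => \int[mu]_(x in D) (((EFin \o g) \_ (~` F k)) x))%E @ \oo
    --> (\int[mu]_(x in D) (cst 0 x))%E.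
  have [] := @dominated_convergence _ _ _ mu D mD
    (fun k => (EFin \o g) \_ (~` F k)) (cst 0%E) (EFin \o g).
  - move=> k; apply/measurable_restrict => //; first exact: measurableC.
    apply: measurable_funS (measurable_int _ ig) => //.
  - exact: measurable_cst.
  - apply/aeW => x Dx.
    have := g0 _ Dx; rewrite le_eqVlt => /predU1P[gx0|gx0].
      by apply: cvg_near_cst; apply: nearW => k; rewrite /patch /= -gx0 if_same.
    apply: cvg_near_cst; near=> k; rewrite /patch.
    case: ifPn => //; rewrite inE => nF /=.
    exfalso; apply: nF; split=> //=; apply/andP; split.
      near: k; exact: near_infty_natSinv_lt (PosNum gx0).
    apply/ltW; near: k.
    have [N _ NP] := nbhs_infty_gtr (g x); exists N => // m /= Nm.
    by apply: lt_trans (NP m Nm) _; rewrite ltr_nat.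
  - exact: ig.
  - apply/aeW => x Dx k; rewrite /patch; case: ifPn => _ /=.
      by rewrite ger0_norm ?g0.
    by rewrite normr0 lee_fin g0.
  - by [].
rewrite integral0 => /cvge0_lt/(_ e20)[k _ /(_ k (leqnn k))/= small].
exists (F k), (e / 2 / k.+1%:R); split=> //.
- have mE : measurable (D `&` [set x | (k.+1%:R^-1%:E <= `|(g x)%:E|)%E]).
    apply: emeasurable_fun_c_infty => //.
    by apply/measurable_EFinP; exact: measurableT_comp.
  apply: (@le_lt_trans _ _ (mu (D `&` [set x | (k.+1%:R^-1%:E <= `|(g x)%:E|)%E]))).
    apply: le_measure; rewrite ?inE//.
    move=> x [Dx /= /andP[gx _]]; split=> //=.
    by rewrite lee_fin (le_trans (ltW gx))// ler_norm.
  rewrite ltey; apply/negP => /eqP mooE.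
  have ka : 0 < k.+1%:R^-1 :> R by rewrite invr_gt0.
  have := @le_integral_abse _ _ _ mu D mD (EFin \o g) _ (measurable_int _ ig) ka.
  rewrite mooE gt0_muley ?lte_fin// leye_eq => /eqP goo.
  by have /integrableP[_] := ig; rewrite goo ltxx.
- by rewrite !divr_gt0.
move=> _ E mE ED sm.
have [mP P0] := nonneg_mfunS 0 mE ED hg.
have EE : E = (E `&` F k) `|` (E `\` F k) by rewrite setUIDK.
rewrite [X in integral _ X]EE ge0_integral_setU//; last 5 first.
- exact: measurableI.
- exact: measurableD.
- by rewrite -EE.
- by rewrite -EE.
- by rewrite disj_set2E setIDA setIAC -setIDA setDv setI0.
rewrite (splitr e) EFinD; apply: leeD.
  have -> : (\int[mu]_(x in E `&` F k) (g x)%:E = \int[mu]_(x in E `&` F k) `|(g x)%:E|)%E.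
    by apply: eq_integral => x; rewrite inE => -[/ED Dx _]; rewrite gee0_abs// lee_fin g0.
  apply: (@le_trans _ _ (k.+1%:R%:E * mu (E `&` F k))%E).
    apply: integral_le_bound => //; first exact: measurableI.
      by apply: measurable_funS mP => //; exact: subIsetl.
    apply/aeW => x [/ED Dx [_ /= /andP[_ gk]]].
    by rewrite lee_fin ger0_norm ?g0.
  apply: le_trans (lee_wpmul2l _ sm) _ => //.
  by rewrite -EFinM lee_fin mulrC divfK.
rewrite -integral_mkcondr in small; apply: le_trans (ltW small).
apply: ge0_subset_integral => //.
- exact: measurableD.
- by apply: measurableI => //; exact: measurableC.
- by apply/measurable_EFinP; apply: measurable_funS mg => //; exact: subIsetl.
- by move=> x [Dx _] /=; rewrite lee_fin g0.
- by move=> x [/ED].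
Unshelve. all: end_near. Qed.

(** The sum of the [Phi k] is integrable, hence finite almost everywhere. *)
Lemma summable_integral_cvg0 Phi : nonneg_mfun Phi ->
  (forall k, \int[mu]_(x in D) (Phi k x)%:E <= (1 / (2 ^ k.+1)%:R)%:E)%E ->
  {ae mu, forall x, D x -> Phi ^~ x @ \oo --> (0 : R)}.
Proof.
move=> [mP P0] small.
have mP' n : measurable_fun D (EFin \o Phi n) by apply/measurable_EFinP.
have P0' n x : D x -> (0 <= (EFin \o Phi n) x)%E.
  by move=> Dx; rewrite lee_fin P0.
have := @integral_nneseries _ _ _ mu D mD _ mP' P0'.
set S := (fun x => _ : \bar R) => intS.
have mS : measurable_fun D S by apply: ge0_emeasurable_sum => // k x Dx _; exact: P0'.
have iS : mu.-integrable D S.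
  apply/integrableP; split => //.
  have S0 x : D x -> (0 <= S x)%E by move=> Dx; apply: nneseries_ge0 => k _ _; exact: P0'.
  rewrite (eq_integral S); last by move=> x; rewrite inE => /S0 Sx; rewrite gee0_abs.
  rewrite intS; apply: (@le_lt_trans _ _ 1%E); last exact: ltry.
  apply: le_trans (epsilon_trick0 xpredT (@ler01 R)).
  apply: lee_nneseries => [k _|k _]; last exact: small.
  by move=> *; apply: integral_ge0 => x Dx; exact: P0'.
have := integrable_ae mD iS; apply: filterS => x Sfin Dx.
have := Sfin Dx; rewrite ge0_fin_numE; last by apply: nneseries_ge0 => k _ _; exact: P0'.
move=> Soo; apply: cvg_series_cvg_0; apply: nondecreasing_is_cvgn.
  by apply: nondecreasing_series => k *; exact: P0.
exists (fine (S x)) => _ [k _ <-]; rewrite -lee_fin fineK; last exact: Sfin.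
rewrite /series/= -sumEFin; apply: (nneseries_lim_ge k) => i _ _; exact: P0'.
Qed.

End uniform_integrability.

(** * Subgradients of convex functions *)
Section subgradient.
Variable (R : realType).

Definition convexf (V : lmodType R) (f : V -> R) := forall (x y : V) (t : R),
  0 <= t <= 1 -> f (t *: x + (1 - t) *: y) <= t * f x + (1 - t) * f y.

Lemma strictly_convexW (V : lmodType R) (f : V -> R) :
  strictly_convex f -> convexf f.
Proof.
move=> sf x y t /andP[t0 t1].
have [->|xy] := eqVneq x y; first by rewrite -scalerDl -mulrDl !subrKC scale1r mul1r.
move: t0; rewrite le_eqVlt => /predU1P[<-|t0].
  by rewrite !scale0r !mul0r !add0r !subr0 scale1r mul1r.
move: t1; rewrite le_eqVlt => /predU1P[->|t1].
  by rewrite subrr !scale0r !mul0r !addr0 scale1r mul1r.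
by rewrite ltW// sf// t0.
Qed.

Definition diffquot (V : lmodType R) (f : V -> R) (e d : V) (t : R) : R :=
  (f (e + t *: d) - f e) / t.

(** The infimum runs over a sequence of steps instead of all positive ones, which
    is the same by monotonicity of difference quotients and keeps measurability in
    a parameter within reach. *)
Definition dirder (V : lmodType R) (f : V -> R) (e d : V) : R :=
  inf (range (fun k : nat => diffquot f e d k.+1%:R^-1)).

Definition sublinear (V : lmodType R) (q : V -> R) :=
  (forall x y, q (x + y) <= q x + q y) /\
  (forall x (c : R), 0 < c -> q (c *: x) = c * q x).

Section convex.
Variables (V : lmodType R) (f : V -> R).
Hypothesis cf : convexf f.

Lemma diffquot_nd e d s t : 0 < s -> s <= t ->
  diffquot f e d s <= diffquot f e d t.
Proof.
move=> s0 st; have t0 : 0 < t by exact: lt_le_trans st.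
rewrite /diffquot ler_pdivrMr// mulrAC ler_pdivlMr//.
have st1 : 0 <= s / t <= 1 by apply/andP; split; [rewrite divr_ge0 ?ltW | rewrite ler_pdivrMr// mul1r].
have := cf (e + t *: d) e st1.
rewrite scalerDr scalerA divfK ?gt_eqF// addrAC -scalerDl subrKC scale1r => H.
have : t * f (e + s *: d) <= t * (s / t * f (e + t *: d) + (1 - s / t) * f e).
  by rewrite ler_pM2l.
rewrite (_ : t * (s / t * _ + _) = s * f (e + t *: d) + (t - s) * f e); first lra.
by field; lra.
Qed.

(** The point [e] is a convex combination of [e - d] and [e + t *: d], so the
    backward difference bounds all forward quotients from below. *)
Lemma diffquot_lb e d t : 0 < t -> f e - f (e - d) <= diffquot f e d t.
Proof.
move=> t0; rewrite /diffquot ler_pdivlMr//.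
have t1 : 0 < 1 + t by rewrite addr_gt0.
have H01 : 0 <= t / (1 + t) <= 1.
  by apply/andP; split; [rewrite divr_ge0 ?ltW | rewrite ler_pdivrMr// mul1r; lra].
have := cf (e - d) (e + t *: d) H01.
have -> : 1 - t / (1 + t) = 1 / (1 + t) by field; lra.
have -> : (t / (1 + t)) *: (e - d) + (1 / (1 + t)) *: (e + t *: d) = e.
  rewrite !scalerDr scalerN scalerA (_ : 1 / (1 + t) * t = t / (1 + t)); last first.
    by rewrite mul1r mulrC.
  rewrite addrACA addNr addr0 -scalerDl (_ : t / (1 + t) + 1 / (1 + t) = 1) ?scale1r//.
  by field; lra.
move=> H.
have : (1 + t) * f e <= t * f (e - d) + f (e + t *: d).
  have := ler_wpM2l (ltW t1) H.
  rewrite [X in _ <= X -> _](_ : _ = t * f (e - d) + f (e + t *: d))//.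
  by field; lra.
lra.
Qed.

Let has_inf_dq e d : has_inf (range (fun k : nat => diffquot f e d k.+1%:R^-1)).
Proof.
split; first by exists (diffquot f e d 1%:R^-1); exists 0%N.
exists (f e - f (e - d)) => _ [k _ <-]; apply: diffquot_lb.
by rewrite invr_gt0.
Qed.

Lemma dirder_le e d t : 0 < t -> dirder f e d <= diffquot f e d t.
Proof.
move=> t0; have [k _ /(_ k (leqnn k)) kt] := near_infty_natSinv_lt (PosNum t0).
apply: le_trans (diffquot_nd e d _ (ltW kt)); last by rewrite invr_gt0.
by apply: ge_inf; [exact: (has_inf_dq e d).2 | exists k].
Qed.

Lemma dirder_adherent e d eps : 0 < eps ->
  exists2 t, 0 < t & diffquot f e d t < dirder f e d + eps.
Proof.
move=> e0; have [_ [k _ <-] H] := inf_adherent e0 (has_inf_dq e d).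
by exists k.+1%:R^-1 => //; rewrite invr_gt0.
Qed.

Lemma dirder_cvg e d :
  (fun k : nat => diffquot f e d k.+1%:R^-1) @ \oo --> dirder f e d.
Proof.
apply: nonincreasing_cvgn; last exact: (has_inf_dq e d).2.
move=> m k mk; apply: diffquot_nd; first by rewrite invr_gt0.
by rewrite lef_pV2 ?posrE// ler_nat.
Qed.

(** The midpoint of [e + t *: d] and [e + t *: d'] is [e] moved by half of [t] in
    the direction [d + d']. *)
Lemma dirderD e d d' : dirder f e (d + d') <= dirder f e d + dirder f e d'.
Proof.
apply/ler_addgt0Pr => eps e0; have e20 : 0 < eps / 2 by rewrite divr_gt0.
have [s s0 sd] := dirder_adherent e d e20.
have [s' s0' sd'] := dirder_adherent e d' e20.
pose t := Num.min s s'; have t0 : 0 < t by rewrite lt_min s0.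
have ts : diffquot f e d t <= diffquot f e d s.
  by apply: diffquot_nd => //; rewrite ge_min lexx.
have ts' : diffquot f e d' t <= diffquot f e d' s'.
  by apply: diffquot_nd => //; rewrite ge_min lexx orbT.
have t20 : 0 < t / 2 by rewrite divr_gt0.
have := dirder_le e (d + d') t20.
have : diffquot f e (d + d') (t / 2) <= diffquot f e d t + diffquot f e d' t.
  rewrite /diffquot -mulrDl ler_pdivrMr// -mulrA.
  have -> : t^-1 * (t / 2) = 2^-1 by rewrite mulrA mulVf ?mul1r// gt_eqF.
  have h01 : 0 <= (2 : R)^-1 <= 1 by apply/andP; split; lra.
  have := cf (e + t *: d) (e + t *: d') h01.
  have h1 : 1 - 2^-1 = 2^-1 :> R by lra.
  rewrite h1 -scalerDr addrACA -scalerDr (scalerDr 2^-1) scalerA (mulrC _ t).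
  rewrite -(mulr2n e) -(scaler_nat 2 e) scalerA mulVf ?scale1r ?pnatr_eq0//; lra.
lra.
Qed.

Lemma dirderZ e d (c : R) : 0 < c -> dirder f e (c *: d) = c * dirder f e d.
Proof.
have half x (b : R) : 0 < b -> dirder f e (b *: x) <= b * dirder f e x.
  move=> b0; apply/ler_addgt0Pr => eps e0.
  have [s s0 sd] := dirder_adherent e x (divr_gt0 e0 b0).
  have sb : 0 < s / b by rewrite divr_gt0.
  apply: le_trans (dirder_le e (b *: x) sb) _.
  rewrite /diffquot scalerA divfK ?gt_eqF//.
  have -> : (f (e + s *: x) - f e) / (s / b) = b * diffquot f e x s.
    by rewrite /diffquot invf_div mulrCA mulrA.
  have := ltW sd; rewrite -(ler_pM2l b0) => /le_trans; apply.
  by rewrite mulrDr mulrCA divff ?mulr1// gt_eqF.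
move=> c0; apply/eqP; rewrite eq_le half//=.
have ci : 0 < c^-1 by rewrite invr_gt0.
have := half (c *: d) _ ci; rewrite scalerA mulVf ?gt_eqF// scale1r.
by rewrite -(ler_pM2l c0) mulVKf ?gt_eqF.
Qed.

Lemma dirder_sublinear e : sublinear (dirder f e).
Proof. by split=> *; [exact: dirderD | exact: dirderZ]. Qed.

End convex.

Section sublinear.
Variables (V : lmodType R) (q : V -> R).
Hypothesis sq : sublinear q.

Lemma sublinear0 : q 0 = 0.
Proof.
have : q (2 *: 0) = 2 * q 0 by rewrite sq.2.
rewrite scaler0; lra.
Qed.

Lemma sublinear_convex : convexf q.
Proof.
move=> x y t /andP[]; rewrite le_eqVlt => /predU1P[<- _|t0].
  by rewrite !scale0r !mul0r !add0r !subr0 scale1r mul1r.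
rewrite le_eqVlt => /predU1P[->|t1].
  by rewrite subrr !scale0r !mul0r !addr0 scale1r mul1r.
by apply: le_trans (sq.1 _ _) _; rewrite !sq.2// subr_gt0.
Qed.

Lemma dirder_sub_le e d : dirder q e d <= q d.
Proof.
apply: le_trans (dirder_le sublinear_convex e d ltr01) _.
by rewrite /diffquot divr1 scale1r lerBlDl sq.1.
Qed.

(** Directions in which [q] is already linear stay so after differentiation. *)
Lemma dirder_odd e d : q (- d) = - q d -> dirder q e (- d) = - dirder q e d.
Proof.
move=> qd; have S := dirder_sublinear sublinear_convex e.
have := S.1 d (- d); rewrite subrr (_ : dirder q e 0 = 0); last first.
  have : dirder q e (2 *: 0) = 2 * dirder q e 0 by rewrite S.2.
  rewrite scaler0; lra.
have := dirder_sub_le e d; have := dirder_sub_le e (- d); rewrite qd; lra.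
Qed.

Lemma inf_range_cst (c : R) : inf (range (fun _ : nat => c)) = c.
Proof.
rewrite -[RHS]inf1; congr inf; apply/seteqP; split=> [_ [k _ <-]//|_ ->].
by exists 0%N.
Qed.

(** Differentiating a sublinear function at [e] makes it linear along the line of
    [e], as it is affine along this line on each side of [e]. *)
Lemma dirder_self e : dirder q e (- e) = - dirder q e e.
Proof.
have -> : dirder q e e = q e.
  rewrite /dirder (_ : (fun k => _) = fun=> q e); first exact: inf_range_cst.
  apply/funext => k; rewrite /diffquot -{1}[e]scale1r -scalerDl sq.2 ?addr_gt0 ?invr_gt0//.
  have : k.+1%:R^-1 != 0 :> R by rewrite invr_eq0.
  by move: k.+1%:R^-1 => t t0; field.
rewrite /dirder (_ : (fun k => _) = fun=> - q e); first exact: inf_range_cst.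
apply/funext => -[|k]; rewrite /diffquot.
  by rewrite invr1 scale1r subrr sublinear0 sub0r divr1.
rewrite -{1}[e]scale1r scalerN -scalerBl sq.2; last first.
  by rewrite subr_gt0 invf_lt1// ltr1n.
have : k.+2%:R^-1 != 0 :> R by rewrite invr_eq0.
by move: k.+2%:R^-1 => t t0; field.
Qed.

End sublinear.

Section iterated.
Variable (N : nat).
Local Notation V := 'rV[R]_N.
Local Notation delta i := (delta_mx 0 i : V).

(** A Hahn-Banach argument by explicit formula: each differentiation makes the
    function linear in one more coordinate direction and does not increase it. *)
Definition iter_dirder (q : V -> R) (s : seq 'I_N) : V -> R :=
  foldl (fun q i => dirder q (delta i)) q s.

Lemma iter_dirder_prop (s : seq 'I_N) (q : V -> R) : sublinear q ->
  [/\ sublinear (iter_dirder q s), forall d, iter_dirder q s d <= q d,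
      forall d, q (- d) = - q d -> iter_dirder q s (- d) = - iter_dirder q s d &
      forall i, i \in s ->
        iter_dirder q s (- delta i) = - iter_dirder q s (delta i)].
Proof.
elim: s q => [|i s IH] q sq; first by split.
have cq := sublinear_convex sq.
have [s1 le1 odd1 del1] := IH _ (dirder_sublinear cq (delta i)).
split=> //=.
- by move=> d; apply: le_trans (le1 d) _; exact: dirder_sub_le.
- by move=> d qd; apply: odd1; exact: dirder_odd.
- move=> k; rewrite inE => /predU1P[->|/del1//].
  by apply: odd1; exact: dirder_self.
Qed.

Definition subgrad (f : V -> R) (x : V) : V :=
  \row_i iter_dirder (dirder f x) (enum 'I_N) (delta i).

(** After all coordinate directions have been used, the sublinear function is
    bounded by the linear function with the same values on the coordinate
    vectors; applying this bound to [x - y] gives the subgradient inequality. *)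
Lemma subgradP (f : V -> R) (x y : V) : convexf f ->
  f x + \sum_i subgrad f x 0 i * (y - x) 0 i <= f y.
Proof.
move=> cf; set q := iter_dirder (dirder f x) (enum 'I_N).
have [sq qle _ qdel] := iter_dirder_prop (enum 'I_N) (dirder_sublinear cf x).
rewrite -/q in sq qle qdel.
have qline i c : q (c *: delta i) = c * q (delta i).
  have [c0|c0|->] := ltrgtP c 0; last by rewrite scale0r mul0r sublinear0.
    rewrite -[c]opprK scaleNr -scalerN sq.2 ?oppr_gt0// qdel ?mem_enum//.
    by rewrite mulrN !mulNr.
  by rewrite sq.2.
have qsum d : q d <= \sum_i d 0 i * q (delta i).
  rewrite [in leLHS](row_sum_delta d).
  apply: (big_rec2 (fun a b => q a <= b)) => [|i b a _ ab].
    by rewrite (sublinear0 sq).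
  by apply: le_trans (sq.1 _ _) _; rewrite qline lerD2l.
have q0 : q (y - x) <= f y - f x.
  apply: le_trans (qle _) _; apply: le_trans (dirder_le cf _ _ ltr01) _.
  by rewrite /diffquot divr1 scale1r subrKC.
have := qsum (- (y - x)); have := sq.1 (y - x) (- (y - x)).
rewrite subrr (sublinear0 sq).
rewrite (eq_bigr (fun i => - (subgrad f x 0 i * (y - x) 0 i))); last first.
  by move=> i _; rewrite /subgrad !mxE mulNr mulrC.
rewrite sumrN; lra.
Qed.

End iterated.
End subgradient.

(** * The gap between a strictly convex function and its tangent plane *)
Section convex_gap.
Variables (R : realType) (N : nat).
Local Notation V := 'rV[R]_N.

Lemma cvg_sumr (T I : Type) (F : set_system T) (s : seq I) (f : I -> T -> R)
    (l : I -> R) : Filter F -> (forall i, f i @ F --> l i) ->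
  (fun x => \sum_(i <- s) f i x) @ F --> \sum_(i <- s) l i.
Proof.
move=> FF fl; elim: s => [|i s IH].
  rewrite big_nil (_ : (fun x => _) = fun=> 0); first exact: cvg_cst.
  by apply/funext => x; rewrite big_nil.
rewrite big_cons (_ : (fun x => _) = (fun x => f i x + \sum_(j <- s) f j x)).
  exact: cvgD.
by apply/funext => x; rewrite big_cons.
Qed.

Variables (phi : R -> V -> R) (u : R) (xi a : V).
Hypotheses (cphi : continuous (fun z : R * V => phi z.1 z.2))
  (sphi : forall mu, strictly_convex (phi mu))
  (aphi : forall z, phi u xi + \sum_i a 0 i * (z - xi) 0 i <= phi u z).

Definition convex_gap (mu : R) (z : V) : R :=
  phi mu z - phi u xi - \sum_i a 0 i * (z - xi) 0 i.

Lemma convex_gap_continuous :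
  continuous (fun z : R * V => convex_gap z.1 z.2).
Proof.
move=> z; rewrite /convex_gap.
apply: cvgB; first by apply: cvgB; [exact: cphi | exact: cvg_cst].
apply: (@cvg_sumr _ _ (nbhs z) _
  (fun i (w : R * V) => a 0 i * (w.2 - xi) 0 i)
  (fun i => a 0 i * (z.2 - xi) 0 i)) => i.
apply: cvgMl_tmp.
apply: (@continuous_comp _ _ _ (fun w : R * V => w.2 - xi) (fun M : V => M 0 i));
  last exact: coord_continuous.
by apply: cvgB; [exact: cvg_snd | exact: cvg_cst].
Qed.

Lemma convex_gap_center : convex_gap u xi = 0.
Proof.
rewrite /convex_gap subrr sub0r big1 ?oppr0// => i _.
by rewrite subrr mxE mulr0.
Qed.

Lemma convex_gap_strictly_convex mu : strictly_convex (convex_gap mu).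
Proof.
move=> x y t xy t01; have := sphi mu xy t01; rewrite /convex_gap.
set S := fun z : V => \sum_i a 0 i * (z - xi) 0 i.
have -> : \sum_i a 0 i * (t *: x + (1 - t) *: y - xi) 0 i = t * S x + (1 - t) * S y.
  rewrite /S !mulr_sumr -big_split/=; apply: eq_bigr => i _; rewrite !mxE; ring.
rewrite -/(S x) -/(S y); lra.
Qed.

(** If the gap vanished at a second point, strict convexity would make it negative
    halfway. *)
Lemma convex_gap_gt0 z : z != xi -> 0 < convex_gap u z.
Proof.
move=> zxi; rewrite lt_neqAle; apply/andP; split; last first.
  by rewrite /convex_gap -addrA -opprD subr_ge0.
apply/negP => /eqP z0.
have h : 0 < (2 : R)^-1 < 1 by apply/andP; split; lra.
have := convex_gap_strictly_convex u zxi h; rewrite -z0 convex_gap_center !mulr0 addr0.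
apply/negP; rewrite -leNgt /convex_gap -addrA -opprD subr_ge0; exact: aphi.
Qed.

(** On the sphere of radius [dl] around [xi] the gap at [u] is bounded below by a
    positive constant, by compactness, and it still is for [mu] near [u].  At the
    centre it is close to 0, so by convexity along rays it is bounded below for
    every [z] outside the sphere, however large. *)
Lemma convex_gap_away (dl : R) : 0 < dl -> exists2 c, 0 < c &
  \forall mu \near u, forall z, dl <= `|z - xi| -> c <= convex_gap mu z.
Proof.
move=> dl0; pose S := [set z : V | `|z - xi| = dl].
have cS : compact S.
  apply: bounded_closed_compact.
    exists (`|xi| + dl); split; first exact: num_real.
    move=> M Mlt z /= Sz; apply/ltW/(le_lt_trans _ Mlt).
    by rewrite -[z](subrK xi) addrC (le_trans (ler_normD _ _))// Sz.
  rewrite (_ : S = (fun z => `|z - xi|) @^-1` [set dl])//.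
  apply: closed_comp; last exact: closed_eq.
  move=> z _; apply: (@continuous_comp _ _ _ (fun z : V => z - xi) Num.norm);
    last exact: norm_continuous.
  apply: continuousB; last exact: cst_continuous.
  by move=> ?.
have /compact_near_coveringP ncS := cS.
have : \forall i \near filter_prod (nbhs u) (0^'+),
    S `<=` (fun z => i.2 < convex_gap i.1 z).
  apply: ncS => z Sz.
  have zxi : z != xi.
    by apply/eqP => zx; move: Sz dl0; rewrite /S/= zx subrr normr0 => <-; rewrite ltxx.
  have g0 := convex_gap_gt0 zxi.
  have g20 : 0 < convex_gap u z / 2 by rewrite divr_gt0.
  have /= := @convex_gap_continuous (u, z).
  move=> /cvgrPdist_lt/(_ _ g20)[[A B] /= [nA nB] AB].
  exists (B, A `*` [set c | c < convex_gap u z / 2]) => /=.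
    split=> //; exists (A, [set c | c < convex_gap u z / 2]) => //=.
    split=> //; exact: nbhs_right_lt.
  move=> [z' [mu c]] /= [Bz' [Amu cl]].
  have := AB (mu, z') (conj Amu Bz'); rewrite /= ltr_norml => /andP[_]; lra.
case=> -[A B] /= [nA nB] AB.
have [c c0 Bc] : exists2 c, 0 < c & B c.
  have [c [c0 Bc]] := @filter_ex _ _ _ _ (filterI nB (nbhs_right_gt 0)).
  by exists c.
have nxi : \forall mu \near u, `|convex_gap mu xi| < c / 2.
  have c20 : 0 < c / 2 by rewrite divr_gt0.
  have : (fun mu => convex_gap mu xi) @ u --> convex_gap u xi.
    have pc : (fun mu : R => (mu, xi)) @ u --> (u, xi).
      move=> P [[A' B'] /= [nA' nB'] AB']; apply: filterS nA' => mu Amu.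
      by apply: AB'; split=> //; exact: nbhs_singleton.
    exact: (cvg_comp _ _ pc (@convex_gap_continuous (u, xi))).
  rewrite convex_gap_center => /cvgrPdist_lt/(_ _ c20).
  by apply: filterS => mu; rewrite sub0r normrN.
exists (c / 2); first by rewrite divr_gt0.
near=> mu => z zd.
have Amu : A mu by near: mu.
have gxi : `|convex_gap mu xi| < c / 2 by near: mu.
have z0 : 0 < `|z - xi| by exact: lt_le_trans zd.
pose t := dl / `|z - xi|.
have t0 : 0 < t by rewrite divr_gt0.
have t1 : t <= 1 by rewrite /t ler_pdivrMr// mul1r.
(* The point of the segment from [xi] to [z] that lies on the sphere. *)
pose z' := t *: z + (1 - t) *: xi.
have Sz' : S z'.
  rewrite /S/= (_ : z' - xi = t *: (z - xi)).
    by rewrite normrZ gtr0_norm// /t divfK// gt_eqF.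
  by rewrite /z' scalerBl scale1r scalerBr -addrA [xi - _ - xi]addrAC subrr add0r.
have gz' : c < convex_gap mu z' by apply: (AB (mu, c)).
have t01 : 0 <= t <= 1 by rewrite (ltW t0) t1.
have := strictly_convexW (@convex_gap_strictly_convex mu) z xi t01; rewrite -/z'.
move: gxi; rewrite ltr_norml => /andP[g1 g2] H.
have h1 : (1 - t) * convex_gap mu xi <= (1 - t) * (c / 2).
  by apply: ler_wpM2l; [lra | exact: ltW].
have h2 : c / 2 <= t * convex_gap mu z by nra.
have g0 : 0 <= convex_gap mu z.
  rewrite -(pmulr_rge0 _ t0); lra.
by apply: (le_trans h2); rewrite ler_piMl.
Unshelve. all: end_near. Qed.

Section along.
Variables (T : Type) (F : set_system T) (FF : ProperFilter F).
Variables (mu : T -> R) (z : T -> V).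
Hypothesis mu_u : mu @ F --> u.

(** Where [z t] is close to [xi], the gap is close to 0 by continuity; elsewhere
    it is positive. *)
Lemma convex_gap_neg_cvg : (fun t => Num.max 0 (- convex_gap (mu t) (z t))) @ F --> (0 : R).
Proof.
apply/cvgrPdist_lt => e e0.
have := @convex_gap_continuous (u, xi); rewrite /continuous_at /= convex_gap_center.
move=> /cvgrPdist_lt/(_ _ e0)[[A B] /= [nA nB] AB].
have [dl /= dl0 dlB] := iffLR (nbhs_ballP xi B) nB.
have [c c0 cH] := convex_gap_away dl0.
have mA : \forall t \near F, A (mu t) by exact: mu_u.
have mc : \forall t \near F, forall z, dl <= `|z - xi| -> c <= convex_gap (mu t) z :=
  mu_u cH.
near=> t.
have At : A (mu t) by near: t.
have ct : forall z, dl <= `|z - xi| -> c <= convex_gap (mu t) z by near: t.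
rewrite sub0r normrN ger0_norm ?le_max ?lexx// gt_max e0/=.
have [/ct cz|zd] := leP dl `|z t - xi|; first lra.
have Bz : B (z t) by apply: dlB; rewrite -ball_normE/= distrC.
by have := AB (mu t, z t) (conj At Bz); rewrite /= sub0r normrN ltr_norml => /andP[]; lra.
Unshelve. all: end_near. Qed.

Lemma convex_gap_cvg : (fun t => convex_gap (mu t) (z t)) @ F --> (0 : R) -> z @ F --> xi.
Proof.
move=> g0; apply/cvgrPdist_lt => e e0.
have [c c0 cH] := convex_gap_away e0.
have mc : \forall t \near F, forall z, e <= `|z - xi| -> c <= convex_gap (mu t) z :=
  mu_u cH.
have gc : \forall t \near F, `|0 - convex_gap (mu t) (z t)| < c by move/cvgrPdist_lt: g0; exact.
near=> t.
have ct : forall z, e <= `|z - xi| -> c <= convex_gap (mu t) z by near: t.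
have gt : `|0 - convex_gap (mu t) (z t)| < c by near: t.
rewrite distrC ltNge; apply/negP => /ct; apply/negP; rewrite -ltNge.
by move: gt; rewrite sub0r normrN => /(le_lt_trans (ler_norm _)).
Unshelve. all: end_near. Qed.

End along.
End convex_gap.

(** * Measurability of compositions and of subgradients *)
Section caratheodory_composition.
Context d (T : measurableType d) (R : realType).
Variable mu : {measure set T -> \bar R}.
Hypothesis cmu : measure_is_complete mu.
Variables (D : set T) (mD : measurable D).

(** Completeness of the measure allows for pointwise convergence outside a null
    set that need not be described further. *)
Lemma ae_cvg_measurable (h : nat -> T -> R) (f : T -> R) :
  (forall k, measurable_fun D (h k)) ->
  {ae mu, forall x, D x -> h ^~ x @ \oo --> f x} -> measurable_fun D f.
Proof.
move=> mh [Z [mZ Z0 subZ]].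
have mDZ : measurable_fun (D `\` Z) f.
  apply: (@measurable_fun_cvg _ _ _ _ h) => [k|x [Dx nZ]].
    by apply: measurable_funS (mh k) => // x [].
  by apply: contrapT => ncv; apply: nZ; apply: subZ => /= /(_ Dx).
apply/measurable_EFinP.
apply: (@ae_measurable_fun _ _ _ mu cmu D (EFin \o (f \_ (~` Z)))).
  exists Z; split=> // x /= nfx; apply: contrapT => nZ; apply: nfx => Dx.
  by rewrite /= patchE mem_set.
apply/measurable_EFinP; apply/measurable_restrict => //; exact: measurableC.
Qed.

(** Rounding to a countable grid: on the set where the rounded arguments take
    given values, a composition reduces to [j] with constant arguments. *)
Definition grid (k : nat) (r : R) : R := (Num.floor (r * k.+1%:R))%:~R / k.+1%:R.

Lemma grid_dist k r : `|r - grid k r| <= k.+1%:R^-1.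
Proof.
have k0 : 0 < k.+1%:R :> R by [].
have : r - grid k r = (r * k.+1%:R - (Num.floor (r * k.+1%:R))%:~R) / k.+1%:R.
  by rewrite /grid mulrBl mulfK// gt_eqF.
have /andP[f1 f2] := floor_itv (r * k.+1%:R).
move=> ->; rewrite normrM normfV (ger0_norm (ltW k0)) ger0_norm ?subr_ge0//.
rewrite ler_piMl ?invr_ge0//; move: f2; rewrite intrD; lra.
Qed.

Variable N : nat.
Local Notation V := 'rV[R]_N.

Lemma cvg_inv_natS (r : nat -> V) (l : V) :
  (forall k, `|l - r k| <= k.+1%:R^-1) -> r @ \oo --> l.
Proof.
move=> rl; apply/cvgrPdist_lt => e e0.
have [K _ KP] := near_infty_natSinv_lt (PosNum e0); exists K => // k /= Kk.
by apply: le_lt_trans (rl k) (KP _ Kk).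
Qed.

Variable j : T -> R -> V -> R.
Hypothesis mj : forall m xi, measurable_fun D (fun x => j x m xi).
Hypothesis cj : {ae mu, forall x, D x -> continuous (fun z : R * V => j x z.1 z.2)}.
Variables (v : T -> R) (w : T -> V).
Hypothesis mv : measurable_fun D v.
Hypothesis mw : forall i, measurable_fun D (fun x => w x 0 i).

Let measurable_cell (g : T -> R) k (a : int) : measurable_fun D g ->
  measurable (D `&` [set x | Num.floor (g x * k.+1%:R) = a]).
Proof.
move=> mg; rewrite (_ : [set x | _] =
  (fun x => g x * k.+1%:R) @^-1` `[a%:~R, (a + 1)%:~R[%classic).
  have mgk : measurable_fun D (fun x => g x * k.+1%:R) by exact: measurable_funM.
  exact: mgk.
by apply/seteqP; split=> x /=; rewrite in_itv /= -floor_eq => /eqP.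
Qed.

Lemma measurable_caratheodory : measurable_fun D (fun x => j x (v x) (w x)).
Proof.
pose gw k x : V := \row_i grid k (w x 0 i).
apply: (@ae_cvg_measurable (fun k x => j x (grid k (v x)) (gw k x))).
  move=> k _ B mB.
  (* One cell for each vector of integer values of the rounded arguments. *)
  pose G (c : int * 'rV[int]_N) : set T :=
    (D `&` [set x | Num.floor (v x * k.+1%:R) = c.1]) `&`
    (D `&` \bigcap_(i in [set: 'I_N]) (D `&` [set x | Num.floor (w x 0 i * k.+1%:R) = c.2 0 i])) `&`
    (D `&` (fun x => j x (c.1%:~R / k.+1%:R) (\row_i ((c.2 0 i)%:~R / k.+1%:R))) @^-1` B).
  rewrite (_ : _ `&` _ = \bigcup_c G c); last first.
    apply/seteqP; split=> x.
      move=> [Dx Bx].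
      exists (Num.floor (v x * k.+1%:R), \row_i Num.floor (w x 0 i * k.+1%:R)) => //.
      split; [split|]; split=> //=.
        by move=> i _; split => //=; rewrite mxE.
      rewrite (_ : \row_i _ = gw k x)//.
      by apply/rowP => i; rewrite !mxE.
    move=> [c _ [[[Dx /= vc] [_ wc]] [_ /= Bx]]]; split=> //=.
    rewrite /grid vc (_ : gw k x = \row_i ((c.2 0 i)%:~R / k.+1%:R))//.
    by apply/rowP => i; rewrite !mxE /grid; have [_ /= ->] := wc i I.
  apply: countable_bigcupT_measurable; first exact: countableP.
  move=> c; apply: measurableI; last exact: mj.
  apply: measurableI; first exact: measurable_cell.
  apply: measurableI => //.
  apply: fin_bigcap_measurable; first exact: finite_finset.
  by move=> i _; exact: measurable_cell.
apply: filterS cj => x cx Dx.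
have gv : (fun k => grid k (v x)) @ \oo --> v x.
  apply/cvgrPdist_lt => e e0.
  have [K _ KP] := near_infty_natSinv_lt (PosNum e0); exists K => // k /= Kk.
  by apply: le_lt_trans (grid_dist k _) (KP _ Kk).
have gwx : gw ^~ x @ \oo --> w x.
  apply: cvg_inv_natS => k; rewrite /Num.norm/= mx_normrE.
  apply/bigmax_leP; split=> [|[i i'] _ /=]; first by rewrite invr_ge0.
  by rewrite !mxE ord1 grid_dist.
have gvw : (fun k => (grid k (v x), gw k x)) @ \oo --> (v x, w x).
  exact: (@cvg_pair _ _ _ \oo (nbhs (v x)) (nbhs (w x)) _ _ _ _ _ gv gwx).
exact: (cvg_comp _ _ gvw (cx Dx (v x, w x))).
Qed.

End caratheodory_composition.

Section subgrad_measurable.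
Context d (T : measurableType d) (R : realType).
Variable mu : {measure set T -> \bar R}.
Hypothesis cmu : measure_is_complete mu.
Variables (D : set T) (mD : measurable D) (N : nat).
Local Notation V := 'rV[R]_N.

Lemma measurable_dirder (q : T -> V -> R) (w : T -> V) (e : V) :
  {ae mu, forall x, D x -> convexf (q x)} ->
  (forall t : R, measurable_fun D (fun x => q x (w x + t *: e))) ->
  measurable_fun D (fun x => dirder (q x) (w x) e).
Proof.
move=> cq mq.
apply: (@ae_cvg_measurable _ _ _ mu cmu D mD
  (fun k x => diffquot (q x) (w x) e k.+1%:R^-1)).
  move=> k; apply: measurable_funM => //; apply: measurable_funB => //.
  have := mq 0; apply: eq_measurable_fun => x _.
  by rewrite scale0r addr0.
by apply: filterS cq => x cx Dx; apply: dirder_cvg; exact: cx.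
Qed.

Lemma measurable_iter_dirder (s : seq 'I_N) (q : T -> V -> R) (e : V) :
  {ae mu, forall x, D x -> sublinear (q x)} ->
  (forall e, measurable_fun D (fun x => q x e)) ->
  measurable_fun D (fun x => iter_dirder (q x) s e).
Proof.
elim: s q => [|i s IH] q sq mq /=; first exact: mq.
apply: (IH (fun x => dirder (q x) (delta_mx 0 i))).
  apply: filterS sq => x sx Dx; apply: dirder_sublinear.
  by apply: sublinear_convex; exact: sx.
move=> e'; apply: (@measurable_dirder q (fun=> delta_mx 0 i)) => //.
by apply: filterS sq => x sx Dx; apply: sublinear_convex; exact: sx.
Qed.

Lemma measurable_subgrad (j : T -> R -> V -> R) (v : T -> R) (w : T -> V) i :
  (forall m xi, measurable_fun D (fun x => j x m xi)) ->
  {ae mu, forall x, D x -> continuous (fun z : R * V => j x z.1 z.2)} ->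
  {ae mu, forall x, D x -> forall m, convexf (j x m)} ->
  measurable_fun D v -> (forall i, measurable_fun D (fun x => w x 0 i)) ->
  measurable_fun D (fun x => subgrad (j x (v x)) (w x) 0 i).
Proof.
move=> mj cj cvj mv mw.
rewrite (_ : (fun x => _) = fun x =>
  iter_dirder (dirder (j x (v x)) (w x)) (enum 'I_N) (delta_mx 0 i)); last first.
  by apply/funext => x; rewrite mxE.
apply: measurable_iter_dirder.
  by apply: filterS cvj => x cx Dx; apply: dirder_sublinear; exact: cx.
move=> e; apply: measurable_dirder.
  by apply: filterS cvj => x cx Dx; exact: cx.
move=> t; apply: (measurable_caratheodory cmu mD mj cj mv) => k.
rewrite (_ : (fun x => _) = (fun x => w x 0 k + t * e 0 k)).
  exact: measurable_funD.
by apply/funext => x; rewrite !mxE.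
Qed.

End subgrad_measurable.

Lemma integrableZ_EFin d (T : measurableType d) (R : realType)
    (mu : {measure set T -> \bar R}) (D : set T) (g : T -> R) (c : R) :
  measurable D -> mu.-integrable D (EFin \o g) ->
  mu.-integrable D (EFin \o (fun x => c * g x)).
Proof.
move=> mD ig; rewrite (_ : EFin \o _ = fun x => (c%:E * (EFin \o g) x)%E).
  exact: integrableZl.
by apply/funext => x; rewrite /= EFinM.
Qed.

(** * Semicontinuity of convex integrals *)
Section semicontinuity.
Context d (T : measurableType d) (R : realType).
Variable mu : {measure set T -> \bar R}.
Hypothesis cmu : measure_is_complete mu.
Variables (D : set T) (mD : measurable D) (N : nat).
Local Notation V := 'rV[R]_N.
Variables (j : T -> R -> V -> R) (exh : nat -> set T).
Hypotheses (mj : forall m xi, measurable_fun D (fun x => j x m xi))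
  (cj : forall x, D x -> continuous (fun z : R * V => j x z.1 z.2))
  (sj : forall x, D x -> forall m, strictly_convex (j x m)).
Hypotheses (mexh : forall k, measurable (exh k)) (ndexh : nondecreasing_seq exh)
  (exhoo : forall k, (mu (exh k) < +oo)%E) (exhD : D `<=` \bigcup_k exh k).
Variables (un : nat -> T -> R) (u : T -> R) (wn : nat -> T -> V) (w : T -> V).
Hypotheses (mun : forall n, measurable_fun D (un n)) (mu_ : measurable_fun D u)
  (mwn : forall n i, measurable_fun D (fun x => wn n x 0 i))
  (mw : forall i, measurable_fun D (fun x => w x 0 i)).
Hypothesis unu : forall x, D x -> un ^~ x @ \oo --> u x.
Variables (l K : nat -> T -> R).
Hypotheses (hl : nonneg_mfun D l) (ul : unif_small mu D l)
  (il : forall n, mu.-integrable D (EFin \o l n))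
  (hK : nonneg_mfun D K) (uK : unif_small mu D K)
  (iK : forall n, mu.-integrable D (EFin \o K n))
  (jl : forall n x, D x -> - l n x <= j x (un n x) (wn n x))
  (wK : forall n x i, D x -> `|wn n x 0 i| <= 1 + K n x).
Hypothesis weak : forall (A : set T) (a : T -> V) (M : R), measurable A ->
  A `<=` D -> (mu A < +oo)%E -> (forall i, measurable_fun D (fun x => a x 0 i)) ->
  (forall x i, A x -> `|a x 0 i| <= M) ->
  (fun n => \int[mu]_(x in A) (\sum_i a x 0 i * (wn n x - w x) 0 i)) @ \oo --> (0 : R).

Let f x := j x (u x) (w x).
Let jn n x := j x (un n x) (wn n x).
Let a x := subgrad (j x (u x)) (w x).
Let gap n x := convex_gap (j x) (u x) (w x) (a x) (un n x) (wn n x).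
Let lin n x := \sum_i a x 0 i * (wn n x - w x) 0 i.
(* The sets [A k] exhaust [D] and have finite measure; on them [f], [a] and [w] are
   bounded by [k]. *)
Let A k := D `&` (exh k `&` ([set x | `|f x| <= k%:R] `&`
  [set x | forall i, `|a x 0 i| <= k%:R /\ `|w x 0 i| <= k%:R])).

Let subrowE (y z : V) i : (y - z) 0 i = y 0 i - z 0 i.
Proof. by rewrite !mxE. Qed.

Let AD k : A k `<=` D. Proof. by move=> x []. Qed.

Let mf : measurable_fun D f.
Proof.
by apply: (measurable_caratheodory cmu mD mj _ mu_ mw); apply: aeW.
Qed.

Let mjn n : measurable_fun D (jn n).
Proof.
by apply: (measurable_caratheodory cmu mD mj _ (mun n) (mwn n)); apply: aeW.
Qed.

Let ma i : measurable_fun D (fun x => a x 0 i).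
Proof.
apply: (measurable_subgrad cmu mD i mj) => //; apply: aeW => // x Dx m.
by apply: strictly_convexW; exact: sj.
Qed.

Let mlin n : measurable_fun D (lin n).
Proof.
apply: measurable_sum => i; apply: measurable_funM => //.
rewrite (_ : (fun x => _) = fun x => wn n x 0 i - w x 0 i).
  exact: measurable_funB.
by apply/funext => x; rewrite !mxE.
Qed.

Let gapE n x : gap n x = jn n x - f x - lin n x.
Proof. by []. Qed.

Let mgap n : measurable_fun D (gap n).
Proof.
rewrite (_ : gap n = (jn n \- f) \- lin n)//.
by apply: measurable_funB => //; exact: measurable_funB.
Qed.

Let measurable_norm_le (g : T -> R) (c : R) : measurable_fun D g ->
  measurable (D `&` [set x | `|g x| <= c]).
Proof.
move=> mg; have mng : measurable_fun D (fun x => `|g x|) by exact: measurableT_comp.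
rewrite (_ : [set x | _] = (fun x => `|g x|) @^-1` `]-oo, c]%classic); first exact: mng.
by apply/seteqP; split=> x /=; rewrite in_itv.
Qed.

Let mA k : measurable (A k).
Proof.
rewrite /A (_ : _ `&` _ = exh k `&` ((D `&` [set x | `|f x| <= k%:R]) `&`
  (D `&` \bigcap_(i in [set: 'I_N]) ((D `&` [set x | `|a x 0 i| <= k%:R]) `&`
    (D `&` [set x | `|w x 0 i| <= k%:R]))))); last first.
  apply/seteqP; split=> x.
    move=> [Dx [ex [fx aw]]]; split=> //; split=> //; split=> // i _.
    by have [ai wi] := aw i; split.
  by move=> [ex [[Dx fx] [_ aw]]]; split=> //; split=> //; split=> // i;
     have [[_ ai] [_ wi]] := aw i I.
apply: measurableI => //; apply: measurableI; first exact: measurable_norm_le.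
apply: measurableI => //; apply: fin_bigcap_measurable; first exact: finite_finset.
by move=> i _; apply: measurableI; exact: measurable_norm_le.
Qed.

Let Aoo k : (mu (A k) < +oo)%E.
Proof.
apply: le_lt_trans (exhoo k); apply: le_measure; rewrite ?inE//.
by move=> x [_ []].
Qed.

Let ndA : nondecreasing_seq A.
Proof.
move=> m k mk; apply/subsetPset => x [Dx [ex [fx aw]]].
have mkR : m%:R <= k%:R :> R by rewrite ler_nat.
split=> //; split; first by have /subsetPset := ndexh mk; exact.
split=> [|i]; first exact: le_trans fx mkR.
by have [ai wi] := aw i; split; [exact: le_trans ai mkR|exact: le_trans wi mkR].
Qed.

Let near_natr_ge (c : R) : \forall k \near \oo, c <= k%:R.
Proof. exact: nbhs_infty_ger. Qed.

Let near_A x : D x -> \forall k \near \oo, A k x.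
Proof.
move=> Dx; have [k0 _ ek0] := exhD Dx.
pose S : R := `|f x| + \sum_i (`|a x 0 i| + `|w x 0 i|).
near=> k.
have Sk : S <= k%:R by near: k; exact: near_natr_ge.
have S0 : 0 <= \sum_i (`|a x 0 i| + `|w x 0 i|) by apply: sumr_ge0 => i _; rewrite addr_ge0.
have Si i : `|a x 0 i| + `|w x 0 i| <= \sum_i (`|a x 0 i| + `|w x 0 i|).
  by rewrite (bigD1 i)//= lerDl sumr_ge0// => k' _; rewrite addr_ge0.
split=> //; split.
  have k0k : (k0 <= k)%N by near: k; exact: nbhs_infty_ge.
  by have /subsetPset := ndexh k0k; apply.
split=> [|i] /=; first by apply: le_trans Sk; rewrite lerDl.
have := Si i; have := normr_ge0 (a x 0 i); have := normr_ge0 (w x 0 i).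
by have := normr_ge0 (f x); rewrite /S in Sk; split; lra.
Unshelve. all: end_near. Qed.

Let DA : D `<=` \bigcup_k A k.
Proof.
move=> x /near_A[k _ kA]; exists k => //; exact: kA (leqnn k).
Qed.

Let bigcupA : \bigcup_k A k = D.
Proof. by apply/seteqP; split=> // x [k _] /AD. Qed.

Let aP x z : D x -> f x + \sum_i a x 0 i * (z - w x) 0 i <= j x (u x) z.
Proof. by move=> Dx; apply: subgradP; apply: strictly_convexW; exact: sj. Qed.

Lemma unif_smallS (B : set T) (Phi : nat -> T -> R) : measurable B -> B `<=` D ->
  unif_small mu D Phi -> unif_small mu B Phi.
Proof.
move=> mB BD uP e e0; have [F [dl [mF FD Foo dl0 H]]] := uP e e0.
exists (F `&` B), dl; split=> //; first exact: measurableI.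
  apply: le_lt_trans Foo; apply: le_measure; rewrite ?inE//; exact: measurableI.
move=> n E mE EB sm; apply: H => //; first exact: subset_trans BD.
by rewrite -(setIidl EB) -setIA (setIC B).
Qed.

Let gap_neg n x := Num.max 0 (- gap n x).

Let gap_neg_cvg x : D x -> gap_neg ^~ x @ \oo --> (0 : R).
Proof.
move=> Dx; apply: convex_gap_neg_cvg; last exact: unu.
- exact: cj.
- exact: sj.
- by move=> z; exact: aP.
Qed.

Let linle n k x : A k x -> `|lin n x| <= N%:R * (k%:R * (1 + K n x + k%:R)).
Proof.
move=> [Dx [_ [_ aw]]]; apply: le_trans (ler_norm_sum _ _ _) _.
rewrite (_ : N%:R * _ = \sum_(i < N) (k%:R * (1 + K n x + k%:R))); last first.
  by rewrite sumr_const card_ord mulr_natl.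
apply: ler_sum => i _; rewrite normrM subrowE; have [ai wi] := aw i.
apply: ler_pM => //; apply: le_trans (ler_normB _ _) _.
by apply: lerD => //; exact: wK.
Qed.

Let nonneg_mfunA k (Phi : nat -> T -> R) : nonneg_mfun D Phi -> nonneg_mfun (A k) Phi.
Proof.
move=> [mP P0]; split=> n; first by apply: measurable_funS (mP n).
by move=> x /AD; exact: P0.
Qed.

Let iA k (g : T -> R) : mu.-integrable D (EFin \o g) -> mu.-integrable (A k) (EFin \o g).
Proof. by move=> ig; apply: integrableS ig. Qed.

Let icst k (c : R) : mu.-integrable (A k) (EFin \o cst c).
Proof.
apply: measurable_bounded_integrable => //.
exists `|c|; split; first exact: num_real.
by move=> y cy x _ /=; exact: ltW.
Qed.

Let unif_small_cstA k (c : R) : 0 <= c -> unif_small mu (A k) (fun=> cst c).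
Proof.
by move=> c0; apply: unif_small_integrable => //; exact: icst.
Qed.

Let hgap_neg k : nonneg_mfun (A k) gap_neg.
Proof.
split=> n; last by move=> x _; rewrite le_max lexx.
apply: measurable_maxr => //; apply: measurableT_comp => //.
by apply: measurable_funS (mgap n).
Qed.

(** On [A k] the negative part of the gap is dominated by [l n] plus a multiple of
    [K n] plus a constant, so the theorem of Vitali applies to it. *)
Let int_gap_neg k : (fun n => \int[mu]_(x in A k) (gap_neg n x)%:E)%E @ \oo --> 0%E.
Proof.
apply: unif_small_vitali => //; last by apply: aeW => x /AD; exact: gap_neg_cvg.
pose c : R := k%:R + N%:R * (k%:R * (1 + k%:R)).
have c0 : 0 <= c by rewrite addr_ge0// !mulr_ge0// addr_ge0.
pose b : R := N%:R * k%:R.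
have b0 : 0 <= b by rewrite mulr_ge0.
have hcst : nonneg_mfun (A k) (fun=> cst c) by split.
have hbK : nonneg_mfun (A k) (fun n x => b * K n x).
  by apply: nonneg_mfunZ => //; exact: nonneg_mfunA.
have hlA := nonneg_mfunA k hl.
pose Psi n := (l n \+ ((fun x => b * K n x) \+ cst c)).
apply: (@unif_small_le _ _ _ _ _ _ _ Psi) => //.
- by apply: nonneg_mfunD => //; exact: nonneg_mfunD.
- move=> n x Ax; rewrite /Psi/= ge_max; apply/andP; split.
    by rewrite !addr_ge0 ?hlA.2 ?hbK.2.
  have := linle n Ax; have [Dx [_ [fx _]]] := Ax; rewrite gapE.
  have := jl n Dx; rewrite -/(jn n x).
  move: fx; rewrite /= ler_norml => /andP[f1 f2] j1.
  rewrite ler_norml => /andP[l1 l2].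
  rewrite /c /b; rewrite (_ : N%:R * (k%:R * (1 + K n x + k%:R)) =
    N%:R * k%:R * K n x + N%:R * (k%:R * (1 + k%:R))) in l2; last by ring.
  lra.
- apply: unif_smallD => //; first by exact: nonneg_mfunD.
    exact: unif_smallS ul.
  apply: unif_smallD => //; last exact: unif_small_cstA.
  by apply: unif_smallZ => //; [exact: nonneg_mfunA|exact: unif_smallS uK].
Qed.

Let iF k : mu.-integrable (A k) (EFin \o f).
Proof.
apply: (@le_integrable _ _ _ _ _ _ _ (EFin \o cst k%:R)) => //.
- by apply/measurable_EFinP; apply: measurable_funS mf.
- by move=> x [_ [_ [fx _]]] /=; rewrite lee_fin (ger0_norm (ler0n _ _)).
Qed.

Let ilin n k : mu.-integrable (A k) (EFin \o lin n).
Proof.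
apply: (@le_integrable _ _ _ _ _ _ _
  (EFin \o (fun x => N%:R * k%:R * K n x + N%:R * (k%:R * (1 + k%:R))))) => //.
- by apply/measurable_EFinP; apply: measurable_funS (mlin n).
- move=> x Ax /=; have := linle n Ax; rewrite lee_fin => /le_trans; apply.
  by apply: le_trans (ler_norm _); rewrite le_eqVlt; apply/orP; left; apply/eqP; ring.
- rewrite (_ : EFin \o _ = (fun x => (N%:R * k%:R)%R%:E * (EFin \o K n) x) \+
     (EFin \o cst (N%:R * (k%:R * (1 + k%:R)))%R))%E; last first.
    by apply/funext => x; rewrite /= EFinD EFinM.
  by apply: integrableD => //; apply: integrableZl => //; exact: iA.
Qed.

Section integrable_values.
Hypothesis ijn : forall n, mu.-integrable D (EFin \o jn n).

Let igap n k : mu.-integrable (A k) (EFin \o gap n).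
Proof.
rewrite (_ : EFin \o _ = (EFin \o jn n) \- (EFin \o f) \- (EFin \o lin n))%E//.
by apply: integrableB => //; apply: integrableB => //; exact: iA.
Qed.

Let igapn n k : mu.-integrable (A k) (EFin \o gap_neg n).
Proof.
apply: (@le_integrable _ _ _ _ _ _ _ (EFin \o gap n)) => //.
- by apply/measurable_EFinP; have [] := hgap_neg k.
- move=> x _ /=; rewrite lee_fin [leLHS]ger0_norm ?le_max ?lexx// ge_max.
  by rewrite normr_ge0 -normrN ler_norm.
Qed.

(** Integrate [jn n = f + lin n + gap n] over [A k].  The linear term tends to 0
    by weak convergence, the integral of [gap n] differs from that of its absolute
    value by twice the negative part, and [tau] bounds the loss outside [A k]. *)
Lemma semicontinuity_gap k (tau : R) :
  (forall n, (\int[mu]_(x in D `\` A k) (l n x)%:E <= tau%:E)%E) ->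
  forall e : R, 0 < e -> \forall n \near \oo,
    \int[mu]_(x in A k) f x + \int[mu]_(x in A k) `|gap n x| <=
    \int[mu]_(x in D) jn n x + tau + e.
Proof.
move=> tauP e e0.
have e40 : 0 < e / 4 by rewrite divr_gt0.
have wk : (fun n => \int[mu]_(x in A k) lin n x) @ \oo --> (0 : R).
  apply: (@weak (A k) a k%:R) => // x i [_ [_ [_ aw]]]; exact: (aw i).1.
have ign : \forall n \near \oo, (\int[mu]_(x in A k) (gap_neg n x)%:E < (e / 4)%:E)%E.
  exact: cvge0_lt (int_gap_neg k) e40.
move/cvgrPdist_lt/(_ _ e40) : wk => wk.
near=> n.
have w1 : `|0 - \int[mu]_(x in A k) lin n x| < e / 4 by near: n.
have g1 : (\int[mu]_(x in A k) (gap_neg n x)%:E < (e / 4)%:E)%E by near: n.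
have g2 : \int[mu]_(x in A k) gap_neg n x < e / 4.
  by rewrite -lte_fin /Rintegral fineK//; exact: (integrable_fin_num (mA k) (igapn n k)).
have iabs : mu.-integrable (A k) (EFin \o (fun x => `|gap n x|)) by exact: integrable_norm.
have E1 : \int[mu]_(x in A k) `|gap n x| =
    \int[mu]_(x in A k) gap n x + 2 * \int[mu]_(x in A k) gap_neg n x.
  rewrite -RintegralZl// -RintegralD//; last first.
    exact: integrableZ_EFin.
  apply: eq_Rintegral => x _; rewrite /gap_neg; have [g0|g0] := leP 0 (gap n x).
    rewrite ger0_norm// (max_idPl _) ?mulr0 ?addr0//; lra.
  by rewrite ltr0_norm// (max_idPr _); lra.
have E2 : \int[mu]_(x in A k) gap n x = \int[mu]_(x in A k) jn n x -
    \int[mu]_(x in A k) f x - \int[mu]_(x in A k) lin n x.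
  have -> : gap n = (jn n \- f) \- lin n by [].
  rewrite RintegralB//; last by apply: (@integrableB _ _ _ _ _ _ (EFin \o jn n) (EFin \o f)) => //; exact: iA.
  by rewrite RintegralB//; exact: iA.
have mDA : measurable (D `\` A k) by exact: measurableD.
have E3 : \int[mu]_(x in D) jn n x = \int[mu]_(x in A k) jn n x +
    \int[mu]_(x in D `\` A k) jn n x.
  rewrite -Rintegral_setU//.
  - by rewrite setDUK.
  - by rewrite setDUK.
  - by rewrite disj_set2E setDIK.
have E4 : - tau <= \int[mu]_(x in D `\` A k) jn n x.
  have ilA : mu.-integrable (D `\` A k) (EFin \o l n) by apply: integrableS (il n).
  have := tauP n; rewrite -[X in (X <= _)%E]fineK; last exact: (integrable_fin_num mDA ilA).
  rewrite lee_fin -/(Rintegral _ _ _) => t1.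
  apply: (@le_trans _ _ (- \int[mu]_(x in D `\` A k) l n x)); first by rewrite lerN2.
  rewrite -mulN1r -RintegralZl//; apply: le_Rintegral => //.
  - exact: integrableZ_EFin.
  - by apply: integrableS (ijn n).
  - by move=> x [Dx _]; rewrite mulN1r; exact: jl.
move: w1; rewrite sub0r normrN ltr_norml => /andP[w1 w2].
rewrite E1 E2; lra.
Unshelve. all: end_near. Qed.

Variable l0 : T -> R.
Hypotheses (l0_ge0 : forall x, D x -> 0 <= l0 x)
  (il0 : mu.-integrable D (EFin \o l0)) (fl0 : forall x, D x -> - l0 x <= f x).

Let tail_l := unif_small_tail mD hl ul mA ndA DA.

(** The function [f + l0] is nonnegative, so its integral over [D] is the limit of
    its integrals over [A k] even before [f] is known to be integrable. *)
Lemma semicontinuity_integral (c : R) :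
  (\forall n \near \oo, \int[mu]_(x in D) jn n x <= c) ->
  mu.-integrable D (EFin \o f) /\ \int[mu]_(x in D) f x <= c.
Proof.
move=> jc.
have fA e : 0 < e -> \forall k \near \oo, \int[mu]_(x in A k) f x <= c + e.
  move=> e0; have e20 : 0 < e / 2 by rewrite divr_gt0.
  apply: filterS (tail_l e20) => k /semicontinuity_gap/(_ _ e20) h.
  have [n [jcn]] := filter_ex (filterI jc h).
  have : 0 <= \int[mu]_(x in A k) `|gap n x| by exact: Rintegral_ge0.
  by move=> /= ? ?; lra.
pose g x := f x + l0 x.
have g0 x : D x -> 0 <= g x by move=> /fl0; rewrite /g; lra.
have ml0 : measurable_fun D l0 by apply/measurable_EFinP; exact: measurable_int il0.
have mg : measurable_fun D g by exact: measurable_funD.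
have cvA : (fun k => \int[mu]_(x in A k) (g x)%:E)%E @ \oo -->
    (\int[mu]_(x in D) (g x)%:E)%E.
  rewrite -[in X in _ --> X]bigcupA; apply: ge0_nondecreasing_set_cvg_integral => //.
    move=> k; apply/measurable_EFinP; exact: measurable_funS mg.
  by move=> k x /AD Dx; rewrite lee_fin g0.
have gle e : 0 < e -> (\int[mu]_(x in D) (g x)%:E <=
    (c + e + \int[mu]_(x in D) l0 x)%:E)%E.
  move=> e0; rewrite -(cvg_lim _ cvA)//; apply: lime_le; first by apply/cvg_ex; eexists; exact: cvA.
  near=> k.
  have fk : \int[mu]_(x in A k) f x <= c + e by near: k; exact: fA.
  have igA : mu.-integrable (A k) (EFin \o g).
    rewrite (_ : EFin \o g = (EFin \o f) \+ (EFin \o l0))%E//.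
    by apply: integrableD => //; exact: iA.
  rewrite -[X in (X <= _)%E]fineK; last exact: (integrable_fin_num (mA k) igA).
  rewrite lee_fin -/(Rintegral _ _ _).
  have -> : \int[mu]_(x in A k) g x = \int[mu]_(x in A k) f x + \int[mu]_(x in A k) l0 x.
    by rewrite -RintegralD//; exact: iA.
  apply: lerD => //.
  have -> : \int[mu]_(x in D) l0 x = \int[mu]_(x in A k) l0 x + \int[mu]_(x in D `\` A k) l0 x.
    rewrite -Rintegral_setU// ?setDUK//; last by rewrite disj_set2E setDIK.
    exact: measurableD.
  by rewrite lerDl; apply: Rintegral_ge0 => x [/l0_ge0].
have ig : mu.-integrable D (EFin \o g).
  apply/integrableP; split; first exact/measurable_EFinP.
  apply: le_lt_trans (le_lt_trans (gle _ ltr01) (ltry _)).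
  rewrite le_eqVlt; apply/orP; left; apply/eqP; apply: eq_integral => x.
  by rewrite inE => Dx /=; rewrite ger0_norm// g0.
have if_ : mu.-integrable D (EFin \o f).
  rewrite (_ : EFin \o f = (EFin \o g) \- (EFin \o l0))%E.
    exact: integrableB.
  by apply/funext => x; rewrite /g /= -EFinB addrK.
split=> //; apply/ler_addgt0Pr => e e0.
have := gle _ e0; rewrite -[X in (X <= _)%E]fineK; last exact: (integrable_fin_num mD ig).
rewrite lee_fin -/(Rintegral _ _ _).
have -> : \int[mu]_(x in D) g x = \int[mu]_(x in D) f x + \int[mu]_(x in D) l0 x.
  by rewrite -RintegralD.
lra.
Unshelve. all: end_near. Qed.

Hypothesis if_ : mu.-integrable D (EFin \o f).
Hypothesis limsup_le : forall e : R, 0 < e -> \forall n \near \oo,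
  \int[mu]_(x in D) jn n x <= \int[mu]_(x in D) f x + e.

Let gap_L1 k (e : R) : 0 < e ->
  \forall n \near \oo, \int[mu]_(x in A k) `|gap n x| <= e.
Proof.
have aux (p q r s t : R) : p + q <= r + t / 4 + t / 4 ->
    r <= s + t / 4 -> s <= p + t / 4 -> q <= t by lra.
move=> e0; have e40 : 0 < e / 4 by rewrite divr_gt0.
have inf_ := integrable_norm if_.
have uf : unif_small mu D (fun=> fun x => `|f x|) by exact: unif_small_integrable.
have hf : nonneg_mfun D (fun=> fun x => `|f x|).
  by split=> // n; exact: measurableT_comp.
have [m [tm [fm km]]] := filter_ex (filterI (tail_l e40)
  (filterI (unif_small_tail mD hf uf mA ndA DA e40) (nbhs_infty_ge k))).
have mDA : measurable (D `\` A m) by exact: measurableD.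
have fAm : \int[mu]_(x in D) f x <= \int[mu]_(x in A m) f x + e / 4.
  have -> : \int[mu]_(x in D) f x = \int[mu]_(x in A m) f x + \int[mu]_(x in D `\` A m) f x.
    rewrite -Rintegral_setU// ?setDUK//; first by rewrite disj_set2E setDIK.
  have ifD : mu.-integrable (D `\` A m) (EFin \o f) by apply: integrableS if_.
  rewrite lerD2l; apply: le_trans (ler_norm _) _.
  apply: le_trans (le_normr_Rintegral mDA ifD) _.
  have := fm 0%N; rewrite -[X in (X <= _)%E]fineK; last first.
    exact: (integrable_fin_num mDA (integrable_norm ifD)).
  by rewrite lee_fin.
near=> n.
have jn1 : \int[mu]_(x in D) jn n x <= \int[mu]_(x in D) f x + e / 4.
  by near: n; exact: limsup_le.
have H : \int[mu]_(x in A m) f x + \int[mu]_(x in A m) `|gap n x| <=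
    \int[mu]_(x in D) jn n x + e / 4 + e / 4.
  by near: n; exact: semicontinuity_gap.
apply: (@le_trans _ _ (\int[mu]_(x in A m) `|gap n x|)); last exact: (aux _ _ _ _ _ H jn1 fAm).
have Akm : A k `<=` A m by have /subsetPset := ndA km.
have im : mu.-integrable (A m) (EFin \o (fun x => `|gap n x|)) by apply: integrable_norm; exact: igap.
rewrite /Rintegral fine_le//.
- exact: (integrable_fin_num (mA k) (integrable_norm (igap n k))).
- exact: (integrable_fin_num (mA m) im).
- by apply: ge0_subset_integral => //; have /integrableP[] := im.
Unshelve. all: end_near. Qed.

(** If the integrals of [jn n] do not exceed that of [f] in the limit, nothing is
    left for [gap n] in [semicontinuity_gap].  A diagonal choice makes its integral
    over [A k] summable in [k], and almost every point eventually lies in [A k]. *)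
Lemma semicontinuity_strong : exists s : nat -> nat, (forall k, (k <= s k)%N) /\
  {ae mu, forall x, D x -> (fun k => wn (s k) x) @ \oo --> w x}.
Proof.
have hs k : exists n, (k <= n)%N /\ \int[mu]_(x in A k) `|gap n x| <= 1 / (2 ^ k.+1)%:R.
  have k0 : 0 < 1 / (2 ^ k.+1)%:R :> R by rewrite divr_gt0// ltr0n expn_gt0.
  by have [n [kn H]] := filter_ex (filterI (nbhs_infty_ge k) (gap_L1 k k0)); exists n.
have [s sP] := choice hs; exists s; split; first by move=> k; exact: (sP k).1.
pose Phi k := (fun x => `|gap (s k) x|) \_ (A k).
have hPhi : nonneg_mfun D Phi.
  split=> k.
    apply/measurable_restrict => //; rewrite (setIidr (AD (k:=k))).
    by apply: measurableT_comp => //; apply: measurable_funS (mgap (s k)).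
  by move=> x _; rewrite /Phi patchE; case: ifP.
have := summable_integral_cvg0 mD hPhi; move=> /(_ mu)[k|].
  rewrite /Phi; have -> : (\int[mu]_(x in D) (((fun x => `|gap (s k) x|) \_ (A k)) x)%:E =
     \int[mu]_(x in A k) (`|gap (s k) x|)%:E)%E.
    rewrite [RHS]integral_mkcond -[in RHS](setIidr (AD (k:=k))).
    rewrite -integral_mkcond integral_mkcondr; apply: eq_integral => x _.
    by rewrite !patchE; case: ifP.
  rewrite -[X in (X <= _)%E]fineK; last exact: (integrable_fin_num (mA k) (integrable_norm (igap _ k))).
  by rewrite lee_fin; exact: (sP k).2.
move=> Z [mZ Z0 ZP]; exists Z; split=> // x /= nx; apply: ZP => /= h; apply: nx => Dx.
have soo : s @ \oo --> \oo.
  move=> P [N0 _ NP]; exists N0 => // k /= Nk; apply: NP => /=.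
  exact: leq_trans Nk (sP k).1.
apply: (@convex_gap_cvg _ _ (j x) (u x) (w x) (a x) _ _ _ _ _ _ (fun k => un (s k) x)).
- exact: cj.
- exact: sj.
- by move=> z; exact: aP.
- exact: (cvg_comp _ _ soo (unu Dx)).
- apply: norm_cvg0; have := h Dx; apply: cvg_trans; apply: near_eq_cvg.
  by apply: filterS (near_A Dx) => k Akx; rewrite /Phi patchE mem_set.
Qed.

End integrable_values.
End semicontinuity.

(** * Lebesgue measure on the Euclidean space *)
Section lebesgue_Rn.
Variables (R : realType) (n : nat).
Local Notation V := 'rV[R]_n.+1.
Local Notation E := (Rn R n).
Local Notation leb := (@leb R n).

Lemma leb_complete : measure_is_complete leb.
Proof. exact: measure_is_complete_caratheodory. Qed.

Definition set_coord (x : V) (i : 'I_n.+1) (c : R) : V :=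
  \row_k if k == i then c else x 0 k.

Lemma set_coordE x i c k : set_coord x i c 0 k = if k == i then c else x 0 k.
Proof. by rewrite mxE. Qed.

Lemma box_volume_cut (a b : V) i c :
  box_volume a (set_coord b i (Num.min (b 0 i) c)) +
  box_volume (set_coord a i (Num.max (a 0 i) c)) b = box_volume a b.
Proof.
rewrite /box_volume (bigD1 i)//= [X in _ + X](bigD1 i)//= [RHS](bigD1 i)//=.
rewrite !set_coordE eqxx.
rewrite (eq_bigr (fun k => Num.max 0 (b 0 k - a 0 k))); last first.
  by move=> k /negbTE ki; rewrite set_coordE ki.
rewrite [X in _ + _ * X](eq_bigr (fun k => Num.max 0 (b 0 k - a 0 k))); last first.
  by move=> k /negbTE ki; rewrite set_coordE ki.
rewrite -mulrDl; congr (_ * _); set x := a 0 i; set y := b 0 i.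
case: (leP y c) => yc; case: (leP x c) => xc; do ?[case: leP => ?]; lra.
Qed.

Lemma box_volume_ge0 (a b : V) : 0 <= box_volume a b.
Proof. by apply: prodr_ge0 => i _; rewrite le_max lexx. Qed.

(** Cutting the boxes of a cover by a hyperplane preserves their total volume, so
    the outer measure is additive across it. *)
Lemma measurable_halfspace i (c : R) : measurable ([set x | x 0 i <= c] : set E).
Proof.
apply: le_caratheodory_measurable => X.
apply: le_ereal_inf_tmp => _ [ab Xab <-].
pose ab1 k := ((ab k).1, set_coord (ab k).2 i (Num.min ((ab k).2 0 i) c)).
pose ab2 k := (set_coord (ab k).1 i (Num.max ((ab k).1 0 i) c), (ab k).2).
have -> : (\sum_(k <oo) (box_volume (ab k).1 (ab k).2)%:E =
   \sum_(k <oo) (box_volume (ab1 k).1 (ab1 k).2)%:E +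
   \sum_(k <oo) (box_volume (ab2 k).1 (ab2 k).2)%:E)%E.
  rewrite -nneseriesD.
  - by apply: eq_eseriesr => k _; rewrite -EFinD box_volume_cut.
  - by move=> k _ _; rewrite lee_fin box_volume_ge0.
  - by move=> k _ _; rewrite lee_fin box_volume_ge0.
apply: leeD; apply: ereal_inf_lbound.
  exists ab1 => // x [Xx xc]; have [k _ kx] := Xab x Xx; exists k => // k'.
  rewrite /= set_coordE; have /andP[h1 h2] := kx k'; case: eqP => [->|_]; last by rewrite h1.
  by move: (kx i) => /andP[-> h]; rewrite le_min h.
exists ab2 => // x [Xx /= xc]; have [k _ kx] := Xab x Xx; exists k => // k'.
rewrite /= set_coordE; have /andP[h1 h2] := kx k'; case: eqP => [->|_]; last by rewrite h1.
by move: (kx i) => /andP[h ->]; rewrite gt_max h andbT ltNge; apply/negP.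
Qed.

Lemma measurable_coord i (D : set E) : measurable_fun D (fun x : E => x 0 i).
Proof.
apply: measurable_funTS; apply: (measurability _ (RGenOInfty.measurableE R)).
move=> _ [_ [c ->] <-]; rewrite setTI.
rewrite (_ : _ @^-1` _ = ~` [set x : E | x 0 i <= c]); last first.
  by apply/seteqP; split=> x /=; rewrite in_itv/= andbT ltNge => /negP.
by apply: measurableC; exact: measurable_halfspace.
Qed.

Lemma measurable_box (a b : V) : measurable (box a b : set E).
Proof.
rewrite (_ : box a b = \bigcap_(i in [set: 'I_n.+1])
    (setT `&` (fun x : E => x 0 i) @^-1` `]a 0 i, b 0 i]%classic)); last first.
  apply/seteqP; split=> x /= h i; first by move=> _; split=> //=; rewrite in_itv/=; exact: h.
  by have [_ /=] := h i I; rewrite in_itv.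
apply: fin_bigcap_measurable; first exact: finite_finset.
by move=> i _; exact: (@measurable_coord i setT).
Qed.

Lemma leb_box_le (a b : V) : (leb (box a b) <= (box_volume a b)%:E)%E.
Proof.
apply: ereal_inf_lbound.
exists (fun k => if k == 0%N then (a, b) else (0, 0)); first by move=> x bx; exists 0%N.
rewrite nneseries_recl//; last by move=> k _; rewrite lee_fin box_volume_ge0.
rewrite /= eseries0 ?adde0// => k; rewrite lt0n => /negbTE k0 _; rewrite k0/=; congr EFin.
by rewrite /box_volume big_ord_recl subrr maxxx mul0r.
Qed.

Lemma leb_box_lty (a b : V) : (leb (box a b) < +oo)%E.
Proof. exact: le_lt_trans (leb_box_le a b) (ltry _). Qed.

Definition cbox (a b : V) : set V := [set x | forall i, a 0 i <= x 0 i <= b 0 i].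

Lemma box_cbox a b : box a b `<=` cbox a b.
Proof. by move=> x h i; have /andP[/ltW -> ->] := h i. Qed.

Lemma cbox_compact a b : compact (cbox a b).
Proof.
have := @rV_compact R n.+1 (fun i => `[a 0 i, b 0 i]%classic) (fun i => @segment_compact _ _ _).
by congr compact; apply/seteqP; split=> x /= h i; have := h i; rewrite in_itv.
Qed.

(** The boxes with rational corners whose closure lies in [U], enumerated through
    [unpickle]; all other indices give an empty box. *)
Lemma open_bigcup_box (U : set V) : open U ->
  exists ab : nat -> V * V, U = \bigcup_k box (ab k).1 (ab k).2 /\
    forall k, cbox (ab k).1 (ab k).2 `<=` U.
Proof.
move=> oU.
pose toV (q : 'rV[rat]_n.+1) : V := \row_i ratr (q 0 i).
pose empty : V * V := (const_mx 1, const_mx 0).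
have empty0 : cbox empty.1 empty.2 = set0.
  apply/seteqP; split=> // x /(_ 0); rewrite !mxE => /andP[h1 h2].
  by have := le_trans h1 h2; rewrite ler10.
pose ab k := if unpickle k is Some q then
  let c := (toV q.1, toV q.2) in
  if `[< cbox c.1 c.2 `<=` U >] then c else empty else empty.
have abU k : cbox (ab k).1 (ab k).2 `<=` U.
  rewrite /ab; case: (unpickle k) => [q|]; last by rewrite empty0.
  by case: asboolP => // _; rewrite empty0.
exists ab; split=> //; apply/seteqP; split=> x; last by move=> [k _ /box_cbox/abU].
move=> Ux; have := open_nbhs_nbhs (conj oU Ux) => /nbhs_ballP[e /= e0 eU].
have lo i : exists q : rat, (x 0 i - e < ratr q) && (ratr q < x 0 i).
  have h : x 0 i - e < x 0 i by rewrite ltrBlDr ltrDl.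
  by have [q] := rat_in_itvoo h; rewrite in_itv /= => qP; exists q.
have hi i : exists q : rat, (x 0 i < ratr q) && (ratr q < x 0 i + e).
  have h : x 0 i < x 0 i + e by rewrite ltrDl.
  by have [q] := rat_in_itvoo h; rewrite in_itv /= => qP; exists q.
have [ql qlP] := choice lo; have [qh qhP] := choice hi.
pose q : 'rV[rat]_n.+1 * 'rV[rat]_n.+1 := (\row_i ql i, \row_i qh i).
exists (pickle q) => //; rewrite /ab pickleK; case: asboolP => [_|]; last first.
  case=> y yc; apply: eU; split=> // i k; rewrite ord1 /ball/= ltr_norml.
  have := yc k; rewrite !mxE => /andP[h1 h2].
  by have /andP[? ?] := qlP k; have /andP[? ?] := qhP k; apply/andP; split; lra.
move=> i; rewrite !mxE; have /andP[_ ->] := qlP i.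
by have /andP[/ltW -> _] := qhP i.
Qed.

Lemma open_measurable_Rn (U : set V) : open U -> measurable (U : set E).
Proof.
move=> /open_bigcup_box[ab [-> _]].
by apply: bigcupT_measurable => k; exact: measurable_box.
Qed.

Lemma closed_measurable_Rn (F : set V) : closed F -> measurable (F : set E).
Proof.
move=> cF; rewrite -(setCK F); apply: measurableC.
by apply: open_measurable_Rn; exact: closed_openC.
Qed.

Lemma compact_measurable_Rn (K : set V) : compact K -> measurable (K : set E).
Proof.
by move=> cK; apply: closed_measurable_Rn; apply: compact_closed.
Qed.

Lemma continuous_measurable_Rn (f : V -> R) (D : set E) : continuous f ->
  measurable_fun D (f : E -> R).
Proof.
move=> cf; apply: measurable_funTS.
apply: (measurability _ (RGenOpens.measurableE R)).
move=> _ [_ [a [b ->]] <-]; rewrite setTI; apply: open_measurable_Rn.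
by apply: open_comp; [move=> x _; exact: cf|exact: interval_open].
Qed.

(** The exhaustion by sets of finite measure used throughout. *)
Definition bigbox (k : nat) : set E := box (const_mx (- k%:R) : V) (const_mx k%:R).

Lemma bigbox_nd : nondecreasing_seq bigbox.
Proof.
move=> m k mk; apply/subsetPset => x bx i; have := bx i; rewrite !mxE.
have mkR : m%:R <= k%:R :> R by rewrite ler_nat.
by move=> /andP[? ?]; apply/andP; split; lra.
Qed.

Lemma norm_bigbox (x : V) (k : nat) : `|x| < k%:R -> bigbox k x.
Proof.
move=> xk i; rewrite !mxE.
have : `|x 0 i| < k%:R.
  apply: le_lt_trans xk; rewrite [leRHS]/Num.norm/= mx_normrE.
  by apply: (@bigmax_sup _ _ _ _ (0, i)).
by rewrite ltr_norml => /andP[-> /ltW ->].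
Qed.

Lemma bigcup_bigbox : \bigcup_k bigbox k = setT.
Proof.
apply/seteqP; split=> // x _.
have [k _ /(_ k (leqnn k)) /= xk] := nbhs_infty_gtr (`|x : V|).
by exists k => //; exact: norm_bigbox.
Qed.

Lemma bounded_leb_lty (A : set V) : bounded_set A -> exists k, A `<=` bigbox k.
Proof.
move=> [M [_ MA]]; have [k _ /(_ k (leqnn k)) /= Mk] := nbhs_infty_gtr (M + 1).
exists k => x Ax; apply: norm_bigbox; apply: le_lt_trans Mk.
by apply: (MA (M + 1)) => //; rewrite ltrDl.
Qed.

Lemma compact_leb_lty (K : set V) : compact K -> (leb K < +oo)%E.
Proof.
move=> cK; have [k Kk] := bounded_leb_lty (compact_bounded cK).
apply: le_lt_trans (leb_box_lty _ _); apply: le_measure; rewrite ?inE; last exact: Kk.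
  exact: compact_measurable_Rn.
exact: measurable_box.
Qed.

(** Inside a bounded box, the hyperplane is covered by slabs of arbitrarily small
    thickness. *)
Lemma hyperplane_null i (c : R) : leb ([set x : V | x 0 i = c] : set E) = 0%E.
Proof.
set H : set E := (X in leb X).
have mH : measurable H.
  have := @measurable_coord i setT measurableT _ (measurable_set1 c).
  by rewrite setTI.
have sub k : leb (H `&` bigbox k) = 0%E.
  apply/eqP; rewrite eq_le measure_ge0 andbT; apply/lee_addgt0Pr => e e0; rewrite add0e.
  pose P : R := (2 * k%:R) ^+ n + 1.
  have P0 : 0 < P by rewrite ltr_wpDl// exprn_ge0// mulr_ge0.
  pose a : V := set_coord (const_mx (- k%:R)) i (c - e / P).
  pose b : V := set_coord (const_mx k%:R) i c.
  have mI : measurable (H `&` bigbox k).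
    by apply: measurableI => //; exact: measurable_box.
  apply: (@le_trans _ _ (leb (box a b))).
    apply: le_measure; rewrite ?inE//; first exact: measurable_box.
    move=> x [/= xc bx] k'; rewrite !set_coordE; case: eqP => [->|_]; last exact: bx.
    by rewrite xc lexx andbT ltrBlDr ltrDl divr_gt0.
  apply: (le_trans (leb_box_le a b)); rewrite lee_fin /box_volume (bigD1 i)//=.
  rewrite !set_coordE eqxx opprB addrC subrK (max_idPr _); last by rewrite divr_ge0// ltW.
  rewrite (eq_bigr (fun=> 2 * k%:R)); last first.
    move=> k' /negbTE ki; rewrite !set_coordE ki !mxE opprK.
    have -> : k%:R + k%:R = 2 * k%:R :> R by ring.
    by apply/max_idPr; rewrite mulr_ge0.
  rewrite prodr_const (_ : #|_| = n); last by rewrite cardC1 card_ord.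
  by rewrite mulrAC ler_pdivrMr// ler_pM2l// lerDl.
rewrite -(setIT H) -bigcup_bigbox setI_bigcupr.
apply/eqP; rewrite eq_le measure_ge0 andbT.
apply: le_trans (measure_sigma_subadditive _ _ _ (@subset_refl _ _)) _.
- by move=> k; apply: measurableI => //; exact: measurable_box.
- by apply: bigcupT_measurable => k; apply: measurableI => //; exact: measurable_box.
- by rewrite eseries0// => k _ _; exact: sub.
Qed.

(** The measure is an outer measure generated by boxes, so [A] has a cover by boxes
    of nearly the same total volume; finitely many of them miss little of [A]. *)
Lemma leb_approx_boxes (A : set E) (e : R) : measurable A -> (leb A < +oo)%E ->
  0 < e -> exists (ab : nat -> V * V) (k : nat),
  (leb (A `\` \big[setU/set0]_(i < k) box (ab i).1 (ab i).2) <= e%:E)%E /\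
  (leb (\big[setU/set0]_(i < k) box (ab i).1 (ab i).2 `\` A) <= e%:E)%E.
Proof.
move=> mA Aoo e0.
have Afin : leb A \is a fin_num by rewrite ge0_fin_numE.
have [_ [ab Aab <-] sle] := lb_ereal_inf_adherent e0 Afin.
exists ab; pose B k : set E := box (ab k).1 (ab k).2.
have mB k : measurable (B k) by exact: measurable_box.
have mUk k : measurable (\big[setU/set0]_(i < k) B i) by exact: bigsetU_measurable.
have mU : measurable (\bigcup_k B k) by exact: bigcupT_measurable.
have UA : (leb (\bigcup_k B k `\` A) <= e%:E)%E.
  rewrite measureD//; last first.
    apply: le_lt_trans (measure_sigma_subadditive _ mB mU (@subset_refl _ _)) _.
    apply: (@le_lt_trans _ _ (\sum_(k <oo) (box_volume (ab k).1 (ab k).2)%:E)%E).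
      by apply: lee_nneseries => *; [exact: measure_ge0|exact: leb_box_le].
    by apply: lt_trans sle _; rewrite lte_add_pinfty ?ltry.
  rewrite (setIidr Aab) leeBlDr//.
  apply: le_trans (measure_sigma_subadditive _ mB mU (@subset_refl _ _)) _.
  apply: (@le_trans _ _ (\sum_(k <oo) (box_volume (ab k).1 (ab k).2)%:E)%E).
    by apply: lee_nneseries => *; [exact: measure_ge0|exact: leb_box_le].
  by rewrite addeC; exact: ltW.
have cv : leb \o (fun k => A `\` \big[setU/set0]_(i < k) B i) @ \oo --> 0%E.
  pose F k := A `\` \big[setU/set0]_(i < k) B i.
  have mF k : measurable (F k) by exact: measurableD.
  have F0 : \bigcap_k F k = set0.
    apply/seteqP; split=> // x h; have [Ax _] := h 0%N I.
    have [k _ kx] := Aab x Ax; have [_] := h k.+1 I; apply.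
    by rewrite -bigcup_mkord; exists k => /=.
  have -> : 0%E = leb (\bigcap_k F k) by rewrite F0; exact/esym/measure0.
  apply: (@nonincreasing_cvg_mu _ _ _ leb F _ mF (bigcapT_measurable mF)).
    apply: le_lt_trans Aoo; apply: le_measure; rewrite ?inE//.
    by move=> x [].
  move=> k m km; apply/subsetPset; apply: setDS.
  exact: subset_bigsetU.
have [k _ /(_ k (leqnn k)) /= small] := cvge0_lt cv e0.
exists k; split; first exact: ltW.
apply: le_trans UA; apply: le_measure; rewrite ?inE.
- exact: (measurableD (mUk k) mA).
- exact: (measurableD mU mA).
- apply: setSD; rewrite -[X in X `<=` _](bigcup_mkord k B).
  by move=> x [i _ Bx]; exists i.
Qed.

End lebesgue_Rn.

(** * Smooth functions of one variable *)
Section smooth_one_variable.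
Variable R : realType.
Implicit Types (f g : R -> R) (S : set (R -> R)).

Definition deriv_closed S := forall f, S f ->
  exists2 g, S g & forall x, is_derive x (1 : R) f (g x).

(** Coinductively, [f] is smooth if it lies in some set of functions closed under
    differentiation.  Products and primitives are then handled by exhibiting such
    a set, without computing higher derivatives. *)
Definition smooth1 f := exists2 S, deriv_closed S & S f.

Lemma is_derive_continuous f (g : R -> R) : (forall x, is_derive x (1 : R) f (g x)) ->
  continuous f.
Proof.
move=> fg x; apply: differentiable_continuous; apply/derivable1_diffP.
by have [] := fg x.
Qed.

Lemma smooth1_continuous f : smooth1 f -> continuous f.
Proof. by move=> [S cS /cS[g _ fg]]; exact: is_derive_continuous fg. Qed.

Lemma smooth1_affine f (a b : R) : smooth1 f -> smooth1 (fun x => f (a * x + b)).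
Proof.
move=> [S cS Sf].
exists [set h | exists c g, S g /\ h = fun x => c * g (a * x + b)].
  move=> _ [c [g [/cS[g' Sg' gg'] ->]]].
  exists (fun x => (c * a) * g' (a * x + b)); first by exists (c * a), g'.
  move=> x; have D : is_derive x (1 : R) (fun x => a * x + b) a.
    apply/is_derive1_caratheodory; exists (cst a); split=> //; last exact: cst_continuous.
    by move=> z; rewrite /cst; ring.
  have := @is_derive1_comp _ g (fun x => a * x + b) x _ _ (gg' _) D.
  move=> D'; have : is_derive x (1 : R) (c *: (g \o (fun x => a * x + b))) (c *: (g' (a * x + b) * a)).
    exact: is_deriveZ.
  by rewrite /GRing.scale/= (mulrC (g' _)) mulrA.
exists 1, f; split=> //; by apply/funext => x; rewrite mul1r.
Qed.

(** The finite sums of products are closed under differentiation by the Leibniz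
    rule. *)
Lemma smooth1M f g : smooth1 f -> smooth1 g -> smooth1 (fun x => f x * g x).
Proof.
move=> [S cS Sf] [S' cS' Sg].
pose val (s : seq ((R -> R) * (R -> R))) : R -> R := fun x => \sum_(p <- s) p.1 x * p.2 x.
have cons p s x : val (p :: s) x = p.1 x * p.2 x + val s x by rewrite /val big_cons.
exists [set h | exists s, (forall p, List.In p s -> S p.1 /\ S' p.2) /\ h = val s].
  move=> _ [s [sS ->]].
  have [s' s'S D] : exists2 s', (forall p, List.In p s' -> S p.1 /\ S' p.2) &
      forall x, is_derive x (1 : R) (val s) (val s' x).
    elim: s sS => [|p s IH] sS.
      exists [::] => // x; rewrite (_ : val [::] = cst 0); first exact: is_derive_cst.
      by apply/funext => y; rewrite /val big_nil.
    have [s' s'S D] := IH (fun q qs => sS q (or_intror qs)).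
    have [/cS[f' Sf' ff'] /cS'[g' Sg' gg']] := sS p (or_introl erefl).
    have [Sp1 Sp2] := sS p (or_introl erefl).
    exists ((f', p.2) :: (p.1, g') :: s').
      by move=> q /= [<-|[<-|/s'S]].
    move=> x; rewrite (_ : val (p :: s) = (p.1 * p.2) + val s); last first.
      by apply/funext => y; rewrite cons.
    rewrite !cons /=.
    apply: (is_derive_eq (is_deriveD (is_deriveM (ff' x) (gg' x)) (D x))).
    by rewrite /GRing.scale/=; ring.
  by exists (val s') => //; exists s'.
exists [:: (f, g)]; split; first by move=> p /= [<-|//].
by apply/funext => x; rewrite /val big_seq1.
Qed.

Lemma smooth1B f g : smooth1 f -> smooth1 g -> smooth1 (fun x => f x - g x).
Proof.
move=> [S cS Sf] [S' cS' Sg].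
exists [set h | exists a b, [/\ S a, S' b & h = fun x => a x - b x]]; last by exists f, g.
move=> _ [a [b [/cS[a' Sa' aa'] /cS'[b' Sb' bb'] ->]]].
exists (fun x => a' x - b' x); first by exists a', b'.
by move=> x; exact: (is_deriveB (aa' x) (bb' x)).
Qed.

Lemma smooth1_primitive f g : smooth1 g -> (forall x, is_derive x (1 : R) f (g x)) ->
  smooth1 f.
Proof.
move=> [S cS Sg] fg; exists (f |` S); last by left.
move=> h [->|/cS[h' Sh' hh']]; first by exists g => //; right.
by exists h' => //; right.
Qed.

Lemma exprn_le_expR m (y : R) : 0 <= y -> y ^+ m <= m`!%:R * expR y.
Proof.
move=> y0; case: m => [|m].
  by rewrite expr0 fact0 mul1r (le_trans _ (expR_ge1Dx _))// lerDl.
have := expR_ge1Dxn m y0; rewrite -ler_pdivrMl ?ltr0n ?fact_gt0// mulrC => h.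
by apply: le_trans h; rewrite lerDr.
Qed.

Lemma poly_le_expR (P : {poly R}) : exists2 C, 0 <= C &
  forall y, 0 <= y -> `|P.[y]| <= C * expR y.
Proof.
exists (\sum_(i < size P) `|P`_i| * (i`!)%:R).
  by apply: sumr_ge0 => i _; rewrite mulr_ge0.
move=> y y0; rewrite horner_coef; apply: le_trans (ler_norm_sum _ _ _) _.
rewrite mulr_suml; apply: ler_sum => i _.
rewrite normrM normrX (ger0_norm y0) -mulrA ler_wpM2l//; exact: exprn_le_expR.
Qed.

(** The classical flat functions: [P(1/x) exp(-1/x)] on the positive axis.  The
    polynomial factor is what makes the family closed under differentiation. *)
Definition flat (P : {poly R}) (x : R) : R :=
  if 0 < x then P.[x^-1] * expR (- x^-1) else 0.

Lemma flat_le_sqr P : exists2 C, 0 <= C & forall x, `|flat P x| <= C * x ^+ 2.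
Proof.
have [C C0 CP] := poly_le_expR ('X^2 * P); exists C => // x; rewrite /flat.
case: ifPn => x0; last by rewrite normr0 mulr_ge0// sqr_ge0.
have xi : 0 <= x^-1 by rewrite invr_ge0 ltW.
have := CP _ xi; rewrite hornerM hornerXn normrM normrX (ger0_norm xi).
rewrite normrM (ger0_norm (expR_ge0 _)) expRN ler_pdivrMr ?expR_gt0//.
rewrite exprVn -(ler_pM2l (exprn_gt0 2 x0)) mulVKf ?gt_eqF ?exprn_gt0//.
by rewrite mulrCA mulrA.
Qed.

(** For positive [x] the chain rule gives the polynomial [X^2 (P - P')] in [1/x];
    at 0 the quadratic bound makes the difference quotients vanish. *)
Lemma flat_derive P x : is_derive x (1 : R) (flat P) (flat ('X^2 * (P - P^`())) x).
Proof.
have [x0|x0|<-] := ltrgtP 0 x.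
- have D : is_derive x (1 : R) (fun t => P.[t^-1] * expR (- t^-1))
      (flat ('X^2 * (P - P^`())) x).
    have xn0 : x != 0 by rewrite gt_eqF.
    have DV := is_deriveV xn0 (is_derive_id x (1 : R)).
    have DN : is_derive x^-1 (1 : R) (fun y => expR (- y)) (expR (- x^-1) * - 1).
      exact: (is_derive1_comp (is_derive_expR _) (is_deriveNid _ _)).
    have DM := is_deriveM (is_derive_poly P x^-1) DN.
    apply: (is_derive_eq (is_derive1_comp DM DV)).
    rewrite /flat x0 /GRing.scale/= hornerM hornerXn hornerD hornerN exprVn; ring.
  apply: near_eq_is_derive D.
  near=> t; rewrite /flat ifT//; near: t; exact: lt_nbhsr.
- rewrite (_ : flat (_ * _) x = 0); last by rewrite /flat ltNge (ltW x0).
  apply: (@near_eq_is_derive _ _ _ (cst 0)).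
    near=> t; rewrite /flat ifF//; apply/negbTE; rewrite -leNgt ltW//; near: t.
    exact: lt_nbhsl.
- rewrite (_ : flat (_ * _) 0 = 0); last by rewrite /flat ltxx.
  have [C C0 CP] := flat_le_sqr P.
  apply/is_derive1_caratheodory; exists (fun z => flat P z / z); split.
  + move=> z; rewrite (_ : flat P 0 = 0) ?subr0; last by rewrite /flat ltxx.
     have [->|z0] := eqVneq z 0.
      by rewrite mulr0 /flat ltxx.
    by rewrite divfK.
  + apply/cvgrPdist_lt => e e0; rewrite invr0 mulr0.
    have C1 : 0 < C + 1 by rewrite ltr_wpDl.
    have nb : \forall z \near (0 : R), `|z| < e / (C + 1).
      by apply: (@nbhs0_lt _ R); rewrite divr_gt0.
    near=> z; rewrite sub0r normrN; have [->|z0] := eqVneq z 0.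
      by rewrite invr0 mulr0 normr0.
    rewrite normrM normfV ltr_pdivrMr ?normr_gt0//.
    apply: le_lt_trans (CP z) _; rewrite -real_normK ?num_real// expr2 mulrA.
    rewrite ltr_pM2r ?normr_gt0//.
    have : `|z| < e / (C + 1) by near: z; exact: nb.
    rewrite ltr_pdivlMr// => h; apply: le_lt_trans h.
    by rewrite mulrC ler_wpM2l// lerDl.
  + by rewrite invr0 mulr0.
Unshelve. all: end_near. Qed.

Lemma smooth1_flat P : smooth1 (flat P).
Proof.
exists [set h | exists P, h = flat P]; last by exists P.
move=> _ [Q ->]; exists (flat ('X^2 * (Q - Q^`()))); first by eexists.
by move=> x; exact: flat_derive.
Qed.

End smooth_one_variable.

(** * Bumps and test functions *)
Section bumps.
Variable R : realType.

Definition theta : R -> R := flat 1.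

Lemma theta_ge0 x : 0 <= theta x.
Proof. by rewrite /theta /flat; case: ifP => // _; rewrite hornerC mul1r expR_ge0. Qed.

Lemma theta_le1 x : theta x <= 1.
Proof.
rewrite /theta /flat; case: ifP => // x0; rewrite hornerC mul1r -expR0 ler_expR.
by rewrite oppr_le0 invr_ge0 ltW.
Qed.

Lemma theta_eq0 x : x <= 0 -> theta x = 0.
Proof. by move=> x0; rewrite /theta /flat ltNge x0. Qed.

Lemma theta_cvg1 x : 0 < x -> (fun m : nat => theta (m.+1%:R * x)) @ \oo --> (1 : R).
Proof.
move=> x0; rewrite (_ : (fun m => _) = fun m : nat => expR (- (m.+1%:R^-1 * x^-1))).
  have c0 : (fun m : nat => - (m.+1%:R^-1 * x^-1)) @ \oo --> (0 : R).
    rewrite -oppr0; apply: cvgN; rewrite -(mul0r x^-1); apply: cvgMr_tmp.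
    apply/cvgrPdist_lt => e e0; near=> m; rewrite sub0r normrN ger0_norm//.
    by near: m; exact: near_infty_natSinv_lt (PosNum e0).
  rewrite -[X in _ --> X](expR0).
  exact: (cvg_comp _ _ c0 (@continuous_expR R 0)).
apply/funext => m; rewrite /theta /flat mulr_gt0// hornerC mul1r.
by rewrite invfM.
Unshelve. all: end_near. Qed.

(** As [m] grows, this smooth function increases to the indicator of the open
    interval with ends [a] and [b]. *)
Definition bump (m : nat) (a b x : R) : R :=
  theta (m.+1%:R * (x - a)) * theta (m.+1%:R * (b - x)).

Lemma smooth1_bump m a b : smooth1 (bump m a b).
Proof.
apply: smooth1M.
  rewrite (_ : (fun x => _) = fun x => theta (m.+1%:R * x + - (m.+1%:R * a))).
    exact/smooth1_affine/smooth1_flat.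
  by apply/funext => x; rewrite mulrBr.
rewrite (_ : (fun x => _) = fun x => theta ((- m.+1%:R) * x + (m.+1%:R * b))).
  exact/smooth1_affine/smooth1_flat.
by apply/funext => x; rewrite mulrBr mulNr addrC.
Qed.

Lemma bump_ge0 m a b x : 0 <= bump m a b x.
Proof. by rewrite mulr_ge0// theta_ge0. Qed.

Lemma bump_le1 m a b x : bump m a b x <= 1.
Proof. by rewrite mulr_ile1 ?theta_ge0 ?theta_le1. Qed.

Lemma bump_eq0 m a b x : (x <= a) || (b <= x) -> bump m a b x = 0.
Proof.
case/orP => h; rewrite /bump.
  by rewrite theta_eq0 ?mul0r// pmulr_rle0// subr_le0.
by rewrite [X in _ * X]theta_eq0 ?mulr0// pmulr_rle0// subr_le0.
Qed.

Lemma bump_cvg a b x : x != b ->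
  (fun m => bump m a b x) @ \oo --> ((a < x <= b)%R%:R : R).
Proof.
move=> xb; have [/andP[ax xlb]|nab] := boolP (a < x <= b).
  rewrite -[X in _ --> X](mulr1 1) /bump; apply: cvgM; apply: theta_cvg1.
    by rewrite subr_gt0.
  by rewrite subr_gt0 lt_neqAle xb.
rewrite (_ : (fun m => _) = fun=> 0); first exact: cvg_cst.
apply/funext => m; apply: bump_eq0; move: nab; rewrite negb_and -leNgt -ltNge.
by case/orP => [->//|/ltW ->]; rewrite orbT.
Qed.

Lemma bump_shift m a L x : bump m 0 L (x - a) = bump m a (a + L) x.
Proof. by rewrite /bump subr0 opprB addrCA addrA. Qed.

Lemma bump_primitive m (L : R) : exists H : R -> R,
  forall x, is_derive x (1 : R) H (bump m 0 L x).
Proof.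
have cb : continuous (bump m 0 L) by exact/smooth1_continuous/smooth1_bump.
have mb : measurable_fun setT (bump m 0 L) by exact: continuous_measurable_fun.
(* Integrating from minus infinity is harmless, as the bump has compact support. *)
exists (fun y => (\int[lebesgue_measure]_(t in [set` Interval -oo%O (BRight y)]) bump m 0 L t)).
move=> x; have [] := @continuous_FTC1 R (bump m 0 L) -oo%O x (x + 1) _ _ _ (cb x).
- by rewrite ltrDl.
- have il : lebesgue_measure.-integrable `[(0 : R), L] (EFin \o bump m 0 L).
    by apply: continuous_compact_integrable; [exact: segment_compact|exact: continuous_subspaceT].
  have il' : lebesgue_measure.-integrable setT (EFin \o bump m 0 L).
    have -> : EFin \o bump m 0 L = (EFin \o bump m 0 L) \_ `[(0 : R), L].
      apply/funext => y; rewrite /= patchE; case: ifPn => // /negP.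
      rewrite inE/= in_itv/= => /negP; rewrite negb_and -!ltNge => h.
      by rewrite bump_eq0//; case/orP: h => /ltW ->; rewrite ?orbT.
    by rewrite -integrable_mkcond.
  exact: integrableS il'.
- exact: ltNyr.
move=> dF F'; apply: DeriveDef; first exact: dF.
by rewrite -derive1E.
Qed.

(** A smooth hat function over two adjacent intervals of length [L]: its derivative
    is the bump of the first interval minus that of the second.  It is a primitive
    [H] of the bump, evaluated at [x - a] and [x - (a + L)] and subtracted; the
    mean value theorem bounds it by [L]. *)
Lemma hat_exists m (a L : R) : 0 < L -> exists psi : R -> R,
  [/\ smooth1 psi,
      forall x, is_derive x (1 : R) psi (bump m a (a + L) x - bump m (a + L) (a + L + L) x),
      forall x, `|psi x| <= L &
      forall x, psi x != 0 -> a <= x <= a + L + L].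
Proof.
move=> L0; have [H dH] := bump_primitive m L.
have smH : smooth1 H by apply: smooth1_primitive dH; exact: smooth1_bump.
have cH : continuous H := is_derive_continuous dH.
have mvt x y : x <= y -> exists2 t, x <= t <= y & H y - H x = bump m 0 L t * (y - x).
  move=> xy; have [t] := @MVT_segment R H (bump m 0 L) x y xy (fun z _ => dH z)
    (continuous_subspaceT cH).
  by rewrite in_itv/= => txy e; exists t.
have dHc c x : is_derive x (1 : R) (fun x => H (x - c)) (bump m 0 L (x - c)).
  have D : is_derive x (1 : R) (fun x : R => x - c) 1.
    apply/is_derive1_caratheodory; exists (cst 1); split=> //; last exact: cst_continuous.
    by move=> z; rewrite /cst; ring.
  rewrite -[bump _ _ _ _]mulr1; exact: (@is_derive1_comp _ H (fun x => x - c) x _ _ (dH (x - c)) D).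
have smHc c : smooth1 (fun x => H (x - c)).
  by apply: smooth1_primitive (dHc c); rewrite (_ : (fun x => _) = bump m c (c + L));
    [exact: smooth1_bump | apply/funext => x; exact: bump_shift].
exists (fun x => H (x - a) - H (x - (a + L))); split.
- exact: smooth1B.
- move=> x; rewrite -!bump_shift; exact: is_deriveB (dHc _ _) (dHc _ _).
- move=> x; have [|t _ ->] := mvt (x - (a + L)) (x - a); first lra.
  rewrite (_ : x - a - _ = L); last by ring.
  by rewrite normrM (ger0_norm (bump_ge0 _ _ _ _)) (gtr0_norm L0) ler_piMl ?bump_le1// ltW.
- move=> x; apply: contra_neqT; rewrite negb_and -!ltNge => h.
  have [|t /andP[t1 t2] ->] := mvt (x - (a + L)) (x - a); first lra.
  rewrite bump_eq0 ?mul0r//; case/orP: h => h; apply/orP; [left|right]; lra.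
Qed.

End bumps.

Section product_functions.
Variables (R : realType) (n : nat).
Local Notation V := 'rV[R]_n.+1.

(** Test functions are built as tensor products of functions of one variable. *)
Definition prodf (g : 'I_n.+1 -> R -> R) (x : V) : R := \prod_i g i (x 0 i).

Lemma prodf_continuous (g : 'I_n.+1 -> R -> R) : (forall i, continuous (g i)) -> continuous (prodf g).
Proof.
move=> cg; have H (x : V) (s : seq 'I_n.+1) : (fun y : V => \prod_(i <- s) g i (y 0 i)) @ x -->
    \prod_(i <- s) g i (x 0 i).
  elim: s => [|i s IH].
    rewrite big_nil; have -> : (fun y : V => \prod_(i <- [::]) g i (y 0 i)) = cst 1.
      by apply/funext => y; rewrite big_nil.
    exact: (@cst_continuous V R 1 x).
  rewrite big_cons (_ : (fun y => _) = (fun y : V => g i (y 0 i) * \prod_(k <- s) g k (y 0 k))).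
    have c1 : (fun y : V => g i (y 0 i)) @ x --> g i (x 0 i).
      exact: (@continuous_comp _ _ _ (fun y : V => y 0 i) (g i) x
        (@coord_continuous R 1 n.+1 0 i x) (cg i (x 0 i))).
    exact: (cvgM c1 IH).
  by apply/funext => y; rewrite big_cons.
move=> x; exact: H.
Qed.

Lemma prodf_is_derive g (x : V) i d : is_derive (x 0 i) (1 : R) (g i) d ->
  is_derive x (delta_mx 0 i : V) (prodf g) ((\prod_(k | k != i) g k (x 0 k)) * d).
Proof.
move=> [dg dgE]; set c := \prod_(k | k != i) _.
have E : (fun h : R => h^-1 *: ((prodf g \o shift x) (h *: (delta_mx 0 i : V)) - prodf g x)) =
    (fun h : R => c * (h^-1 *: ((g i \o shift (x 0 i)) (h *: (1 : R)) - g i (x 0 i)))).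
  apply/funext => h; rewrite /prodf /= (bigD1 i)//= [X in _ - X](bigD1 i)//=.
  rewrite (eq_bigr (fun k => g k (x 0 k))); last first.
    by move=> k ki; rewrite !mxE (negbTE ki) andbF mulr0 add0r.
  by rewrite !mxE !eqxx -/c /GRing.scale/=; ring.
have cv : (fun h : R => h^-1 *: ((prodf g \o shift x) (h *: (delta_mx 0 i : V)) - prodf g x)) @ 0^' --> c * d.
  rewrite E; apply: cvgMl_tmp; rewrite -dgE; exact: dg.
apply: DeriveDef; first by apply/cvg_ex; exists (c * d).
exact: cvg_lim cv.
Qed.

Lemma smooth_prodf g : (forall i, smooth1 (g i)) -> smooth (prodf g).
Proof.
move=> sg; have /choice[S SP] : forall i, exists S, deriv_closed S /\ S (g i).
  by move=> i; have [S cS Sg] := sg i; exists S.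
have part s : exists h, (forall i, S i (h i)) /\ partials s (prodf g) = prodf h.
  elim: s => [|i s [h [Sh hE]]]; first by exists g; split=> // i; exact: (SP i).2.
  have [h' Sh' dh'] := (SP i).1 _ (Sh i).
  exists (fun k => if k == i then h' else h k); split.
    by move=> k; case: eqP => [->|].
  rewrite /= -/(partials s (prodf g)) hE; apply/funext => x.
  have [_ ->] := prodf_is_derive (dh' (x 0 i)).
  rewrite /prodf [RHS](bigD1 i)//= eqxx mulrC; congr (_ * _).
  by apply: eq_bigr => k /negbTE ->.
move=> s; have [h [Sh ->]] := part s.
have dh i : exists h', forall t, is_derive t (1 : R) (h i) (h' t).
  by have [h' _ dh'] := (SP i).1 _ (Sh i); exists h'.
split.
  by apply: prodf_continuous => i; have [h' dh'] := dh i; exact: is_derive_continuous dh'.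
by move=> x i; have [h' dh'] := dh i; have [] := prodf_is_derive (dh' (x 0 i)).
Qed.

(** Every factor vanishes outside a compact interval, so the product does so
    outside a closed box. *)
Lemma test_prodf Om g (a b : V) : (forall i, smooth1 (g i)) ->
  (forall i t, g i t != 0 -> a 0 i <= t <= b 0 i) -> cbox a b `<=` Om ->
  test_function Om (prodf g).
Proof.
move=> sg supp abOm.
have cl : closure [set x | prodf g x != 0] `<=` cbox a b.
  have cc : closed (cbox a b) by apply: compact_closed => //; exact: cbox_compact.
  rewrite [X in _ `<=` X](closure_id (cbox a b)).1//; apply: closure_subset => x /=.
  move=> gx i; apply: supp; apply: contra_neq gx => gi.
  by rewrite /prodf (bigD1 i)//= gi mul0r.
split; first exact: smooth_prodf.
  exact: (subclosed_compact (@closed_closure _ _) (@cbox_compact R n a b) cl).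
exact: subset_trans abOm.
Qed.

End product_functions.

(** * Box integrals and the halving estimate *)
Section box_integrals.
Variables (R : realType) (n : nat).
Local Notation V := 'rV[R]_n.+1.
Local Notation E := (Rn R n).
Local Notation mu := (@leb R n).
Implicit Types (Om : set V) (v u f : V -> R) (g : V -> V) (a b : V).

Lemma integrable_cbox Om f a b : loc_integrable Om f -> cbox a b `<=` Om ->
  mu.-integrable (cbox a b : set E) (EFin \o f).
Proof. by move=> [_ H] abOm; apply: H => //; exact: cbox_compact. Qed.

Lemma measurable_cbox a b : measurable (cbox a b : set E).
Proof. by apply: compact_measurable_Rn; exact: cbox_compact. Qed.

Lemma integrable_box Om f a b : loc_integrable Om f -> cbox a b `<=` Om ->
  mu.-integrable (box a b : set E) (EFin \o f).
Proof.
move=> lf abOm; apply: integrableS (integrable_cbox lf abOm).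
- exact: measurable_cbox.
- exact: measurable_box.
- exact: box_cbox.
Qed.

Lemma negligible_faces a :
  mu.-negligible [set x : E | exists i : 'I_n.+1, x 0 i = a 0 i].
Proof.
pose F (k : nat) := [set x : E | exists i : 'I_n.+1, i = k :> nat /\ x 0 i = a 0 i].
apply: (@negligibleS _ _ _ _ (\bigcup_k F k)).
  by move=> x [i xi]; exists i => //; exists i.
apply: negligible_bigcup => k; have [kn|kn] := ltnP k n.+1; last first.
  apply: (@negligibleS _ _ _ _ set0); last exact: negligible_set0.
  by move=> x [i [ik _]]; move: kn; rewrite -ik leqNgt ltn_ord.
exists [set x : E | x 0 (Ordinal kn) = a 0 (Ordinal kn)]; split.
- have := @measurable_coord R n (Ordinal kn) setT measurableT _ (measurable_set1 (a 0 (Ordinal kn))).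
  by rewrite setTI.
- exact: hyperplane_null.
- move=> x [i [ik xi]] /=; rewrite (_ : Ordinal kn = i)//.
  exact/val_inj.
Qed.

Lemma negligible_cbox_box a b : mu.-negligible (cbox a b `\` box a b).
Proof.
apply: negligibleS (negligible_faces a) => x [xc nx]; apply: contrapT => h; apply: nx => k.
have /andP[h1 ->] := xc k; rewrite andbT lt_neqAle h1 andbT; apply/eqP => e.
by apply: h; exists k.
Qed.

Definition bump_box m a b : V -> R := prodf (fun i => bump m (a 0 i) (b 0 i)).

Lemma bump_box_ge0 m a b x : 0 <= bump_box m a b x.
Proof. by apply: prodr_ge0 => i _; exact: bump_ge0. Qed.

Lemma bump_box_le1 m a b x : bump_box m a b x <= 1.
Proof. by apply: prodr_ile1 => i _; rewrite bump_ge0 bump_le1. Qed.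

Lemma bump_supp m (a b t : R) : bump m a b t != 0 -> a <= t <= b.
Proof.
apply: contra_neqT; rewrite negb_and -!ltNge => h; apply: bump_eq0.
by case/orP: h => /ltW ->; rewrite ?orbT.
Qed.

Lemma bump_box_continuous m a b : continuous (bump_box m a b).
Proof. by apply: prodf_continuous => i; exact/smooth1_continuous/smooth1_bump. Qed.

Lemma bump_box_cvg a b (x : V) : (forall i, x 0 i != b 0 i) ->
  (fun m => bump_box m a b x) @ \oo --> (\1_(box a b) x : R).
Proof.
move=> xb.
have H (s : seq 'I_n.+1) :
   (fun m => \prod_(i <- s) bump m (a 0 i) (b 0 i) (x 0 i)) @ \oo -->
   (\prod_(i <- s) (a 0 i < x 0 i <= b 0 i)%R%:R : R).
  elim: s => [|i s IH].
    rewrite big_nil (_ : (fun m => _) = cst 1); first exact: cvg_cst.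
    by apply/funext => y; rewrite big_nil.
  rewrite big_cons (_ : (fun m => _) = (fun m => bump m (a 0 i) (b 0 i) (x 0 i) *
     \prod_(k <- s) bump m (a 0 k) (b 0 k) (x 0 k))).
    by apply: cvgM => //; exact: bump_cvg.
  by apply/funext => y; rewrite big_cons.
suff -> : (\1_(box a b) x : R) = \prod_i (a 0 i < x 0 i <= b 0 i)%R%:R by exact: H.
rewrite indicE; have [bx|nbx] := pselect (box a b x).
  by rewrite mem_set// big1// => i _; rewrite bx.
rewrite memNset//; have /existsNP[i /negP/negbTE ni] := nbx.
by rewrite (bigD1 i)//= ni mul0r.
Qed.

Lemma ae_off_faces b : {ae mu, forall x : E, forall i, x 0 i != b 0 i}.
Proof.
apply: negligibleS (negligible_faces b) => x /= /existsNP[i /negP].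
by rewrite negbK => /eqP xi; exists i.
Qed.

(** The bumps of a half-open box converge to its indicator off the faces, which are
    null. *)
Lemma integral_bump_box a b v : mu.-integrable (cbox a b : set E) (EFin \o v) ->
  (fun m => \int[mu]_(x in (cbox a b : set E)) (v x * bump_box m a b x)) @ \oo -->
  \int[mu]_(x in (box a b : set E)) v x.
Proof.
move=> iv; have mc := measurable_cbox a b.
have mv : measurable_fun (cbox a b : set E) v by apply/measurable_EFinP; exact: measurable_int iv.
have [|||||_ _] := @dominated_convergence _ E R mu (cbox a b) mc
  (fun m x => (v x * bump_box m a b x)%:E) (fun x => (v x * \1_(box a b) x)%:E)
  (fun x => `|(v x)%:E|%E).
- move=> m; apply/measurable_EFinP; apply: measurable_funM => //.
  by apply: continuous_measurable_Rn; exact: bump_box_continuous.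
- apply/measurable_EFinP; apply: measurable_funM => //.
  by apply: measurable_indic; exact: measurable_box.
- apply: filterS (ae_off_faces b) => x xb _.
  apply/fine_cvgP; split; first exact: nearW.
  by apply: cvgMl_tmp; exact: bump_box_cvg.
- exact: integrable_abse.
- apply/aeW => x m _; rewrite lee_fin normrM ler_piMr// ger0_norm ?bump_box_ge0//.
  exact: bump_box_le1.
have E1 : (\int[mu]_(x in cbox a b) (v x * \1_(box a b) x)%:E =
    \int[mu]_(x in box a b) (v x)%:E)%E.
  rewrite -[in RHS](setIidr (@box_cbox _ _ a b)) integral_mkcondr.
  apply: eq_integral => x _; rewrite patchE indicE; case: ifPn => xb.
    by rewrite mulr1.
  by rewrite mulr0.
have fin : (\int[mu]_(x in box a b) (v x)%:E)%E \is a fin_num.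
  apply: (integrable_fin_num (measurable_box a b)).
  by apply: integrableS iv => //; [exact: measurable_box|exact: box_cbox].
by rewrite E1 -(fineK fin) => /fine_cvg.
Qed.

Lemma Rintegral_cbox Om f a b : cbox a b `<=` Om ->
  (forall x, Om x -> ~ cbox a b x -> f x = 0) ->
  \int[mu]_(x in (Om : set E)) f x = \int[mu]_(x in (cbox a b : set E)) f x.
Proof.
move=> abOm f0; rewrite Rintegral_mkcond [RHS]Rintegral_mkcond.
apply: eq_Rintegral => x _; rewrite !patchE; case: ifPn => [/set_mem xO|xO].
  by case: ifPn => // /negP xc; apply: f0 => // xc'; apply: xc; rewrite inE.
case: ifPn => // /set_mem/abOm xO'; by move: xO; rewrite mem_set.
Qed.

Lemma bump_box_out m a b x : ~ cbox a b x -> bump_box m a b x = 0.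
Proof.
move=> /existsNP[i /negP h]; rewrite /bump_box /prodf (bigD1 i)//= bump_eq0 ?mul0r//.
by move: h; rewrite negb_and -!ltNge => /orP[] /ltW ->; rewrite ?orbT.
Qed.

Lemma test_bump_box Om m a b : cbox a b `<=` Om -> test_function Om (bump_box m a b).
Proof.
move=> abOm; apply: test_prodf abOm => [i|i t]; first exact: smooth1_bump.
exact: bump_supp.
Qed.

Definition midpoint i (c : V * V) : R := (c.1 0 i + c.2 0 i) / 2.

Definition lower i (c : V * V) : V * V := (c.1, set_coord c.2 i (midpoint i c)).

Definition upper i (c : V * V) : V * V := (set_coord c.1 i (midpoint i c), c.2).

Definition vbox (c : V * V) : set E := box c.1 c.2.

Definition vcbox (c : V * V) : set E := cbox c.1 c.2.

Lemma vbox_split i c : vbox c = vbox (lower i c) `|` vbox (upper i c).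
Proof.
apply/seteqP; split=> x.
  move=> xc; have [xm|xm] := leP (x 0 i) (midpoint i c); [left|right] => k;
    rewrite /= set_coordE; case: eqP => [->|_]; rewrite ?xm ?andbT; try exact: xc;
    by have /andP[] := xc i.
case=> xc k; have := xc i; have := xc k; rewrite /= !set_coordE eqxx /midpoint.
  case: eqP => [->|_ -> //]; move=> _ /andP[h1 h2]; apply/andP; split; lra.
case: eqP => [->|_ -> //]; move=> _ /andP[h1 h2]; apply/andP; split; lra.
Qed.

Lemma vbox_disj i c : [disjoint vbox (lower i c) & vbox (upper i c)].
Proof.
rewrite disj_set2E; apply/eqP/seteqP; split=> // x [/(_ i)/andP[_ h] /(_ i)/andP[h' _]].
by move: h h'; rewrite /= !set_coordE eqxx => h /lt_le_trans/(_ h); rewrite ltxx.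
Qed.

Lemma vcbox_lower i c : vbox c !=set0 -> vcbox (lower i c) `<=` vcbox c.
Proof.
move=> [y yc] x xc k; have := xc k; have /andP[y1 y2] := yc i.
rewrite /= set_coordE; case: eqP => [->|_ //]; rewrite /midpoint => /andP[-> h] /=; lra.
Qed.

Lemma vcbox_upper i c : vbox c !=set0 -> vcbox (upper i c) `<=` vcbox c.
Proof.
move=> [y yc] x xc k; have := xc k; have /andP[y1 y2] := yc i.
rewrite /= set_coordE; case: eqP => [->|_ //]; rewrite /midpoint => /andP[h ->]; lra.
Qed.

Lemma integrable_mul_bounded (D : set E) (f phi : E -> R) (M : R) : measurable D ->
  mu.-integrable D (EFin \o f) -> measurable_fun D phi ->
  (forall x, D x -> `|phi x| <= M) -> mu.-integrable D (EFin \o (fun x => f x * phi x)).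
Proof.
move=> mD if_ mphi phiM.
apply: (@le_integrable _ _ _ _ _ mD _ (EFin \o (fun x => M * `|f x|))).
- apply/measurable_EFinP; apply: measurable_funM => //.
  by apply/measurable_EFinP; exact: measurable_int if_.
- move=> x Dx /=; rewrite lee_fin; apply: le_trans (ler_norm _).
  by rewrite normrM mulrC ler_wpM2r// phiM.
- by apply: integrableZ_EFin => //; exact: integrable_norm.
Qed.

Lemma Rintegral_box f a b : mu.-integrable (cbox a b : set E) (EFin \o f) ->
  \int[mu]_(x in (box a b : set E)) f x = \int[mu]_(x in (cbox a b : set E)) f x.
Proof.
move=> if_; have mb := measurable_box a b; have mc := measurable_cbox a b.
have md : measurable (cbox a b `\` box a b : set E) by exact: measurableD.
rewrite /Rintegral; congr fine.
have md0 : mu (cbox a b `\` box a b : set E) = 0%E.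
  by apply/negligibleP => //; exact: negligible_cbox_box.
rewrite [RHS](negligible_integral md mc if_ md0) setDD setIidr//; exact: box_cbox.
Qed.

Lemma cvg_le_bound (h : nat -> R) (l M : R) : h @ \oo --> l ->
  (forall m, h m <= M) -> l <= M.
Proof.
move=> cv H; rewrite -(cvg_lim _ cv)//; apply: limr_le; first by apply/cvg_ex; exists l.
exact: nearW.
Qed.

(** Test the weak derivative with the hat function in the variable [i] times bumps
    in the other variables.  Its derivative is the difference of the bumps of the
    two halves and it is bounded by half of the side; then let the bumps tend to
    the indicators. *)
Lemma halving Om u g i c : weak_gradient Om u g -> vcbox c `<=` Om -> vbox c !=set0 ->
  `|\int[mu]_(x in vbox (lower i c)) u x - \int[mu]_(x in vbox (upper i c)) u x| <=
  (c.2 0 i - c.1 0 i) / 2 * \int[mu]_(x in vbox c) `|g x 0 i|.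
Proof.
move=> [lu lg wg] cOm c0; have [y yc] := c0; have /andP[y1 y2] := yc i.
set L := (c.2 0 i - c.1 0 i) / 2.
have L0 : 0 < L by rewrite divr_gt0// subr_gt0 (lt_le_trans y1).
have mid : c.1 0 i + L = midpoint i c by rewrite /L /midpoint; lra.
have top : c.1 0 i + L + L = c.2 0 i by rewrite /L; lra.
have mc : measurable (vcbox c) by exact: measurable_cbox.
have iu : mu.-integrable (vcbox c) (EFin \o u) by exact: integrable_cbox lu cOm.
have ig : mu.-integrable (vcbox c) (EFin \o (fun x => g x 0 i)) by exact: integrable_cbox (lg i) cOm.
have lowc : vcbox (lower i c) `<=` vcbox c by exact: vcbox_lower.
have upc : vcbox (upper i c) `<=` vcbox c by exact: vcbox_upper.
have Egbox : \int[mu]_(x in vbox c) `|g x 0 i| = \int[mu]_(x in vcbox c) `|g x 0 i|.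
  by apply: Rintegral_box; exact: integrable_norm.
have bnd m : `|\int[mu]_(x in vcbox (lower i c)) (u x * bump_box m (lower i c).1 (lower i c).2 x) -
    \int[mu]_(x in vcbox (upper i c)) (u x * bump_box m (upper i c).1 (upper i c).2 x)| <=
    L * \int[mu]_(x in vbox c) `|g x 0 i|.
  have [psi [spsi dpsi bpsi supp]] := hat_exists m (c.1 0 i) L0.
  rewrite top mid in dpsi; rewrite top in supp.
  (* The hat function in the variable [i], bumps in the others. *)
  pose G k := if k == i then psi else bump m (c.1 0 k) (c.2 0 k).
  have tG : test_function Om (prodf G).
    apply: (@test_prodf _ _ _ _ c.1 c.2) => // k; rewrite /G.
      by case: eqP => _ //; exact: smooth1_bump.
    by case: eqP => [->|_]; [exact: supp|move=> t; exact: bump_supp].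
  have GL x : `|prodf G x| <= L.
    rewrite /prodf (bigD1 i)//= {1}/G eqxx normrM -[leRHS]mulr1.
    apply: ler_pM => //; rewrite ger0_norm.
      by apply: prodr_ile1 => k ki; rewrite /G (negbTE ki) bump_ge0 bump_le1.
    by apply: prodr_ge0 => k ki; rewrite /G (negbTE ki) bump_ge0.
  have G0 x : ~ vcbox c x -> prodf G x = 0.
    move=> /existsNP[k /negP h]; rewrite /prodf (bigD1 k)//=; apply/eqP.
    rewrite mulf_eq0; apply/orP; left; apply: contraNT h; rewrite /G.
    by case: (k =P i) => [->|_]; [exact: supp|exact: bump_supp].
  have DG x : 'D_(delta_mx 0 i) (prodf G) x =
      bump_box m (lower i c).1 (lower i c).2 x - bump_box m (upper i c).1 (upper i c).2 x.
    have dGi : is_derive (x 0 i) (1 : R) (G i) (bump m (c.1 0 i) (midpoint i c) (x 0 i) -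
       bump m (midpoint i c) (c.2 0 i) (x 0 i)).
      by rewrite /G eqxx; exact: dpsi.
    have [_ ->] := prodf_is_derive dGi.
    rewrite mulrBr /bump_box /prodf; congr (_ - _); rewrite [RHS](bigD1 i)//= mulrC.
      rewrite set_coordE eqxx; congr (_ * _); apply: eq_bigr => k /negbTE ki.
      by rewrite /G ki set_coordE ki.
    rewrite set_coordE eqxx; congr (_ * _); apply: eq_bigr => k /negbTE ki.
    by rewrite /G ki set_coordE ki.
  have mbump a b (D : set E) : measurable_fun D (bump_box m a b).
    by apply: continuous_measurable_Rn; exact: bump_box_continuous.
  have nbump a b x : `|bump_box m a b x| <= 1 by rewrite ger0_norm ?bump_box_le1 ?bump_box_ge0.
  have := wg _ i tG.
  rewrite (@Rintegral_cbox Om _ c.1 c.2)//; last first.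
    move=> x _ xc; rewrite DG !bump_box_out ?subrr ?mulr0//.
      by move=> /upc.
    by move=> /lowc.
  rewrite [in X in _ = - X -> _](@Rintegral_cbox Om _ c.1 c.2)//; last first.
    by move=> x _ /G0 ->; rewrite mulr0.
  move=> E1.
  have E2 : \int[mu]_(x in vcbox c) (u x * 'D_(delta_mx 0 i) (prodf G) x) =
     \int[mu]_(x in vcbox (lower i c)) (u x * bump_box m (lower i c).1 (lower i c).2 x) -
    \int[mu]_(x in vcbox (upper i c)) (u x * bump_box m (upper i c).1 (upper i c).2 x).
    rewrite (@eq_Rintegral _ E R mu (vcbox c) (fun x : E => u x * bump_box m (lower i c).1 (lower i c).2 x -
      u x * bump_box m (upper i c).1 (upper i c).2 x)); last first.
      by move=> x _; rewrite DG mulrBr.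
    rewrite RintegralB//; [|exact: (integrable_mul_bounded mc iu (mbump _ _ _) (fun x _ => nbump _ _ x))..].
    congr (_ - _); (apply: Rintegral_cbox => //; move=> x _ h; rewrite bump_box_out ?mulr0//).
  rewrite -E2 E1 normrN Egbox.
  have igG : mu.-integrable (vcbox c) (EFin \o (fun x => g x 0 i * prodf G x)).
    apply: (integrable_mul_bounded mc ig _ (fun x _ => GL x)).
    apply: continuous_measurable_Rn; apply: prodf_continuous => k; apply: smooth1_continuous.
    by rewrite /G; case: eqP => _ //; exact: smooth1_bump.
  apply: le_trans (le_normr_Rintegral mc igG) _.
  rewrite -RintegralZl//; last exact: integrable_norm.
  apply: le_Rintegral => //.
  - exact: integrable_norm.
  - by apply: integrableZ_EFin => //; exact: integrable_norm.
  - by move=> x _; rewrite normrM mulrC ler_wpM2r.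
have cvl := integral_bump_box (integrableS mc (measurable_cbox _ _) lowc iu).
have cvu := integral_bump_box (integrableS mc (measurable_cbox _ _) upc iu).
apply: (@cvg_le_bound (fun m => `|_ - _|) _ _ _ bnd).
exact: cvg_norm (cvgB cvl cvu).
Qed.

End box_integrals.

(** * Cutting boxes into cells *)
Section cells.
Variables (R : realType) (n : nat).
Local Notation V := 'rV[R]_n.+1.
Local Notation E := (Rn R n).
Local Notation mu := (@leb R n).
Implicit Types (Om : set V) (v u f : V -> R) (g : V -> V) (c : V * V).

(** The cells obtained by halving all boxes at hand along each coordinate of [s] in
    turn. *)
Fixpoint cells (s : seq 'I_n.+1) c : seq (V * V) :=
  if s is i :: s' then cells s' (lower i c) ++ cells s' (upper i c) else [:: c].

Definition side c (i : 'I_n.+1) : R := c.2 0 i - c.1 0 i.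

Lemma measurable_vbox c : measurable (vbox c).
Proof. exact: measurable_box. Qed.

Lemma side_lower i c k : side (lower i c) k = if k == i then side c k / 2 else side c k.
Proof.
by rewrite /side /= set_coordE; case: eqP => [->|//]; rewrite /midpoint; lra.
Qed.

Lemma side_upper i c k : side (upper i c) k = if k == i then side c k / 2 else side c k.
Proof.
by rewrite /side /= set_coordE; case: eqP => [->|//]; rewrite /midpoint; lra.
Qed.

Lemma sum_side_halved (c c' : V * V) i :
  (forall k, side c' k = if k == i then side c k / 2 else side c k) ->
  \sum_k side c' k = \sum_k side c k - side c i / 2.
Proof.
move=> H; rewrite (bigD1 i)//= [in RHS](bigD1 i)//= H eqxx.
rewrite (eq_bigr (fun k => side c k)); last by move=> k /negbTE ki; rewrite H ki.
lra.
Qed.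

Lemma vboxS_lower i c : vbox (lower i c) `<=` vbox c.
Proof. by rewrite (vbox_split i c); left. Qed.

Lemma vboxS_upper i c : vbox (upper i c) `<=` vbox c.
Proof. by rewrite (vbox_split i c); right. Qed.

Lemma integrable_vboxS c c' f : vbox c' `<=` vbox c ->
  mu.-integrable (vbox c) (EFin \o f) -> mu.-integrable (vbox c') (EFin \o f).
Proof. by move=> sub; apply: integrableS => //; exact: measurable_vbox. Qed.

Lemma Rintegral_split i c f : mu.-integrable (vbox c) (EFin \o f) ->
  \int[mu]_(x in vbox c) f x =
  \int[mu]_(x in vbox (lower i c)) f x + \int[mu]_(x in vbox (upper i c)) f x.
Proof.
move=> if_; rewrite [in LHS](vbox_split i c) Rintegral_setU//.
- exact: measurable_vbox.
- exact: measurable_vbox.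
- by rewrite -vbox_split.
- exact: vbox_disj.
Qed.

Lemma Rintegral_cells s c f : mu.-integrable (vbox c) (EFin \o f) ->
  \int[mu]_(x in vbox c) f x = \sum_(c' <- cells s c) \int[mu]_(x in vbox c') f x.
Proof.
elim: s c => [|i s IH] c if_; first by rewrite /= big_seq1.
rewrite /= big_cat/= -!IH; first exact: Rintegral_split.
  by apply: integrable_vboxS if_; exact: vboxS_upper.
by apply: integrable_vboxS if_; exact: vboxS_lower.
Qed.

Lemma cells_cat s s' c : cells (s ++ s') c = flatten [seq cells s' c' | c' <- cells s c].
Proof.
elim: s c => [|i s IH] c; first by rewrite /= cats0.
by rewrite /= !IH map_cat flatten_cat.
Qed.

Lemma cells_sub s c c' : c' \in cells s c -> vbox c' `<=` vbox c.
Proof.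
elim: s c => [|i s IH] c; first by rewrite inE => /eqP ->.
rewrite mem_cat => /orP[/IH h|/IH h]; apply: subset_trans h _.
  exact: vboxS_lower.
exact: vboxS_upper.
Qed.

Lemma side_cells s c c' k : c' \in cells s c -> side c' k = side c k / 2 ^+ count_mem k s.
Proof.
elim: s c => [|i s IH] c; first by rewrite inE => /eqP ->; rewrite divr1.
rewrite mem_cat /= => /orP[/IH ->|/IH ->]; rewrite (side_lower, side_upper) [i == k]eq_sym;
  case: eqP => _; rewrite ?add0n// add1n exprS invfM mulrA//.
Qed.

(** A round halves every side once, so that cells shrink in all directions. *)
Definition rounds (m : nat) : seq 'I_n.+1 := flatten (nseq m (enum 'I_n.+1)).

Lemma count_rounds m k : count_mem k (rounds m) = m.
Proof.
elim: m => [//|m IH]; rewrite /rounds /= count_cat -/(rounds m) IH.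
by rewrite count_uniq_mem ?enum_uniq// mem_enum.
Qed.

Lemma rounds_add m m' : rounds (m + m') = rounds m ++ rounds m'.
Proof. by rewrite /rounds nseqD flatten_cat. Qed.

Definition cell_sum s c f : R := \sum_(c' <- cells s c) `|\int[mu]_(x in vbox c') f x|.

Definition norm1 (g : V -> V) (x : V) : R := \sum_i `|g x 0 i|.

Lemma Rintegral_vbox0 c f : ~ (vbox c !=set0) -> \int[mu]_(x in vbox c) f x = 0.
Proof.
by move=> h; rewrite (_ : vbox c = set0) ?Rintegral_set0//; exact/nonemptyPn.
Qed.

Lemma integrable_norm1 Om u g c : weak_gradient Om u g -> vcbox c `<=` Om ->
  mu.-integrable (vcbox c) (EFin \o norm1 g).
Proof.
move=> [_ lg _] cOm.
rewrite (_ : EFin \o _ = fun x => (\sum_(i <- index_enum _) `|g x 0 i|%:E)%E); last first.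
  by apply/funext => x; rewrite /= /norm1 sumEFin.
apply: integrable_sum; first exact: measurable_cbox.
move=> i _; apply: integrable_norm; exact: integrable_cbox (lg i) cOm.
Qed.

(** By [halving], cutting along the coordinate [i] increases the sum of absolute
    values by at most half of the side times the integral of the gradient.  The
    side is halved at the same time, and so the factor [2 * \sum_k side c k]
    decreases by the whole of the side, which pays for the cut. *)
Lemma cell_sum_le Om u g s c : weak_gradient Om u g -> vcbox c `<=` Om ->
  cell_sum s c u <= `|\int[mu]_(x in vbox c) u x| +
    2 * (\sum_k side c k) * \int[mu]_(x in vbox c) norm1 g x.
Proof.
move=> wg; elim: s c => [|i s IH] c cOm.
  rewrite /cell_sum /= big_seq1.
  have [c0|c0] := pselect (vbox c !=set0); last by rewrite !Rintegral_vbox0// mulr0 addr0.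
  rewrite lerDl mulr_ge0//; last first.
    by apply: Rintegral_ge0 => x _; apply: sumr_ge0.
  rewrite mulr_ge0//; apply: sumr_ge0 => k _; rewrite subr_ge0.
  by have [y yc] := c0; have /andP[/ltW h1 h2] := yc k; exact: le_trans h1 h2.
have [c0|c0] := pselect (vbox c !=set0); last first.
  rewrite !Rintegral_vbox0// normr0 mulr0 addr0 /cell_sum big_seq big1// => c' /cells_sub sub.
  rewrite Rintegral_vbox0 ?normr0// => -[y /sub yc]; apply: c0; by exists y.
rewrite /cell_sum /= big_cat/= -/(cell_sum s (lower i c) u) -/(cell_sum s (upper i c) u).
have lOm := subset_trans (vcbox_lower (i := i) c0) cOm.
have uOm := subset_trans (vcbox_upper (i := i) c0) cOm.
have := IH _ lOm; have := IH _ uOm.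
rewrite (sum_side_halved (side_lower i c)) (sum_side_halved (side_upper i c)).
have iu : mu.-integrable (vbox c) (EFin \o u) by apply: integrable_box cOm; case: wg.
have iG : mu.-integrable (vbox c) (EFin \o norm1 g).
  apply: integrableS (integrable_norm1 wg cOm); [exact: measurable_cbox|exact: measurable_box|].
  exact: box_cbox.
have ig : mu.-integrable (vbox c) (EFin \o (fun x => g x 0 i)).
  by case: wg => _ lg _; exact: integrable_box (lg i) cOm.
have := Rintegral_split i iu; have := Rintegral_split i iG.
have := halving i wg cOm c0.
have hG : \int[mu]_(x in vbox c) `|g x 0 i| <= \int[mu]_(x in vbox c) norm1 g x.
  apply: le_Rintegral => //; [exact: measurable_box|exact: integrable_norm|].
  by move=> x _; rewrite /norm1 (bigD1 i)//= lerDl sumr_ge0.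
have S0 : 0 <= side c i.
  by have [y yc] := c0; have /andP[/ltW h1 h2] := yc i; rewrite subr_ge0; exact: le_trans h1 h2.
rewrite -/(side c i).
set V1 := \int[mu]_(x in vbox (lower i c)) u x; set V2 := \int[mu]_(x in vbox (upper i c)) u x.
set G1 := \int[mu]_(x in vbox (lower i c)) _; set G2 := \int[mu]_(x in vbox (upper i c)) _.
set G := \int[mu]_(x in vbox c) norm1 g x in hG *.
set S := \sum_k side c k; set sc := side c i in S0 *.
move=> hV EG -> hu hl.
have hV' : `|V1 - V2| <= sc / 2 * G.
  by apply: le_trans hV _; rewrite ler_wpM2l// divr_ge0.
(* The larger of the two right-hand terms is the left-hand side, according to signs. *)
have tri : `|V1| + `|V2| <= `|V1 + V2| + `|V1 - V2|.
  have := ler_norm (V1 + V2); have := ler_norm (- (V1 + V2)).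
  have := ler_norm (V1 - V2); have := ler_norm (- (V1 - V2)); rewrite !normrN.
  have [?|?] := ler0P V1; have [?|?] := ler0P V2; lra.
have scG : 0 <= sc * G.
  by rewrite mulr_ge0//; apply: Rintegral_ge0 => x _; exact: sumr_ge0.
have e : 2 * (S - sc / 2) * G1 + 2 * (S - sc / 2) * G2 = 2 * S * G - sc * G.
  by rewrite EG; lra.
rewrite EG in hV' e scG *; lra.
Qed.

End cells.

(** * Cell sums and the norm of L^1 *)
Section approximation.
Variables (R : realType) (n : nat).
Local Notation V := 'rV[R]_n.+1.
Local Notation E := (Rn R n).
Local Notation mu := (@leb R n).
Implicit Types (D : set E) (v w f : V -> R) (c : V * V).

(** A smooth approximation of the indicator of a finite union of boxes that need
    not be disjoint. *)
Definition bump_union m (ab : nat -> V * V) (k : nat) (x : V) : R :=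
  1 - \prod_(i < k) (1 - bump_box m (ab i).1 (ab i).2 x).

Lemma bump_union01 m ab k x : 0 <= bump_union m ab k x <= 1.
Proof.
have h (i : 'I_k) : 0 <= 1 - bump_box m (ab i).1 (ab i).2 x <= 1.
  by have := bump_box_ge0 m (ab i).1 (ab i).2 x;
     have := bump_box_le1 m (ab i).1 (ab i).2 x => ? ?; apply/andP; split; lra.
have : 0 <= \prod_(i < k) (1 - bump_box m (ab i).1 (ab i).2 x).
  by apply: prodr_ge0 => i _; have /andP[] := h i.
have : \prod_(i < k) (1 - bump_box m (ab i).1 (ab i).2 x) <= 1.
  by apply: prodr_ile1 => i _.
by rewrite /bump_union => ? ?; apply/andP; split; lra.
Qed.

Lemma cvg_prodr (T I : Type) (F : set_system T) (s : seq I) (h : I -> T -> R)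
    (l : I -> R) : Filter F -> (forall i, h i @ F --> l i) ->
  (fun x => \prod_(i <- s) h i x) @ F --> \prod_(i <- s) l i.
Proof.
move=> FF fl; elim: s => [|i s IH].
  rewrite big_nil (_ : (fun x => _) = fun=> 1); first exact: cvg_cst.
  by apply/funext => x; rewrite big_nil.
rewrite big_cons (_ : (fun x => _) = (fun x => h i x * \prod_(j <- s) h j x)).
  exact: cvgM.
by apply/funext => x; rewrite big_cons.
Qed.

Lemma bump_union_continuous m ab k : continuous (bump_union m ab k).
Proof.
suff H (x : V) : (fun y : V => \prod_(i < k) (1 - bump_box m (ab i).1 (ab i).2 y)) @ x -->
    \prod_(i < k) (1 - bump_box m (ab i).1 (ab i).2 x).
  by move=> x; exact: (cvgB (@cst_continuous V R 1 x) (H x)).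
apply: (@cvg_prodr V 'I_k (nbhs x) _ (fun i y => 1 - bump_box m (ab i).1 (ab i).2 y)
  (fun i => 1 - bump_box m (ab i).1 (ab i).2 x)) => i.
exact: (cvgB (@cst_continuous V R 1 x) (@bump_box_continuous R n m _ _ x)).
Qed.

Lemma bump_union_cvg ab k : {ae mu, forall x : E,
  (fun m => bump_union m ab k x) @ \oo -->
  (\1_(\big[setU/set0]_(i < k) vbox (ab i)) x : R)}.
Proof.
have := @ae_foralln _ E _ mu (fun i x => forall j, x 0 j != (ab i).2 0 j)
  (fun i => ae_off_faces (ab i).2).
apply: filterS => x xb.
have -> : (\1_(\big[setU/set0]_(i < k) vbox (ab i)) x : R) =
    1 - \prod_(i < k) (1 - \1_(vbox (ab i)) x).
  elim: k => [|k IH]; first by rewrite !big_ord0 subrr indicE in_set0.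
  rewrite !big_ord_recr/= [in RHS]indicE indicE in_setU.
  move: IH; rewrite indicE => IH.
  case: (x \in vbox (ab k)); first by rewrite orbT subrr mulr0 subr0.
  by rewrite orbF subr0 mulr1 IH.
apply: cvgB; first exact: cvg_cst.
apply: (@cvg_prodr nat 'I_k \oo _ (fun i m => 1 - bump_box m (ab i).1 (ab i).2 x)
  (fun i => 1 - \1_(vbox (ab i)) x)) => i.
by apply: cvgB; [exact: cvg_cst|apply: bump_box_cvg; exact: xb].
Qed.

(** The set is approximated in measure by finitely many boxes, and their union by
    bumps; uniform smallness of the integrable weight [w] transfers the first
    approximation to the weighted integral. *)
Lemma approx_indicator D (A : set E) w (e : R) : measurable D -> (mu D < +oo)%E ->
  measurable A -> A `<=` D ->
  mu.-integrable D (EFin \o w) -> (forall x, D x -> 0 <= w x) -> 0 < e ->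
  exists phi : V -> R, [/\ continuous phi, forall x, 0 <= phi x <= 1 &
    \int[mu]_(x in D) (w x * `|\1_A x - phi x|) <= e].
Proof.
have aux (p q t : R) : p <= t / 2 -> q <= t / 4 -> 0 < t -> p + q <= t by lra.
move=> mD Doo mA AD iw w0 e0.
have e40 : 0 < e / 4 by rewrite divr_gt0.
have [F [dl [mF FD Foo dl0 H]]] := unif_small_integrable mD w0 iw e40.
have Aoo : (mu A < +oo)%E by apply: le_lt_trans Doo; apply: le_measure; rewrite ?inE.
have [ab [k [s1 s2]]] := leb_approx_boxes mA Aoo dl0.
set G : set E := \big[setU/set0]_(i < k) vbox (ab i).
have mG : measurable G by apply: bigsetU_measurable => i _; exact: measurable_vbox.
have mw : measurable_fun D w by apply/measurable_EFinP; exact: measurable_int iw.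
have md1 (B : set E) (phi : E -> R) : measurable B -> measurable_fun D phi -> measurable_fun D
    (fun x => `|\1_B x - phi x|).
  move=> mB mphi; have mI : measurable_fun D (\1_B : E -> R) by exact: measurable_indic.
  have := measurableT_comp (@normr_measurable R setT) (measurable_funB mI mphi).
  exact.
have i01 (B : set E) (x : E) : 0 <= (\1_B x : R) <= 1.
  by rewrite indicE; case: (x \in B); rewrite lexx ler01.
have int1 (B : set E) (phi : E -> R) : measurable B -> measurable_fun D phi -> (forall x, 0 <= phi x <= 1) ->
    mu.-integrable D (EFin \o (fun x => w x * `|\1_B x - phi x|)).
  move=> mB mphi p01.
  apply: (@integrable_mul_bounded R n D w _ 1 mD iw (md1 _ _ mB mphi)).
  move=> x _; rewrite normr_id ler_norml.
  by have /andP[? ?] := p01 x; have /andP[? ?] := i01 B x; apply/andP; split; lra.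
have mIG : measurable_fun D (\1_G : E -> R) by exact: measurable_indic.
have AG : \int[mu]_(x in D) (w x * `|\1_A x - \1_G x|) <= e / 2.
  have sub : (\int[mu]_(x in D) (w x * `|\1_A x - \1_G x|)%:E <=
      \int[mu]_(x in A `\` G) (w x)%:E + \int[mu]_(x in D `&` (G `\` A)) (w x)%:E)%E.
    rewrite -ge0_integral_setU//.
    - have UD : (A `\` G) `|` (D `&` (G `\` A)) `<=` D.
        by rewrite subUset; split=> x [h1 h2] => //; exact: AD.
      rewrite -[X in (_ <= integral _ X _)%E](setIidr UD) integral_mkcondr.
      apply: ge0_le_integral => //.
      + by move=> x Dx; rewrite lee_fin mulr_ge0// w0.
      + exact: (measurable_int _ (int1 _ _ mA mIG (i01 G))).
      + apply/measurable_restrict => //; last by apply: measurable_funS (measurable_int _ iw).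
        by apply: measurableU; [exact: measurableD|apply: measurableI => //; exact: measurableD].
      + move=> x Dx; rewrite patchE !indicE.
        have [xA|xA] := boolP (x \in A); have [xG|xG] := boolP (x \in G);
          rewrite /= ?(subrr, subr0, sub0r) ?normrN ?normr0 ?normr1 ?mulr0 ?mulr1.
        * by case: ifP => // _; rewrite lee_fin w0.
        * by rewrite mem_set//; left; split; [exact/set_mem|move=> /mem_set; rewrite (negbTE xG)].
        * by rewrite mem_set//; right; split=> //; split; [exact/set_mem|move=> /mem_set; rewrite (negbTE xA)].
        * by case: ifP => // _; rewrite lee_fin w0.
    - exact: measurableD.
    - by apply: measurableI => //; exact: measurableD.
    - apply/measurable_EFinP; apply: measurable_funS mw => //.
      by rewrite subUset; split=> x [h1 h2] => //; exact: AD.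
    - by move=> x [[/AD Dx _]|[Dx _]]; rewrite lee_fin w0.
    - by rewrite disj_set2E; apply/eqP/seteqP; split=> // x [[Ax _] [_ [_ nA]]].
  have fin := integrable_fin_num mD (int1 _ _ mA mIG (i01 G)).
  rewrite -lee_fin /Rintegral fineK//; apply: le_trans sub _.
  rewrite (_ : e / 2 = e / 4 + e / 4); last by lra.
  rewrite EFinD; apply: leeD; apply: (H 0%N).
  - exact: measurableD.
  - by move=> x [/AD].
  - apply: le_trans s1; apply: le_measure; rewrite ?inE.
    + by apply: measurableI => //; exact: measurableD.
    + exact: measurableD.
    + by move=> x [].
  - by apply: measurableI => //; exact: measurableD.
  - by move=> x [].
  - apply: le_trans s2; apply: le_measure; rewrite ?inE.
    + by apply: measurableI => //; apply: measurableI => //; exact: measurableD.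
    + exact: measurableD.
    + by move=> x [[]].
have cv : (fun m => \int[mu]_(x in D) (w x * `|\1_G x - bump_union m ab k x|)) @ \oo --> (0 : R).
  have [|||||_ _] := @dominated_convergence _ E R mu D mD
    (fun m x => (w x * `|\1_G x - bump_union m ab k x|)%:E) (cst 0%E) (EFin \o w).
  - move=> m; apply: (measurable_int _ (int1 _ _ mG _ (bump_union01 m ab k))).
    exact: (continuous_measurable_Rn (@bump_union_continuous m ab k)).
  - exact: measurable_cst.
  - apply: filterS (bump_union_cvg ab k) => x cvx _.
    apply/fine_cvgP; split; first exact: nearW.
    rewrite [X in _ --> X](_ : _ = w x * `|\1_G x - \1_G x|); last by rewrite subrr normr0 mulr0.
    apply: cvgMl_tmp; apply: cvg_norm; apply: cvgB => //; exact: cvg_cst.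
  - exact: iw.
  - apply/aeW => x m Dx; rewrite lee_fin normrM normr_id (ger0_norm (w0 _ Dx)) ler_piMr ?w0//.
    have /andP[? ?] := bump_union01 m ab k x; have /andP[? ?] := i01 G x.
    by rewrite ler_norml; apply/andP; split; lra.
  by rewrite integral0 => /fine_cvg.
move/cvgrPdist_lt/(_ _ e40) : cv => [m _ /(_ m (leqnn m))]; rewrite /= sub0r normrN => hm.
have cphi := @bump_union_continuous m ab k.
exists (bump_union m ab k); split=> //; first exact: bump_union01.
have mphi : measurable_fun D (bump_union m ab k) by exact: continuous_measurable_Rn.
have iGm := int1 _ _ mG mphi (bump_union01 m ab k).
have iAm := int1 _ _ mA mphi (bump_union01 m ab k).
have iAG := int1 _ _ mA mIG (i01 G).
apply: (@le_trans _ _ (\int[mu]_(x in D) (w x * `|\1_A x - \1_G x|) +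
   \int[mu]_(x in D) (w x * `|\1_G x - bump_union m ab k x|))).
  rewrite -RintegralD//; apply: le_Rintegral => //.
    exact: (integrableD mD iAG iGm).
  move=> x Dx; rewrite -mulrDr ler_wpM2l ?w0//.
  by rewrite (le_trans _ (ler_normD _ _))// subrKA.
exact: (aux _ _ _ AG (ltW (le_lt_trans (ler_norm _) hm)) e0).
Qed.

Lemma continuous_fine_on_cbox (phi : V -> R) c (e : R) : continuous phi -> 0 < e ->
  exists2 dl, 0 < dl & forall x y : V, vcbox c x -> `|y - x| < dl -> `|phi y - phi x| < e.
Proof.
move=> cphi e0; have e20 : 0 < e / 2 by rewrite divr_gt0.
have /compact_near_coveringP nc : compact (cbox c.1 c.2) by exact: cbox_compact.
have : \forall dl \near (0 : R)^'+, cbox c.1 c.2 `<=`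
    (fun x => forall y : V, `|y - x| < dl -> `|phi y - phi x| < e).
  apply: nc => x _.
  have /cvgrPdist_lt/(_ _ e20)/nbhs_ballP[d /= d0 dP] := cphi x.
  have d20 : 0 < d / 2 by rewrite divr_gt0.
  exists (ball x (d / 2), [set dl | dl < d / 2]); first split=> /=.
  - exact: nbhsx_ballx.
  - exact: nbhs_right_lt.
  move=> [x' dl] /= [x'x dld] y yx'.
  move: x'x; rewrite -ball_normE /= => x'x.
  have h1 : `|phi x - phi x'| < e / 2 by apply: dP; rewrite -ball_normE /=; lra.
  have h2 : `|phi x - phi y| < e / 2.
    apply: dP; rewrite -ball_normE /= (_ : x - y = (x - x') + - (y - x')).
      by apply: le_lt_trans (ler_normD _ _) _; rewrite normrN; lra.
    by rewrite opprB addrA subrK.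
  rewrite (_ : phi y - phi x' = - (phi x - phi y) + (phi x - phi x')); last by ring.
  by apply: le_lt_trans (ler_normD _ _) _; rewrite normrN; lra.
move=> /(filterI (nbhs_right_gt 0))/filter_ex[dl [dl0 dlP]].
by exists dl => // x y xc; exact: dlP.
Qed.

(** Approximate the sign of [v] by a continuous function [phi].  On cells so small
    that [phi] hardly varies, the integral of [v * phi] is nearly a constant of
    absolute value at most 1 times the integral of [v]. *)
Lemma fine_cells c v (e : R) : mu.-integrable (vbox c) (EFin \o v) -> 0 < e ->
  \forall m \near \oo,
    \int[mu]_(x in vbox c) `|v x| <= cell_sum (rounds n m) c v + e.
Proof.
move=> iv e0; have mc := measurable_vbox c.
have [c0|c0] := pselect (vbox c !=set0); last first.
  apply: nearW => m; rewrite Rintegral_vbox0//; apply: addr_ge0; last exact: ltW.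
  by apply: sumr_ge0 => c' _.
have mv : measurable_fun (vbox c) v by apply/measurable_EFinP; exact: measurable_int iv.
have inv := integrable_norm iv.
have coo : (mu (vbox c) < +oo)%E by exact: leb_box_lty.
have e40 : 0 < e / 4 by rewrite divr_gt0.
have mpos : measurable (vbox c `&` [set x | 0 < v x]).
  rewrite (_ : [set x | _] = v @^-1` `]0, +oo[%classic); first exact: mv.
  by apply/seteqP; split=> x /=; rewrite in_itv/= andbT.
have mneg : measurable (vbox c `&` [set x | v x < 0]).
  rewrite (_ : [set x | _] = v @^-1` `]-oo, 0[%classic); first exact: mv.
  by apply/seteqP; split=> x /=; rewrite in_itv/=.
have [p [cp p01 pP]] := approx_indicator mc coo mpos (@subIsetl _ _ _) inv (fun x _ => normr_ge0 (v x)) e40.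
have [q [cq q01 qP]] := approx_indicator mc coo mneg (@subIsetl _ _ _) inv (fun x _ => normr_ge0 (v x)) e40.
pose phi x := p x - q x.
have cphi : continuous phi by move=> x; exact: (cvgB (cp x) (cq x)).
have phi1 x : `|phi x| <= 1.
  rewrite /phi ler_norml; have /andP[? ?] := p01 x; have /andP[? ?] := q01 x.
  by apply/andP; split; lra.
have mphi (D : set E) : measurable_fun D phi by exact: continuous_measurable_Rn.
have ivphi c' : vbox c' `<=` vbox c -> mu.-integrable (vbox c') (EFin \o (fun x => v x * phi x)).
  move=> c'c; apply: (integrable_mul_bounded (measurable_vbox _) _ (mphi _) (fun x _ => phi1 x)).
  exact: integrable_vboxS iv.
set I := \int[mu]_(x in vbox c) `|v x|.
have I0 : 0 <= I by exact: Rintegral_ge0.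
have Ile : I <= \int[mu]_(x in vbox c) (v x * phi x) + e / 2.
  have bint (A : set E) (h : V -> R) : measurable A -> continuous h -> (forall x, 0 <= h x <= 1) ->
      mu.-integrable (vbox c) (EFin \o (fun x => `|v x| * `|\1_A x - h x|)).
    move=> mA ch h01; apply: (@integrable_mul_bounded R n (vbox c) (fun x => `|v x|) _ 1 mc inv).
      have mI : measurable_fun (vbox c) (\1_A : E -> R) by exact: measurable_indic.
      have mh : measurable_fun (vbox c) h by exact: continuous_measurable_Rn.
      by have := measurableT_comp (@normr_measurable R setT) (measurable_funB mI mh); exact.
    move=> x _; rewrite normr_id indicE ler_norml; have /andP[? ?] := h01 x.
    by case: (x \in A); apply/andP; split; rewrite ?mulr1n ?mulr0n; lra.
  have ip := bint _ _ mpos cp p01; have iq := bint _ _ mneg cq q01.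
  have is1 := integrableD mc (ivphi c (@subset_refl _ _)) ip.
  have : I <= \int[mu]_(x in vbox c) (v x * phi x + `|v x| * `|\1_(vbox c `&` [set x | 0 < v x]) x - p x| +
      `|v x| * `|\1_(vbox c `&` [set x | v x < 0]) x - q x|).
    apply: le_Rintegral => //; first exact: (integrableD mc is1 iq).
    move=> x xc; have /andP[? ?] := p01 x; have /andP[? ?] := q01 x.
    rewrite !indicE /phi; have [vx|vx|->] := ltrgtP (v x) 0.
    - rewrite memNset; last by move=> [_ /=]; lra.
      rewrite mem_set// ltr0_norm// /= ?mulr1n ?mulr0n sub0r normrN.
      by rewrite (ger0_norm (_ : 0 <= p x))// (ger0_norm (_ : 0 <= 1 - q x)); lra.
    - rewrite mem_set// memNset; last by move=> [_ /=]; lra.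
      rewrite gtr0_norm// /= ?mulr1n ?mulr0n sub0r normrN.
      by rewrite (ger0_norm (_ : 0 <= q x))// (ger0_norm (_ : 0 <= 1 - p x)); lra.
    - by rewrite normr0 !mul0r !addr0.
  rewrite (RintegralD mc is1 iq) (RintegralD mc (ivphi c (@subset_refl _ _)) ip).
  by move: pP qP; lra.
pose eta := e / 2 / (I + 1).
have eta0 : 0 < eta by rewrite divr_gt0 ?divr_gt0// ltr_wpDl.
have [dl dl0 dlP] := continuous_fine_on_cbox c cphi eta0.
have side0 k : 0 <= side c k.
  by have [y yc] := c0; have /andP[/ltW h1 h2] := yc k; rewrite subr_ge0; exact: le_trans h1 h2.
pose S := \sum_k side c k + 1.
have sideS k : side c k < S.
  rewrite /S (bigD1 k)//= -addrA ltrDl ltr_wpDl// sumr_ge0//.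
have S0 : 0 < S by apply: le_lt_trans (side0 0) (sideS 0).
near=> m.
have Sm : S / 2 ^+ m < dl.
  rewrite ltr_pdivrMr ?exprn_gt0// mulrC -ltr_pdivrMr//.
  apply: (@lt_le_trans _ _ m%:R); first by near: m; exact: nbhs_infty_gtr.
  by rewrite -natrX ler_nat ltnW// ltn_expl.
apply: le_trans Ile _.
rewrite (Rintegral_cells (rounds n m) (ivphi c (@subset_refl _ _))).
have cellle c' : c' \in cells (rounds n m) c -> \int[mu]_(x in vbox c') (v x * phi x) <=
    `|\int[mu]_(x in vbox c') v x| + eta * \int[mu]_(x in vbox c') `|v x|.
  move=> c'c; have sub := cells_sub c'c; have mc' := measurable_vbox c'.
  have iv' := integrable_vboxS sub iv.
  set t := phi c'.2.
  have it : mu.-integrable (vbox c') (EFin \o (fun x => t * v x)) by exact: integrableZ_EFin.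
  have ie : mu.-integrable (vbox c') (EFin \o (fun x => eta * `|v x|)).
    by apply: integrableZ_EFin => //; exact: integrable_norm.
  apply: (@le_trans _ _ (\int[mu]_(x in vbox c') (t * v x + eta * `|v x|))).
    apply: le_Rintegral => //; [exact: ivphi|exact: (integrableD mc' it ie)|].
    move=> x xc'; have : `|phi c'.2 - phi x| < eta.
      apply: dlP; first exact/box_cbox/sub.
      apply: le_lt_trans _ Sm; rewrite [leLHS]/Num.norm/= mx_normrE.
      apply/bigmax_leP; split=> [|[i k] _ /=]; first by rewrite ltW// divr_gt0// exprn_gt0.
      rewrite !mxE ord1; have /andP[h1 h2] := xc' k.
      rewrite ger0_norm ?subr_ge0//.
      apply: (@le_trans _ _ (side c' k)); first by rewrite /side lerD2l lerN2 ltW.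
      by rewrite (side_cells k c'c) count_rounds ler_wpM2r ?invr_ge0 ?exprn_ge0// ltW.
    rewrite -/t distrC => h; have : `|v x * (phi x - t)| <= eta * `|v x|.
      by rewrite normrM mulrC ler_wpM2r// ltW.
    by have := ler_norm (v x * (phi x - t)); lra.
  rewrite RintegralD// !RintegralZl//; last exact: integrable_norm.
  rewrite lerD2r; apply: le_trans (ler_norm _) _; rewrite normrM ler_piMl//; exact: phi1.
apply: (@le_trans _ _ (cell_sum (rounds n m) c v + eta * I + e / 2)).
  rewrite lerD2r /cell_sum /I (Rintegral_cells (rounds n m) inv) mulr_sumr -big_split/=.
  by rewrite big_seq [leRHS]big_seq; apply: ler_sum => c' c'c; exact: cellle.
rewrite -addrA lerD2l {2}(splitr e) lerD2r /eta mulrAC ler_pdivrMr ?ltr_wpDl//.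
by rewrite ler_pM2l ?divr_gt0// lerDl.
Unshelve. all: end_near. Qed.

End approximation.

(** * Weak gradients *)
Section weak_gradients.
Variables (R : realType) (n : nat).
Local Notation V := 'rV[R]_n.+1.
Local Notation E := (Rn R n).
Local Notation mu := (@leb R n).
Implicit Types (Om : set V) (v u f phi : V -> R) (g h : V -> V) (c : V * V).

Lemma cells_vcbox s c c' : c' \in cells s c -> vbox c' !=set0 -> vcbox c' `<=` vcbox c.
Proof.
elim: s c => [|i s IH] c; first by move=> cc'; move: cc'; rewrite inE => /eqP -> _.
move=> cc' c'0; have c0 : vbox c !=set0 by have [y /(cells_sub cc') yc] := c'0; exists y.
move: cc'; rewrite mem_cat => /orP[/IH/(_ c'0) h|/IH/(_ c'0) h]; apply: subset_trans h _.
  exact: vcbox_lower.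
exact: vcbox_upper.
Qed.

(** All cell sums vanish, so [fine_cells] bounds the norm by any positive number. *)
Lemma null_of_box_integrals Om f : open Om -> loc_integrable Om f ->
  (forall c, vcbox c `<=` Om -> \int[mu]_(x in vbox c) f x = 0) ->
  {ae mu, forall x : E, Om x -> f x = 0}.
Proof.
move=> oOm lf f0; have [ab [OmE abOm]] := open_bigcup_box oOm.
suff H k : {ae mu, forall x : E, vbox (ab k) x -> f x = 0}.
  have := @ae_foralln _ E _ mu _ H; apply: filterS => x xf.
  by rewrite OmE => -[k _ xk]; exact: (xf k xk).
have if_ : mu.-integrable (vbox (ab k)) (EFin \o f) by exact: integrable_box lf (abOm k).
have cs0 s : cell_sum s (ab k) f = 0.
  rewrite /cell_sum big_seq big1// => c' cc'.
  have [c'0|c'0] := pselect (vbox c' !=set0); last by rewrite Rintegral_vbox0// normr0.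
  by rewrite f0 ?normr0//; exact: subset_trans (cells_vcbox cc' c'0) (abOm k).
have I0 : \int[mu]_(x in vbox (ab k)) `|f x| = 0.
  apply/eqP; rewrite eq_le Rintegral_ge0// andbT; apply/ler_addgt0Pr => e e0.
  have [m _ /(_ m (leqnn m))] := fine_cells if_ e0.
  by rewrite /= cs0.
have mk := measurable_vbox (ab k).
have := (ae_eq_integral_abs mu mk (measurable_int _ if_)).1.
have fin := integrable_fin_num mk (integrable_norm if_).
move=> /(_ _)[|].
  by rewrite /= in fin *; rewrite -[LHS](fineK fin); congr EFin; exact: I0.
move=> Z [mZ Z0 ZP]; exists Z; split=> // x /= nx; apply: ZP => /= h; apply: nx => xk.
by have /= [] := h xk.
Qed.

(** Bumps of boxes are test functions. *)
Lemma test_null_box Om f c : loc_integrable Om f ->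
  (forall phi, test_function Om phi -> \int[mu]_(x in (Om : set E)) (f x * phi x) = 0) ->
  vcbox c `<=` Om -> \int[mu]_(x in vbox c) f x = 0.
Proof.
move=> lf f0 cOm.
have := integral_bump_box (integrable_cbox lf cOm).
rewrite (_ : (fun m => _) = fun=> 0); last first.
  apply/funext => m; rewrite -(f0 _ (test_bump_box m cOm)).
  by rewrite (Rintegral_cbox cOm)// => x _ xc; rewrite bump_box_out// mulr0.
by move=> cv; rewrite -(cvg_lim _ cv)// lim_cst.
Qed.

Lemma du_bois_reymond Om f : open Om -> loc_integrable Om f ->
  (forall phi, test_function Om phi -> \int[mu]_(x in (Om : set E)) (f x * phi x) = 0) ->
  {ae mu, forall x : E, Om x -> f x = 0}.
Proof.
by move=> oOm lf f0; apply: null_of_box_integrals => // c; exact: test_null_box.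
Qed.

Lemma test_function_sub Om Om' phi : Om' `<=` Om -> test_function Om' phi ->
  test_function Om phi.
Proof. by move=> sub [h1 h2 h3]; split=> //; exact: subset_trans sub. Qed.

Lemma test_function_derive Om phi i : test_function Om phi ->
  test_function Om ('D_(delta_mx 0 i) phi).
Proof.
move=> [sm cK KOm]; set K := closure [set x | phi x != 0].
have part s : partials s ('D_(delta_mx 0 i) phi) = partials (rcons s i) phi.
  by rewrite /partials -cats1 foldr_cat.
have sub : closure [set x | 'D_(delta_mx 0 i) phi x != 0] `<=` K.
  rewrite [X in _ `<=` X](closure_id K).1; last exact: closed_closure.
  apply: closure_subset => x /= Dx; apply: contrapT => nK; move/eqP: Dx; apply.
  have nearx : \near x, cst 0 x = phi x.
    have : open_nbhs x (~` K) by split=> //; apply: closed_openC; exact: closed_closure.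
    move=> /open_nbhs_nbhs; apply: filterS => y nKy; apply/esym/eqP; apply: contrapT => phiy.
    by apply: nKy; apply: subset_closure => /=; exact/negP.
  have := near_eq_is_derive nearx (is_derive_cst (0 : R) x (delta_mx 0 i)).
  by move=> [_ ->].
split; first by move=> s; rewrite part; exact: sm.
  exact: (subclosed_compact (@closed_closure _ _) cK sub).
exact: subset_trans KOm.
Qed.

Lemma test_bounded Om phi : test_function Om phi ->
  exists M : R, forall x, `|phi x| <= M.
Proof.
move=> [sm cK KOm]; have [cphi _] := sm [::].
have /compact_bounded[M [_ MP]] : compact (phi @` closure [set x | phi x != 0]).
  by apply: continuous_compact => //; exact: continuous_subspaceT.
exists (`|M| + 1) => x; have [->|phix] := eqVneq (phi x) 0.
  by rewrite normr0 addr_ge0.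
apply: (MP (`|M| + 1)); first by rewrite ltr_pwDr// ler_norm.
by exists x => //; exact: subset_closure.
Qed.

Lemma integrable_test Om f phi : open Om -> loc_integrable Om f -> test_function Om phi ->
  mu.-integrable (Om : set E) (EFin \o (fun x => f x * phi x)).
Proof.
move=> oOm [mf lf] tphi; have [M phiM] := test_bounded tphi.
have [sm cK KOm] := tphi; have [cphi _] := sm [::].
set K : set E := closure [set x | phi x != 0].
have mK : measurable K by exact: compact_measurable_Rn.
have mOm : measurable (Om : set E) by exact: open_measurable_Rn.
have := integrable_mul_bounded mK (lf _ cK KOm) (continuous_measurable_Rn cphi) (fun x _ => phiM x).
move=> /(integrable_mkcond _ mK) H; apply/(integrable_mkcond _ mOm).
rewrite (_ : _ \_ _ = (EFin \o (fun x => f x * phi x)) \_ K)//.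
apply/funext => x; rewrite !patchE; case: ifPn => [/set_mem xO|xO].
  case: ifPn => // xK; rewrite /= (_ : phi x = 0) ?mulr0//.
  apply/eqP; apply: contraNT xK => phix; apply: mem_set; exact: subset_closure.
case: ifPn => // /set_mem/KOm xO'; by move: xO; rewrite mem_set.
Qed.

Lemma loc_integrableD Om f f' : loc_integrable Om f -> loc_integrable Om f' ->
  loc_integrable Om (fun x => f x + f' x).
Proof.
move=> [mf lf] [mf' lf']; split; first exact: measurable_funD.
move=> K cK KOm; exact: (integrableD (compact_measurable_Rn cK) (lf _ cK KOm) (lf' _ cK KOm)).
Qed.

Lemma loc_integrableZ Om f (k : R) : loc_integrable Om f ->
  loc_integrable Om (fun x => k * f x).
Proof.
move=> [mf lf]; split; first exact: measurable_funM.
move=> K cK KOm; exact: (integrableZ_EFin _ (compact_measurable_Rn cK) (lf _ cK KOm)).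
Qed.

Lemma weak_gradientD Om u v g h : open Om -> weak_gradient Om u g ->
  weak_gradient Om v h -> weak_gradient Om (u \+ v) (fun x => g x + h x).
Proof.
move=> oOm [lu lg wu] [lv lh wv].
have mOm : measurable (Om : set E) by exact: open_measurable_Rn.
have gh i : (fun x => (g x + h x) 0 i) = (fun x => g x 0 i + h x 0 i).
  by apply/funext => x; rewrite mxE.
split; first exact: loc_integrableD.
  by move=> i; rewrite gh; exact: loc_integrableD.
move=> phi i tphi; have tD := test_function_derive i tphi.
have -> : \int[mu]_(x in (Om : set E)) ((u \+ v) x * 'D_(delta_mx 0 i) phi x) =
    \int[mu]_(x in (Om : set E)) (u x * 'D_(delta_mx 0 i) phi x) +
    \int[mu]_(x in (Om : set E)) (v x * 'D_(delta_mx 0 i) phi x).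
  rewrite -RintegralD//; [|exact: integrable_test|exact: integrable_test].
  by apply: eq_Rintegral => x _; rewrite mulrDl.
have -> : \int[mu]_(x in (Om : set E)) ((g x + h x) 0 i * phi x) =
    \int[mu]_(x in (Om : set E)) (g x 0 i * phi x) +
    \int[mu]_(x in (Om : set E)) (h x 0 i * phi x).
  rewrite -RintegralD//.
  - by apply: eq_Rintegral => x _; rewrite mxE mulrDl.
  - exact: (integrable_test oOm (lg i) tphi).
  - exact: (integrable_test oOm (lh i) tphi).
by rewrite wu// wv// opprD.
Qed.

Lemma weak_gradientZ Om u g (k : R) : open Om -> weak_gradient Om u g ->
  weak_gradient Om (fun x => k * u x) (fun x => k *: g x).
Proof.
move=> oOm [lu lg wu].
have mOm : measurable (Om : set E) by exact: open_measurable_Rn.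
have gh i : (fun x => (k *: g x) 0 i) = (fun x => k * g x 0 i).
  by apply/funext => x; rewrite mxE.
split; first exact: loc_integrableZ.
  by move=> i; rewrite gh; exact: loc_integrableZ.
move=> phi i tphi; have tD := test_function_derive i tphi.
have -> : \int[mu]_(x in (Om : set E)) (k * u x * 'D_(delta_mx 0 i) phi x) =
    k * \int[mu]_(x in (Om : set E)) (u x * 'D_(delta_mx 0 i) phi x).
  rewrite -RintegralZl//; last exact: integrable_test.
  by apply: eq_Rintegral => x _; rewrite mulrA.
have -> : \int[mu]_(x in (Om : set E)) ((k *: g x) 0 i * phi x) =
    k * \int[mu]_(x in (Om : set E)) (g x 0 i * phi x).
  rewrite -RintegralZl//; last exact: (integrable_test oOm (lg i) tphi).
  by apply: eq_Rintegral => x _; rewrite mxE mulrA.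
by rewrite wu// mulrN.
Qed.

(** The difference of two weak gradients is a weak gradient of zero in every
    component, hence is orthogonal to all test functions. *)
Lemma weak_gradient_unique Om u g h : open Om -> weak_gradient Om u g ->
  weak_gradient Om u h -> {ae mu, forall x : E, Om x -> g x = h x}.
Proof.
move=> oOm wg wh.
have := weak_gradientD oOm wg (weak_gradientZ (- 1) oOm wh).
move=> [_ lgh wgh].
have H (i : 'I_n.+1) : {ae mu, forall x : E, Om x -> g x 0 i = h x 0 i}.
  have := du_bois_reymond oOm (lgh i); move=> /(_ _)[phi tphi|Z [mZ Z0 ZP]].
    have := wgh phi i tphi => /(congr1 (fun z => - z)); rewrite opprK => <-.
    rewrite (_ : (fun x => _) = fun=> 0) ?Rintegral_cst ?oppr0//.
    - by rewrite mul0r oppr0.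
    - exact: open_measurable_Rn.
    by apply/funext => x; rewrite /= mulN1r subrr mul0r.
  exists Z; split=> // x /= nx; apply: ZP => /= hx; apply: nx => /hx.
  by rewrite !mxE mulN1r => /subr0_eq.
have : {ae mu, forall x : E, forall (k : nat) (i : 'I_n.+1), i = k :> nat -> Om x ->
    g x 0 i = h x 0 i}.
  apply: ae_foralln => k; have [kn|kn] := ltnP k n.+1.
    apply: filterS (H (Ordinal kn)) => x xH i ik.
    by rewrite (_ : i = Ordinal kn)//; exact/val_inj.
  by apply/aeW => x i ik; move: kn; rewrite -ik leqNgt ltn_ord.
apply: filterS => x xH Ox; apply/rowP => i; exact: xH erefl Ox.
Qed.

Lemma weak_gradient_sub Om Om' u g : open Om -> Om' `<=` Om ->
  measurable (Om' : set E) -> weak_gradient Om u g -> weak_gradient Om' u g.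
Proof.
move=> oOm sub mOm' [lu lg wu].
have mOm : measurable (Om : set E) by exact: open_measurable_Rn.
have lsub f : loc_integrable Om f -> loc_integrable Om' f.
  move=> [mf lf]; split; first exact: measurable_funS mf.
  by move=> K cK KOm'; apply: lf => //; exact: subset_trans sub.
have Eint f phi : test_function Om' phi -> \int[mu]_(x in (Om' : set E)) (f x * phi x) =
    \int[mu]_(x in (Om : set E)) (f x * phi x).
  move=> [_ _ KOm']; rewrite Rintegral_mkcond [RHS]Rintegral_mkcond.
  apply: eq_Rintegral => x _; rewrite !patchE; case: ifPn => [/set_mem xO|xO].
    by rewrite mem_set//; exact: sub.
  case: ifPn => // _; rewrite (_ : phi x = 0) ?mulr0//.
  apply/eqP; apply: contraNT xO => phix; apply: mem_set; apply: KOm'; exact: subset_closure.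
split; first exact: lsub.
  by move=> i; exact: lsub.
move=> phi i tphi; rewrite Eint; last exact: test_function_derive.
by rewrite wu ?Eint//; exact: test_function_sub tphi.
Qed.

End weak_gradients.

(** * Rellich's theorem on boxes *)
Lemma cvg_subseq_oo (s : nat -> nat) : (forall k, (k <= s k)%N) -> s @ \oo --> \oo.
Proof.
move=> ks; apply/cvgnyPge => A; near=> k; apply: leq_trans (ks k); near: k.
exact: nbhs_infty_ge.
Unshelve. all: end_near. Qed.

Section rellich.
Variables (R : realType) (n : nat).
Local Notation V := 'rV[R]_n.+1.
Local Notation E := (Rn R n).
Local Notation mu := (@leb R n).
Implicit Types (Om : set V) (v : nat -> V -> R) (g : nat -> V -> V) (c : V * V).

(** After [m] rounds the cells have sides divided by [2 ^ m]; [cell_sum_le] in each of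
    them bounds the effect of all further rounds. *)
Lemma cell_sum_refine_le Om (v : V -> R) (g : V -> V) c m m' :
  weak_gradient Om v g -> vcbox c `<=` Om ->
  cell_sum (rounds n (m + m')) c v <= cell_sum (rounds n m) c v +
    2 * ((\sum_k side c k) / 2 ^+ m) * \int[mu]_(x in vbox c) norm1 g x.
Proof.
move=> wg cOm; have [c0|c0] := pselect (vbox c !=set0); last first.
  have cells0 s : cell_sum s c v = 0.
    rewrite /cell_sum big_seq big1// => c' /cells_sub cc'.
    by rewrite Rintegral_vbox0 ?normr0// => -[x /cc' xc]; apply: c0; exists x.
  by rewrite !cells0 add0r Rintegral_vbox0// mulr0.
have ing : mu.-integrable (vbox c) (EFin \o norm1 g).
  apply: integrableS (integrable_norm1 wg cOm); first exact: measurable_cbox.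
    exact: measurable_vbox.
  exact: box_cbox.
rewrite (Rintegral_cells (rounds n m) ing) mulr_sumr /cell_sum rounds_add cells_cat.
rewrite big_flatten/= big_map -big_split/= big_seq [leRHS]big_seq; apply: ler_sum => c' cc'.
have [c'0|c'0] := pselect (vbox c' !=set0); last first.
  rewrite !(Rintegral_vbox0 _ c'0) normr0 mulr0 addr0 big_seq big1// => c2 /cells_sub cc2.
  by rewrite Rintegral_vbox0 ?normr0// => -[x /cc2 xc]; apply: c'0; exists x.
have c'Om := subset_trans (cells_vcbox cc' c'0) cOm.
apply: le_trans (cell_sum_le (rounds n m') wg c'Om) _.
rewrite lerD2l; apply: ler_wpM2r.
  by apply: Rintegral_ge0 => x _; apply: sumr_ge0.
rewrite mulr_suml; apply: ler_wpM2l => //; apply: ler_sum => k _.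
by rewrite (side_cells k cc') count_rounds.
Qed.

(** For fixed [m] the cell sum after [m] rounds involves finitely many box integrals
    and tends to 0; the remainder is of order [2 ^- m], uniformly in [k]. *)
Lemma rellich_box Om v g c (M : R) : (forall k, weak_gradient Om (v k) (g k)) ->
  vcbox c `<=` Om ->
  (forall c', vcbox c' `<=` Om -> (fun k => \int[mu]_(x in vbox c') v k x) @ \oo --> (0 : R)) ->
  (forall k, \int[mu]_(x in vbox c) norm1 (g k) x <= M) ->
  (fun k => \int[mu]_(x in vbox c) `|v k x|) @ \oo --> (0 : R).
Proof.
move=> wg cOm v0 gM.
have [c0|c0] := pselect (vbox c !=set0); last first.
  by under eq_fun do rewrite Rintegral_vbox0//; exact: cvg_cst.
have M0 : 0 <= M.
  by apply: le_trans (gM 0%N); apply: Rintegral_ge0 => x _; apply: sumr_ge0.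
set S := \sum_k side c k.
have cs0 s : (fun k => cell_sum s c (v k)) @ \oo --> (0 : R).
  have := @cvg_sumr R nat _ \oo (cells s c)
    (fun c' => if c' \in cells s c then (fun k => `|\int[mu]_(x in vbox c') v k x|)
      else fun=> 0) (fun=> 0).
  rewrite big1// (_ : (fun k => \sum_(i <- _) _) = fun k => cell_sum s c (v k)); last first.
    apply/funext => k; rewrite /cell_sum big_seq [RHS]big_seq; apply: eq_bigr => c' ->//.
  move=> H; apply: H => c'; case: ifPn => cc'; last exact: cvg_cst.
  have [c'0|c'0] := pselect (vbox c' !=set0); last first.
    by under eq_fun do rewrite Rintegral_vbox0// normr0; exact: cvg_cst.
  rewrite -[X in _ --> X](normr0 R); apply: cvg_norm; apply: v0.
  exact: subset_trans (cells_vcbox cc' c'0) cOm.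
apply/cvgr0Pnorm_le => e e0.
have [m _ /(_ m (leqnn m)) /= mS] := nbhs_infty_ger (2 * S * M * 4 / e).
(* The number of rounds [m] is now fixed; [k] tends to infinity for this [m]. *)
have small : 2 * (S / 2 ^+ m) * M <= e / 4.
  have m2 : 2 * S * M * 4 / e <= 2 ^+ m.
    by apply: le_trans mS _; rewrite -natrX ler_nat ltnW// ltn_expl.
  have p2 : 0 < 2 ^+ m :> R by rewrite exprn_gt0.
  rewrite (_ : 2 * (S / 2 ^+ m) * M = (2 * S * M) / 2 ^+ m); last by field; rewrite gt_eqF.
  rewrite ler_pdivrMr//; move: m2; rewrite ler_pdivrMr// => m2; lra.
have e40 : 0 < e / 4 by rewrite divr_gt0.
have /cvgr0Pnorm_le/(_ _ e40) := cs0 (rounds n m).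
apply: filterS => k csk.
rewrite ger0_norm; last exact: Rintegral_ge0.
have iv : mu.-integrable (vbox c) (EFin \o v k).
  by have [lv _ _] := wg k; exact: integrable_box lv cOm.
have [N _ /(_ (m + N)%N (leq_addl _ _)) /= fin] := fine_cells iv e40.
have := cell_sum_refine_le m N (wg k) cOm.
have gk : 2 * (S / 2 ^+ m) * \int[mu]_(x in vbox c) norm1 (g k) x <= e / 4.
  apply: le_trans small; apply: ler_wpM2l => //; rewrite mulr_ge0// divr_ge0 ?exprn_ge0//.
  apply: sumr_ge0 => i _; have [y yc] := c0; have /andP[y1 y2] := yc i.
  by rewrite subr_ge0 (le_trans (ltW y1)).
have := le_trans (ler_norm _) csk; rewrite -/S; move: fin gk.
set a := 2 * (S / 2 ^+ m) * _; lra.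
Qed.

(** A diagonal choice: at stage [k] the integrals over the first [k + 1] boxes of a
    countable cover are below [2 ^- (k + 1)], so each is summable along the
    subsequence. *)
Lemma rellich_subseq Om v g : open Om -> (forall k, weak_gradient Om (v k) (g k)) ->
  (forall c, vcbox c `<=` Om -> (fun k => \int[mu]_(x in vbox c) v k x) @ \oo --> (0 : R)) ->
  (forall c, vcbox c `<=` Om -> exists M : R, forall k,
     \int[mu]_(x in vbox c) norm1 (g k) x <= M) ->
  exists s : nat -> nat, (forall k, (k <= s k)%N) /\
    {ae mu, forall x : E, Om x -> (fun k => v (s k) x) @ \oo --> (0 : R)}.
Proof.
move=> oOm wg v0 gM; have [ab [OmE abOm]] := open_bigcup_box oOm.
have I0 i : (fun k => \int[mu]_(x in vbox (ab i)) `|v k x|) @ \oo --> (0 : R).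
  by have [M MP] := gM _ (abOm i); exact: rellich_box wg (abOm i) v0 MP.
have iv i k : mu.-integrable (vbox (ab i)) (EFin \o v k).
  by have [lv _ _] := wg k; exact: integrable_box lv (abOm i).
have [s sP] : {s : nat -> nat & forall k, (k <= s k)%N /\ forall i : 'I_k.+1,
    \int[mu]_(x in vbox (ab i)) `|v (s k) x| <= 1 / (2 ^ k.+1)%:R}.
  apply: (@choice _ _ (fun k m => (k <= m)%N /\ forall i : 'I_k.+1,
    \int[mu]_(x in vbox (ab i)) `|v m x| <= 1 / (2 ^ k.+1)%:R)) => k.
  have p0 : 0 < 1 / (2 ^ k.+1)%:R :> R by rewrite divr_gt0// ltr0n expn_gt0.
  have : \forall m \near \oo, forall i : 'I_k.+1,
      \int[mu]_(x in vbox (ab i)) `|v m x| <= 1 / (2 ^ k.+1)%:R.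
    apply: filter_forall => i; have /cvgr0Pnorm_le/(_ _ p0) := I0 i.
    by apply: filterS => m; apply: le_trans; exact: ler_norm.
  move=> [N _ NP]; exists (maxn k N); split; first exact: leq_maxl.
  by apply: NP; exact: leq_maxr.
exists s; split; first by move=> k; have [] := sP k.
suff H i : {ae mu, forall x : E, vbox (ab i) x -> (fun k => v (s k) x) @ \oo --> (0 : R)}.
  have := @ae_foralln _ E _ mu _ H; apply: filterS => x xf.
  by rewrite OmE => -[k _ xk]; exact: (xf k xk).
have mb := measurable_vbox (ab i).
have := @summable_integral_cvg0 _ E R mu _ mb (fun k x => `|v (s (k + i)%N) x|).
move=> /(_ _ _)[||Z [mZ Z0 ZP]].
- split=> [k|k x _]; last exact: normr_ge0.
  apply: measurableT_comp; first exact: normr_measurable.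
  by have /measurable_int/measurable_EFinP := iv i (s (k + i)%N).
- move=> k; have /integrable_norm ivk := iv i (s (k + i)%N).
  have fin := integrable_fin_num mb ivk.
  rewrite -[leLHS](fineK fin) lee_fin.
  have [_ sk] := sP (k + i)%N.
  have ik : (i < (k + i).+1)%N by rewrite ltnS leq_addl.
  apply: le_trans (sk (Ordinal ik)) _.
  rewrite !div1r lef_pV2 ?posrE ?ltr0n ?expn_gt0// ler_nat leq_exp2l// ltnS leq_addr.
  done.
exists Z; split=> // x /= nx; apply: ZP => /= h; apply: nx => xk.
have := h xk; rewrite -(cvg_shiftn i (fun k => v (s k) x)) => h'.
by apply/norm_cvg0P.
Qed.

End rellich.

(** * Euclidean norm and Lebesgue spaces *)
Section euclidean_norm.
Variables (R : realType) (N : nat).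
Implicit Types x y : 'rV[R]_N.

Lemma enorm_ge0 x : 0 <= enorm x.
Proof. exact: sqrtr_ge0. Qed.

Lemma coord_le_enorm x i : `|x 0 i| <= enorm x.
Proof.
rewrite -sqrtr_sqr; apply: ler_wsqrtr; rewrite (bigD1 i)//= lerDl.
by apply: sumr_ge0 => k _; exact: sqr_ge0.
Qed.

Lemma enorm_le_sum x : enorm x <= \sum_i `|x 0 i|.
Proof.
have S0 (P : pred 'I_N) : 0 <= \sum_(i | P i) `|x 0 i| by exact: sumr_ge0.
rewrite -[leRHS]ger0_norm ?S0// -sqrtr_sqr; apply: ler_wsqrtr.
rewrite expr2 mulr_suml; apply: ler_sum => i _.
rewrite -real_normK ?num_real// expr2 ler_wpM2l// (bigD1 i)//= lerDl.
exact: S0.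
Qed.

Lemma enorm_sub_le x y : enorm (x - y) <= N%:R * (enorm x + enorm y).
Proof.
apply: le_trans (enorm_le_sum _) _.
rewrite mulr_natl -[X in _ *+ X]card_ord -sumr_const; apply: ler_sum => i _.
by rewrite !mxE (le_trans (ler_normB _ _))// lerD// coord_le_enorm.
Qed.

Lemma measurable_enorm d (T : measurableType d) (D : set T) (w : T -> 'rV[R]_N) :
  (forall i, measurable_fun D (fun t => w t 0 i)) -> measurable_fun D (fun t => enorm (w t)).
Proof.
move=> mw; rewrite (_ : (fun t => _) = fun t => (\sum_i w t 0 i ^+ 2) `^ 2^-1); last first.
  by apply/funext => t; rewrite powR12_sqrt// sumr_ge0// => i _; exact: sqr_ge0.
apply: (measurableT_comp (measurable_powR _)); apply: measurable_sum => i.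
exact: measurable_funX.
Qed.

End euclidean_norm.

Lemma powR_normD (R : realType) (r a b : R) : 0 <= r ->
  `|a + b| `^ r <= 2 `^ r * (`|a| `^ r + `|b| `^ r).
Proof.
move=> r0; set m := Num.max `|a| `|b|.
have m0 : 0 <= m by rewrite le_max normr_ge0.
have abm : `|a + b| <= 2 * m.
  apply: le_trans (ler_normD _ _) _; rewrite mulr_natl mulr2n lerD//.
    by rewrite le_max lexx.
  by rewrite le_max lexx orbT.
apply: le_trans (_ : (2 * m) `^ r <= _).
  by apply: ge0_ler_powR; rewrite ?nnegrE// mulr_ge0.
rewrite powRM// ler_wpM2l ?powR_ge0// /m.
by case: (leP `|a| `|b|) => _; rewrite (lerDl, lerDr) powR_ge0.
Qed.

Section lebesgue_spaces.
Variables (R : realType) (n : nat).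
Local Notation V := 'rV[R]_n.+1.
Local Notation E := (Rn R n).
Local Notation mu := (@leb R n).
Implicit Types (Om : set V) (f g : V -> R) (r : R).

Lemma measurable_normX (D : set E) f r : measurable_fun D f ->
  measurable_fun D (fun x => `|f x| `^ r).
Proof.
move=> mf; apply: (measurableT_comp (measurable_powR r)).
exact: (measurableT_comp (@normr_measurable R setT) mf).
Qed.

Lemma Lp_norm_ge0 Om r f : (0 <= Lp_norm Om r f)%E.
Proof. exact: Lnorm_ge0. Qed.

Lemma Lp_norm_lty Om r f : in_Lp Om r f -> (Lp_norm Om r f < +oo)%E.
Proof. by rewrite /in_Lp inE => /andP[_ /set_mem]. Qed.

Lemma Lp_norm_powR Om r f : 0 < r ->
  (Lp_norm Om r f `^ r)%E = (\int[mu]_(x in (Om : set E)) (`|f x| `^ r)%:E)%E.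
Proof.
move=> r0; rewrite /Lp_norm (poweR_Lnorm _ _ (lt0r_neq0 r0)) [RHS]integral_mkcond.
apply: eq_integral => x _ /=; rewrite !patchE; case: ifPn => // _.
by rewrite normr0 powR0 ?gt_eqF.
Qed.

Lemma Lp_norm_le Om r f (c : R) : 0 < r -> 0 <= c ->
  (\int[mu]_(x in (Om : set E)) (`|f x| `^ r)%:E <= (c `^ r)%:E)%E ->
  (Lp_norm Om r f <= c%:E)%E.
Proof.
move=> r0 c0; rewrite -Lp_norm_powR//; have := Lp_norm_ge0 Om r f.
case: (Lp_norm Om r f) => [y| |]//; last by rewrite poweRyr ?gt_eqF.
rewrite poweR_EFin !lee_fin => y0; apply: contraTT; rewrite -!ltNge => cy.
by apply: gt0_ltr_powR; rewrite ?nnegrE.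
Qed.

Lemma in_LpP Om r f : measurable (Om : set E) -> 0 < r ->
  in_Lp Om r f <->
  measurable_fun (Om : set E) f /\ mu.-integrable Om (EFin \o (fun x => `|f x| `^ r)).
Proof.
move=> mOm r0.
have finE : (Lp_norm Om r f < +oo)%E <->
    (\int[mu]_(x in (Om : set E)) (`|f x| `^ r)%:E < +oo)%E.
  rewrite -Lp_norm_powR//; have := Lp_norm_ge0 Om r f.
  case: (Lp_norm Om r f) => [y| |]//; last by rewrite poweRyr ?gt_eqF.
  by rewrite poweR_EFin !ltry.
have absE : (\int[mu]_(x in (Om : set E)) `|(`|f x| `^ r)%:E|)%E =
    (\int[mu]_(x in (Om : set E)) (`|f x| `^ r)%:E)%E.
  by apply: eq_integral => x _; rewrite /= ger0_norm// powR_ge0.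
split=> [|[mf /integrableP[_ fin]]].
  rewrite /in_Lp inE => /andP[/set_mem mf /set_mem fin].
  have mf' : measurable_fun (Om : set E) f by exact/(measurable_restrictT _ mOm).
  split=> //; apply/integrableP; split; first exact/measurable_EFinP/measurable_normX.
  by rewrite absE; apply/finE.
rewrite /in_Lp inE; apply/andP; split; apply/mem_set.
  exact/(measurable_restrictT _ mOm).
by apply/finE; rewrite -absE.
Qed.


Lemma in_Lp_le Om r f g (c : R) : measurable (Om : set E) -> 0 < r ->
  measurable_fun (Om : set E) f -> in_Lp Om r g ->
  (forall x, Om x -> `|f x| <= c * `|g x|) -> in_Lp Om r f.
Proof.
move=> mOm r0 mf /in_LpP[]// mg ig fg; apply/in_LpP => //; split=> //.
apply: (@le_integrable _ E _ mu _ mOm _ (EFin \o (fun x => `|c| `^ r * `|g x| `^ r))).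
- exact/measurable_EFinP/measurable_normX.
- move=> x Ox /=; rewrite lee_fin (ger0_norm (powR_ge0 _ _)).
  rewrite (ger0_norm (mulr_ge0 (powR_ge0 _ _) (powR_ge0 _ _))) -powRM//; apply: ge0_ler_powR; rewrite ?nnegrE ?mulr_ge0 ?(ltW r0)//.
  by apply: le_trans (fg x Ox) _; rewrite ler_wpM2r// ler_norm.
- exact: integrableZ_EFin.
Qed.

Lemma in_LpD Om r f g : measurable (Om : set E) -> 0 < r ->
  in_Lp Om r f -> in_Lp Om r g -> in_Lp Om r (fun x => f x + g x).
Proof.
move=> mOm r0 /in_LpP[]// mf if_ /in_LpP[]// mg ig; apply/in_LpP => //.
have mfg : measurable_fun (Om : set E) (fun x => f x + g x) by exact: measurable_funD.
split=> //; have ifg := integrableZ_EFin (2 `^ r) mOm (integrableD mOm if_ ig).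
apply: (le_integrable mOm _ _ ifg).
  exact/measurable_EFinP/measurable_normX.
move=> x Ox /=; rewrite lee_fin (ger0_norm (powR_ge0 _ _)).
rewrite (ger0_norm (mulr_ge0 (powR_ge0 _ _) (addr_ge0 (powR_ge0 _ _) (powR_ge0 _ _)))).
exact: powR_normD (ltW r0).
Qed.

Lemma in_LpZ Om r f (c : R) : measurable (Om : set E) -> 0 < r ->
  in_Lp Om r f -> in_Lp Om r (fun x => c * f x).
Proof.
move=> mOm r0 lf; have /in_LpP[]// := lf => mf _.
apply: (in_Lp_le mOm r0 _ lf (c := `|c|)); first exact: measurable_funM.
by move=> x _; rewrite normrM.
Qed.

Lemma integral_normX_ae Om r f g : measurable (Om : set E) ->
  measurable_fun (Om : set E) f -> measurable_fun (Om : set E) g ->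
  {ae mu, forall x : E, Om x -> f x = g x} ->
  (\int[mu]_(x in (Om : set E)) (`|f x| `^ r)%:E =
   \int[mu]_(x in (Om : set E)) (`|g x| `^ r)%:E)%E.
Proof.
move=> mOm mf mg fg; apply: (@ge0_ae_eq_integral _ E R mu Om _ _ mOm).
- exact/measurable_EFinP/measurable_normX.
- exact/measurable_EFinP/measurable_normX.
- by move=> x _; rewrite lee_fin powR_ge0.
- by move=> x _; rewrite lee_fin powR_ge0.
- by apply: filterS fg => x fg Ox; rewrite /= fg.
Qed.

Lemma in_Lp_ae Om r f g : measurable (Om : set E) -> 0 < r ->
  measurable_fun (Om : set E) g -> {ae mu, forall x : E, Om x -> f x = g x} ->
  in_Lp Om r f -> in_Lp Om r g.
Proof.
move=> mOm r0 mg fg /in_LpP => /(_ mOm r0)[mf if_]; apply/(in_LpP _ mOm r0); split=> //.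
apply/integrableP; split; first exact/measurable_EFinP/measurable_normX.
have /integrableP[_] := if_; have absE h : (\int[mu]_(x in (Om : set E)) `|(`|h x| `^ r)%:E| =
    \int[mu]_(x in (Om : set E)) (`|h x| `^ r)%:E)%E.
  by apply: eq_integral => x _; rewrite abse_EFin ger0_norm ?powR_ge0.
by rewrite /= !absE (integral_normX_ae r mOm mf mg fg).
Qed.

Lemma Lp_norm_ae Om r f g : measurable (Om : set E) -> 0 < r ->
  measurable_fun (Om : set E) f -> measurable_fun (Om : set E) g ->
  {ae mu, forall x : E, Om x -> f x = g x} -> Lp_norm Om r f = Lp_norm Om r g.
Proof.
move=> mOm r0 mf mg fg.
rewrite -[LHS](poweRe1 (Lp_norm_ge0 _ _ _)) -[RHS](poweRe1 (Lp_norm_ge0 _ _ _)).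
rewrite -(divff (lt0r_neq0 r0)) !poweRrM !(Lp_norm_powR _ _ r0).
by rewrite (integral_normX_ae r mOm mf mg fg).
Qed.

Lemma le_Lp_norm Om r f g : measurable (Om : set E) -> 0 < r ->
  measurable_fun (Om : set E) f -> measurable_fun (Om : set E) g ->
  (forall x, Om x -> `|f x| <= `|g x|) -> (Lp_norm Om r f <= Lp_norm Om r g)%E.
Proof.
move=> mOm r0 mf mg fg; have := Lp_norm_ge0 Om r g.
case gE : (Lp_norm Om r g) => [y| |]//.
2: by move=> _; rewrite leey.
rewrite lee_fin => y0; apply: Lp_norm_le => //.
rewrite -poweR_EFin -gE Lp_norm_powR//; apply: ge0_le_integral => //.
- exact/measurable_EFinP/measurable_normX.
- exact/measurable_EFinP/measurable_normX.
- by move=> x Ox; rewrite lee_fin; apply: ge0_ler_powR; rewrite ?nnegrE ?(ltW r0)// fg.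
Qed.

Lemma in_Lp_enorm Om r (w : V -> V) : measurable (Om : set E) -> 0 < r ->
  (forall i, in_Lp Om r (fun x => w x 0 i)) -> in_Lp Om r (fun x => enorm (w x)).
Proof.
move=> mOm r0 lw.
have mw i : measurable_fun (Om : set E) (fun x => w x 0 i) by have /in_LpP[] := lw i.
have S (s : seq 'I_n.+1) : in_Lp Om r (fun x => \sum_(i <- s) `|w x 0 i|).
  elim: s => [|i s IH].
    rewrite (_ : (fun x => _) = cst 0); last by apply/funext => x; rewrite big_nil.
    apply/in_LpP => //; split; first exact: measurable_cst.
    rewrite (_ : _ \o _ = cst 0%E); first exact: integrable0.
    by apply/funext => x; rewrite /= normr0 powR0 ?gt_eqF.
  rewrite (_ : (fun x => _) = fun x => `|w x 0 i| + \sum_(k <- s) `|w x 0 k|); last first.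
    by apply/funext => x; rewrite big_cons.
  apply: in_LpD => //; apply: (in_Lp_le mOm r0 _ (lw i) (c := 1)).
    exact: (measurableT_comp (@normr_measurable R setT) (mw i)).
  by move=> x _; rewrite normr_id mul1r.
apply: (in_Lp_le mOm r0 _ (S (index_enum _)) (c := 1)); first exact: measurable_enorm.
move=> x _; rewrite mul1r ger0_norm ?enorm_ge0// ger0_norm ?sumr_ge0//.
exact: enorm_le_sum.
Qed.

(** Hoelder's inequality against the indicator of [A], which has finite measure. *)
Lemma holder_finite Om r (A : set E) : measurable (Om : set E) -> 1 < r ->
  measurable A -> A `<=` Om -> (mu A < +oo)%E ->
  exists2 C : R, 0 <= C & forall f, in_Lp Om r f -> mu.-integrable A (EFin \o f) /\
    (\int[mu]_(x in A) `|f x|%:E <= C%:E * Lp_norm Om r f)%E.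
Proof.
move=> mOm r1 mA AOm Aoo; have r0 : 0 < r by exact: lt_trans r1.
(* The conjugate exponent of [r]. *)
pose q := r / (r - 1); have r10 : 0 < r - 1 by rewrite subr_gt0.
have q0 : 0 < q by rewrite divr_gt0.
have rq : r^-1 + q^-1 = 1 by rewrite /q; field; rewrite !gt_eqF.
have m1 : measurable_fun setT (\1_A : E -> R) by exact: measurable_indic.
have : ('N[mu]_(q%:E)[EFin \o (\1_A : E -> R)] < +oo)%E.
  have := poweR_Lnorm mu (EFin \o (\1_A : E -> R)) (lt0r_neq0 q0).
  rewrite (_ : (\int[mu]_x _)%E = mu A); last first.
    rewrite -[RHS]mul1e -(integral_cst mu mA 1) [RHS]integral_mkcond; apply: eq_integral => x _.
    rewrite patchE /= indicE; case: (x \in A); first by rewrite normr1 powR1.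
    by rewrite normr0 powR0// gt_eqF.
  have := Lnorm_ge0 mu q%:E (EFin \o (\1_A : E -> R)).
  case: ('N[mu]_(q%:E)[EFin \o (\1_A : E -> R)])%E => [y| |]//; first by rewrite ltry.
  by rewrite poweRyr ?gt_eqF// => _ Aoo'; move: Aoo; rewrite -Aoo'.
have := Lnorm_ge0 mu q%:E (EFin \o (\1_A : E -> R)).
case NE : ('N[mu]_(q%:E)[EFin \o (\1_A : E -> R)])%E => [C| |]// C0 _; exists C => // f lf.
have /in_LpP[]// := lf => mf _.
have mfO : measurable_fun setT (f \_ Om : E -> R) by exact/(measurable_restrictT _ mOm).
have bound : (\int[mu]_(x in A) `|f x|%:E <= C%:E * Lp_norm Om r f)%E.
  have := hoelder mu mfO m1 r0 q0 rq; rewrite NE [X in (_ <= X)%E]muleC; apply: le_trans.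
  rewrite (_ : (\int[mu]_(x in A) `|f x|%:E)%E = 'N[mu]_1[EFin \o (f \_ Om \* \1_A)%R]%E)//.
  rewrite Lnorm1 [LHS]integral_mkcond; apply: eq_integral => x _.
  rewrite patchE /= indicE; case: ifPn => [/set_mem xA|_]; last by rewrite mulr0 normr0.
  by rewrite mulr1 patchE mem_set//; exact: AOm.
split=> //; apply/integrableP; split.
  by apply/measurable_EFinP; exact: measurable_funS mf.
apply: le_lt_trans bound _; have : (Lp_norm Om r f < +oo)%E.
  exact: Lp_norm_lty.
have := Lp_norm_ge0 Om r f.
by case: (Lp_norm Om r f) => [y| |]// _ _; rewrite -EFinM ltry.
Qed.

(** The set [F] is the part of [Om] in a large ball; outside the ball the tail
    condition applies, inside it the condition on small sets. *)
Lemma equiintegrable_unif_small Om r (f : nat -> V -> R) : measurable (Om : set E) ->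
  (forall k, measurable_fun (Om : set E) (f k)) -> equiintegrable Om r f ->
  unif_small mu (Om : set E) (fun k x => `|f k x| `^ r).
Proof.
move=> mOm mf [small tail] e e0; have e20 : 0 < e / 2 by rewrite divr_gt0.
have [dl [dl0 dlP]] : exists dl : R, 0 < dl /\ forall k (A : set E), measurable A -> A `<=` Om ->
    (mu A <= dl%:E -> \int[mu]_(x in A) (`|f k x| `^ r)%:E <= (e / 2)%:E)%E.
  have [dl [dl0 H]] := filter_ex (filterI (nbhs_right_gt (0 : R)) (cvge0_lt small e20)).
  exists dl; split=> // k A mA AOm Adl; apply: le_trans (ltW H).
  by apply: ereal_sup_ubound; exists k, A.
have [rho [rho0 rhoP]] : exists rho : R, 0 < rho /\ forall k,
    (\int[mu]_(x in (Om : set E) `\` [set x | (enorm x < rho)%R]) (`|f k x| `^ r)%:E <=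
     (e / 2)%:E)%E.
  have [rho [rho0 H]] := filter_ex (filterI (nbhs_pinfty_gt (num_real (0 : R)))
    (cvge0_lt tail e20)).
  exists rho; split=> // k; apply: le_trans (ltW H).
  by apply: ereal_sup_ubound; exists k.
pose B := [set x : E | enorm x < rho].
have mB : measurable B.
  rewrite (_ : B = setT `&` (fun x : E => enorm x) @^-1` `]-oo, rho[%classic).
    apply: (@measurable_enorm R n.+1 _ E setT id) => // i; exact: measurable_coord.
  by apply/seteqP; split=> x /=; rewrite in_itv//= => -[].
have [k _ /(_ k (leqnn k)) /= rk] := nbhs_infty_gtr rho.
have Bk : B `<=` bigbox k.
  move=> x xB i; rewrite !mxE; have := le_lt_trans (coord_le_enorm x i) (lt_trans xB rk).
  by rewrite ltr_norml => /andP[-> /ltW].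
exists (Om `&` B), dl; split=> //.
- exact: measurableI.
- apply: le_lt_trans (leb_box_lty (const_mx (- k%:R)) (const_mx k%:R)).
  apply: le_measure; rewrite ?inE; [exact: measurableI|exact: measurable_box|].
  by move=> x [_ /Bk].
move=> m A mA AOm Adl.
have pos (D : set E) x : D x -> (0 <= (`|f m x| `^ r)%:E)%E by rewrite lee_fin powR_ge0.
have mfm (D : set E) : D `<=` Om -> measurable_fun D (fun x => (`|f m x| `^ r)%:E).
  by move=> DOm; apply/measurable_EFinP/measurable_normX; exact: measurable_funS (mf m).
have mAB : measurable (A `&` B) by exact: measurableI.
have mAnB : measurable (A `\` B) by exact: measurableD.
have ABE : A `&` B `|` A `\` B = A by exact: setUIDK.
have disj : [disjoint A `&` B & A `\` B].
  by rewrite disj_set2E; apply/eqP/seteqP; split=> // x [[_ h] [_ /(_ h)]].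
have := @ge0_integral_setU _ E R mu _ _ mAB mAnB (fun x => (`|f m x| `^ r)%:E).
rewrite ABE => /(_ (mfm _ AOm) (pos A) disj) ->.
rewrite (splitr e) EFinD; apply: leeD.
  apply: dlP; first exact: measurableI.
    by move=> x [/AOm].
  by apply: le_trans Adl; rewrite setIA (setIidl AOm).
apply: le_trans (rhoP m).
have mOB : measurable ((Om : set E) `\` B) by exact: measurableD.
apply: (@ge0_subset_integral _ E R mu _ _ mAnB mOB (fun x => (`|f m x| `^ r)%:E)).
- by apply: mfm => x [].
- exact: pos.
- by move=> x [/AOm Ox nB].
Qed.

End lebesgue_spaces.

(** * Sobolev functions and their weak limits *)
Section sobolev_functions.
Variables (R : realType) (n : nat).
Local Notation V := 'rV[R]_n.+1.
Local Notation E := (Rn R n).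
Local Notation mu := (@leb R n).
Variables (Om : set V) (p : R).
Hypotheses (oOm : open Om) (p1 : 1 < p).
Implicit Types (u v a : V -> R) (A : set E).

Let mOm : measurable (Om : set E). Proof. exact: open_measurable_Rn. Qed.
Let p0 : 0 < p. Proof. exact: lt_trans p1. Qed.

Lemma xget_weak_gradient (U : set V) u (g : V -> V) : weak_gradient U u g ->
  weak_gradient U u (wgrad U u).
Proof. by move=> wg; apply: (@xgetPex _ (fun=> 0) [set h | weak_gradient U u h]); exists g. Qed.

Lemma wgrad_weak u : W1p Om p u -> weak_gradient Om u (wgrad Om u).
Proof. by move=> [_ [g [wg _]]]; exact: xget_weak_gradient wg. Qed.

Lemma wgrad_Lp u i : W1p Om p u -> in_Lp Om p (fun x => wgrad Om u x 0 i).
Proof.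
move=> wu; have wgu := wgrad_weak wu; have [_ [g [wg lg]]] := wu.
apply: (in_Lp_ae mOm p0 _ _ (lg i)).
  by have [_ lw _] := wgu; have [] := lw i.
by apply: filterS (weak_gradient_unique oOm wg wgu) => x h Ox; rewrite h.
Qed.

Lemma W1p_Lp u : W1p Om p u -> in_Lp Om p u. Proof. by case. Qed.

Lemma measurable_Lp u (r : R) : 0 < r -> in_Lp Om r u -> measurable_fun (Om : set E) u.
Proof. by move=> r0 /in_LpP => /(_ mOm r0)[]. Qed.

Lemma measurable_wgrad u i : W1p Om p u ->
  measurable_fun (Om : set E) (fun x => wgrad Om u x 0 i).
Proof. by move=> wu; exact: measurable_Lp p0 (wgrad_Lp i wu). Qed.

Lemma W1pD u v : W1p Om p u -> W1p Om p v -> W1p Om p (u \+ v).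
Proof.
move=> wu wv; split; first exact: in_LpD mOm p0 (W1p_Lp wu) (W1p_Lp wv).
exists (fun x => wgrad Om u x + wgrad Om v x); split.
  exact: weak_gradientD oOm (wgrad_weak wu) (wgrad_weak wv).
move=> i; rewrite (_ : (fun x => _) = fun x => wgrad Om u x 0 i + wgrad Om v x 0 i); last first.
  by apply/funext => x; rewrite mxE.
exact: in_LpD mOm p0 (wgrad_Lp i wu) (wgrad_Lp i wv).
Qed.

Lemma W1pZ u (c : R) : W1p Om p u -> W1p Om p (fun x => c * u x).
Proof.
move=> wu; split; first exact: in_LpZ c mOm p0 (W1p_Lp wu).
exists (fun x => c *: wgrad Om u x); split.
  exact: weak_gradientZ c oOm (wgrad_weak wu).
move=> i; rewrite (_ : (fun x => _) = fun x => c * wgrad Om u x 0 i); last first.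
  by apply/funext => x; rewrite mxE.
exact: in_LpZ c mOm p0 (wgrad_Lp i wu).
Qed.

Lemma wgradD u v : W1p Om p u -> W1p Om p v ->
  {ae mu, forall x : E, Om x -> wgrad Om (u \+ v) x = wgrad Om u x + wgrad Om v x}.
Proof.
move=> wu wv; apply: weak_gradient_unique oOm (wgrad_weak (W1pD wu wv)) _.
exact: weak_gradientD oOm (wgrad_weak wu) (wgrad_weak wv).
Qed.

Lemma wgradZ u (c : R) : W1p Om p u ->
  {ae mu, forall x : E, Om x -> wgrad Om (fun x => c * u x) x = c *: wgrad Om u x}.
Proof.
move=> wu; apply: weak_gradient_unique oOm (wgrad_weak (W1pZ c wu)) _.
exact: weak_gradientZ c oOm (wgrad_weak wu).
Qed.

Lemma Lp_norm_le_W1p u : (Lp_norm Om p u <= W1p_norm Om p u)%E.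
Proof. by rewrite /W1p_norm leeDl// Lp_norm_ge0. Qed.

Lemma Lp_norm_wgrad_le u i : W1p Om p u ->
  (Lp_norm Om p (fun x => wgrad Om u x 0%R i) <= W1p_norm Om p u)%E.
Proof.
move=> wu; apply: (@le_trans _ _ (Lp_norm Om p (fun x => enorm (wgrad Om u x)))).
  apply: (le_Lp_norm mOm p0 (measurable_wgrad i wu)).
    by apply: measurable_enorm => k; exact: measurable_wgrad.
  by move=> x _; rewrite [leRHS]ger0_norm ?enorm_ge0// coord_le_enorm.
by rewrite /W1p_norm leeDr// Lp_norm_ge0.
Qed.

Lemma ae_eq_Rintegral A (f g : E -> R) : measurable A ->
  measurable_fun A f -> measurable_fun A g ->
  {ae mu, forall x : E, A x -> f x = g x} -> \int[mu]_(x in A) f x = \int[mu]_(x in A) g x.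
Proof.
move=> mA mf mg fg; congr fine; apply: ae_eq_integral => //.
- exact/measurable_EFinP.
- exact/measurable_EFinP.
- by apply: filterS fg => x fg Ax; rewrite fg.
Qed.

(** Integration against a bounded function over a set of finite measure is a bounded
    functional on [L^p], by Hoelder's inequality.  The operator [L] will be the
    identity or a component of the weak gradient; the latter is linear only up to
    null sets, since [wgrad] is a choice. *)
Lemma dual_of_bounded (L : (V -> R) -> V -> R) A a (M : R) :
  (forall u, W1p Om p u -> in_Lp Om p (L u)) ->
  (forall u v, W1p Om p u -> W1p Om p v ->
     {ae mu, forall x : E, Om x -> L (u \+ v) x = L u x + L v x}) ->
  (forall c u, W1p Om p u -> {ae mu, forall x : E, Om x -> L (fun x => c * u x) x = c * L u x}) ->
  (forall u, W1p Om p u -> (Lp_norm Om p (L u) <= W1p_norm Om p u)%E) ->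
  measurable A -> A `<=` Om -> (mu A < +oo)%E -> measurable_fun A (a : E -> R) ->
  (forall x, A x -> `|a x| <= M) ->
  W1p_dual Om p (fun u => \int[mu]_(x in A) (L u x * a x)).
Proof.
move=> lL LD LZ LN mA AOm Aoo ma aM; have [C C0 CP] := holder_finite mOm p1 mA AOm Aoo.
have iL u : W1p Om p u -> mu.-integrable A (EFin \o L u) by move=> /lL/CP[].
have iLa u : W1p Om p u -> mu.-integrable A (EFin \o (fun x => L u x * a x)).
  by move=> wu; exact: integrable_mul_bounded mA (iL u wu) ma aM.
have mLa u : W1p Om p u -> measurable_fun A (fun x => L u x * a x).
  by move=> /iLa/measurable_int/measurable_EFinP.
split.
- move=> u v wu wv; rewrite -(RintegralD mA (iLa u wu) (iLa v wv)).
  apply: (ae_eq_Rintegral mA (mLa _ (W1pD wu wv)) (measurable_funD (mLa u wu) (mLa v wv))).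
  by apply: filterS (LD u v wu wv) => x h Ax; rewrite (h (AOm x Ax)) mulrDl.
- move=> c u wu; rewrite -(RintegralZl c mA (iLa u wu)).
  apply: (ae_eq_Rintegral mA (mLa _ (W1pZ c wu)) (measurable_funM (measurable_cst c) (mLa u wu))).
  by apply: filterS (LZ c u wu) => x h Ax; rewrite (h (AOm x Ax)) /= mulrA.
exists (`|M| * C) => u wu; have [iLu bL] := CP _ (lL u wu).
have inL := integrable_norm iLu.
apply: (@le_trans _ _ (`|M|%:E * (C%:E * Lp_norm Om p (L u)))%E); last first.
  rewrite EFinM -muleA; apply: lee_wpmul2l; first by rewrite lee_fin.
  by apply: lee_wpmul2l; [rewrite lee_fin|exact: LN].
apply: le_trans (lee_wpmul2l _ bL); last by rewrite lee_fin.
rewrite -[X in (_ * X)%E](fineK (integrable_fin_num mA inL)) -EFinM lee_fin.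
apply: le_trans (le_normr_Rintegral mA (iLa u wu)) _.
rewrite -(RintegralZl _ mA inL); apply: le_Rintegral => //.
- exact: integrable_norm (iLa u wu).
- exact: integrableZ_EFin mA inL.
- by move=> x Ax; rewrite normrM mulrC ler_wpM2r// (le_trans (aM x Ax))// ler_norm.
Qed.

Section weak_limits.
Variables (u_ : nat -> V -> R) (u : V -> R).
Hypotheses (wu_ : forall k, W1p Om p (u_ k)) (wu : W1p Om p u).
Hypothesis u_cvg : W1p_weak_cvg Om p u_ u.

Lemma weak_cvg_integral A a (M : R) : measurable A -> A `<=` Om -> (mu A < +oo)%E ->
  measurable_fun A (a : E -> R) -> (forall x, A x -> `|a x| <= M) ->
  (fun k => \int[mu]_(x in A) (u_ k x * a x)) @ \oo --> \int[mu]_(x in A) (u x * a x).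
Proof.
move=> mA AOm Aoo ma aM; apply: (u_cvg (F := fun v => \int[mu]_(x in A) (v x * a x))).
apply: (@dual_of_bounded (fun v => v) A a M) => //.
- by move=> v; exact: W1p_Lp.
- by move=> v w _ _; exact: aeW.
- by move=> c v _; exact: aeW.
- by move=> v _; exact: Lp_norm_le_W1p.
Qed.

Lemma weak_cvg_wgrad i A a (M : R) : measurable A -> A `<=` Om -> (mu A < +oo)%E ->
  measurable_fun A (a : E -> R) -> (forall x, A x -> `|a x| <= M) ->
  (fun k => \int[mu]_(x in A) (wgrad Om (u_ k) x 0 i * a x)) @ \oo -->
  \int[mu]_(x in A) (wgrad Om u x 0 i * a x).
Proof.
move=> mA AOm Aoo ma aM.
apply: (u_cvg (F := fun v => \int[mu]_(x in A) (wgrad Om v x 0 i * a x))).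
apply: (@dual_of_bounded (fun v x => wgrad Om v x 0 i) A a M) => //.
- by move=> v; exact: wgrad_Lp.
- by move=> v w wv ww; apply: filterS (wgradD wv ww) => x h Ox; rewrite (h Ox) mxE.
- by move=> c v wv; apply: filterS (wgradZ c wv) => x h Ox; rewrite (h Ox) mxE.
- by move=> v; exact: Lp_norm_wgrad_le.
Qed.

Lemma integrable_W1p A v : W1p Om p v -> measurable A -> A `<=` Om -> (mu A < +oo)%E ->
  mu.-integrable A (EFin \o v) /\ forall i, mu.-integrable A (EFin \o (fun x => wgrad Om v x 0 i)).
Proof.
move=> wv mA AOm Aoo; have [C _ CP] := holder_finite mOm p1 mA AOm Aoo.
by split=> [|i]; [have [] := CP _ (W1p_Lp wv)|have [] := CP _ (wgrad_Lp i wv)].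
Qed.

Lemma weak_cvg_wgrad_sum A (a : V -> V) (M : R) : measurable A -> A `<=` Om -> (mu A < +oo)%E ->
  (forall i, measurable_fun A (fun x : E => a x 0 i)) -> (forall x i, A x -> `|a x 0 i| <= M) ->
  (fun k => \int[mu]_(x in A) (\sum_i a x 0 i * (wgrad Om (u_ k) x - wgrad Om u x) 0 i))
    @ \oo --> (0 : R).
Proof.
move=> mA AOm Aoo ma aM.
have iw v i : W1p Om p v -> mu.-integrable A (EFin \o (fun x => wgrad Om v x 0 i * a x 0 i)).
  move=> wv; have [_ iv] := integrable_W1p wv mA AOm Aoo.
  exact: integrable_mul_bounded mA (iv i) (ma i) (fun x Ax => aM x i Ax).
have sumE : (fun k => \int[mu]_(x in A) (\sum_i a x 0 i * (wgrad Om (u_ k) x - wgrad Om u x) 0 i)) =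
    fun k => \sum_i (\int[mu]_(x in A) (wgrad Om (u_ k) x 0 i * a x 0 i) -
            \int[mu]_(x in A) (wgrad Om u x 0 i * a x 0 i)).
  apply/funext => k; have H (s : seq 'I_n.+1) :
      mu.-integrable A (EFin \o (fun x => \sum_(i <- s) a x 0 i * (wgrad Om (u_ k) x - wgrad Om u x) 0 i)) /\
      \int[mu]_(x in A) (\sum_(i <- s) a x 0 i * (wgrad Om (u_ k) x - wgrad Om u x) 0 i) =
      \sum_(i <- s) (\int[mu]_(x in A) (wgrad Om (u_ k) x 0 i * a x 0 i) -
            \int[mu]_(x in A) (wgrad Om u x 0 i * a x 0 i)).
    elim: s => [|i s [IH1 IH2]].
      rewrite (_ : (fun x : E => _) = cst 0); last by apply/funext => x; rewrite big_nil.
      by rewrite big_nil Rintegral_cst ?mul0r//; split=> //; exact: integrable0.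
    have iB := integrableB mA (iw _ i (wu_ k)) (iw _ i wu).
    rewrite (_ : (fun x : E => _) = fun x => (wgrad Om (u_ k) x 0 i * a x 0 i -
        wgrad Om u x 0 i * a x 0 i) +
      \sum_(j <- s) a x 0 j * (wgrad Om (u_ k) x - wgrad Om u x) 0 j); last first.
      by apply/funext => x; rewrite big_cons !mxE; congr (_ + _); ring.
    split; first exact: (integrableD mA iB IH1).
    by rewrite (RintegralD mA iB IH1) (RintegralB mA (iw _ i (wu_ k)) (iw _ i wu)) big_cons IH2.
  by have [_ ->] := H (index_enum _).
have := @cvg_sumr R nat _ \oo (index_enum 'I_n.+1) (fun i k =>
  \int[mu]_(x in A) (wgrad Om (u_ k) x 0 i * a x 0 i) -
  \int[mu]_(x in A) (wgrad Om u x 0 i * a x 0 i)) (fun=> 0).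
rewrite sumE big1// => H; apply: H => i.
have := weak_cvg_wgrad mA AOm Aoo (ma i) (fun x Ax => aM x i Ax).
by move=> /(_ i)/subr_cvg0.
Qed.

(** Box integrals converge because they are bounded functionals, and the gradients
    are bounded in [L^1] of every box, so Rellich's theorem applies to the
    differences. *)
Lemma weak_cvg_ae_subseq : W1p_bounded Om p u_ ->
  exists s : nat -> nat, (forall k, (k <= s k)%N) /\
    {ae mu, forall x : E, Om x -> (fun k => u_ (s k) x) @ \oo --> u x}.
Proof.
move=> [M bM].
pose v k := u_ k \+ (fun x => - 1 * u x).
pose g k x := wgrad Om (u_ k) x + (- 1) *: wgrad Om u x.
have wg k : weak_gradient Om (v k) (g k).
  apply: weak_gradientD oOm (wgrad_weak (wu_ k)) _.
  exact: weak_gradientZ oOm (wgrad_weak wu).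
have boxE c : vcbox c `<=` Om -> vbox c `<=` Om.
  by move=> cOm; apply: subset_trans cOm; exact: box_cbox.
have v0 c : vcbox c `<=` Om -> (fun k => \int[mu]_(x in vbox c) v k x) @ \oo --> (0 : R).
  move=> cOm; have mc := measurable_vbox c; have coo := leb_box_lty c.1 c.2.
  have := weak_cvg_integral mc (boxE _ cOm) coo (@measurable_cst _ _ E _ _ (1 : R))
    (M := 1) (fun x _ => ltac:(by rewrite normr1)).
  have E1 w : \int[mu]_(x in vbox c) (w x * 1) = \int[mu]_(x in vbox c) w x.
    by apply: eq_Rintegral => x _; rewrite mulr1.
  rewrite E1; under eq_fun do rewrite E1; move/subr_cvg0; apply: cvg_trans; apply: near_eq_cvg; apply: nearW => k.
  have [ik _] := integrable_W1p (wu_ k) mc (boxE _ cOm) coo.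
  have [iu _] := integrable_W1p wu mc (boxE _ cOm) coo.
  by rewrite /= -(RintegralB mc ik iu); apply: eq_Rintegral => x _; rewrite /v /= mulN1r.
have gM c : vcbox c `<=` Om -> exists M : R, forall k,
    \int[mu]_(x in vbox c) norm1 (g k) x <= M.
  move=> cOm; have mc := measurable_vbox c; have coo := leb_box_lty c.1 c.2.
  have [C C0 CP] := holder_finite mOm p1 mc (boxE _ cOm) coo.
  exists (\sum_(i < n.+1) (C * M + \int[mu]_(x in vbox c) `|wgrad Om u x 0 i|)) => k.
  have ik i : mu.-integrable (vbox c) (EFin \o (fun x => wgrad Om (u_ k) x 0 i)).
    by have [] := CP _ (wgrad_Lp i (wu_ k)).
  have iu i : mu.-integrable (vbox c) (EFin \o (fun x => wgrad Om u x 0 i)).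
    by have [] := CP _ (wgrad_Lp i wu).
  have isum i := integrableD mc (integrable_norm (ik i)) (integrable_norm (iu i)).
  have ig : mu.-integrable (vbox c) (EFin \o norm1 (g k)).
    apply: integrableS (integrable_norm1 (wg k) cOm) => //; first exact: measurable_cbox.
    exact: box_cbox.
  have H (s : seq 'I_n.+1) : mu.-integrable (vbox c) (EFin \o (fun x =>
      \sum_(i <- s) (`|wgrad Om (u_ k) x 0 i| + `|wgrad Om u x 0 i|))) /\
    \int[mu]_(x in vbox c) (\sum_(i <- s) (`|wgrad Om (u_ k) x 0 i| + `|wgrad Om u x 0 i|)) <=
    \sum_(i <- s) (C * M + \int[mu]_(x in vbox c) `|wgrad Om u x 0 i|).
    elim: s => [|i s [IH1 IH2]].
      rewrite (_ : (fun x : E => _) = cst 0); last by apply/funext => x; rewrite big_nil.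
      by rewrite big_nil Rintegral_cst ?mul0r//; split=> //; exact: integrable0.
    rewrite (_ : (fun x : E => _) = fun x => (`|wgrad Om (u_ k) x 0 i| + `|wgrad Om u x 0 i|) +
      \sum_(j <- s) (`|wgrad Om (u_ k) x 0 j| + `|wgrad Om u x 0 j|)); last first.
      by apply/funext => x; rewrite big_cons.
    split; first exact: (integrableD mc (isum i) IH1).
    rewrite (RintegralD mc (isum i) IH1) big_cons lerD//.
    rewrite (RintegralD mc (integrable_norm (ik i)) (integrable_norm (iu i))) lerD2r.
    have [_ bC] := CP _ (wgrad_Lp i (wu_ k)).
    rewrite -lee_fin (fineK (integrable_fin_num mc (integrable_norm (ik i)))).
    apply: le_trans bC _; rewrite EFinM; apply: lee_wpmul2l; first by rewrite lee_fin.
    exact: le_trans (Lp_norm_wgrad_le i (wu_ k)) (bM k).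
  have [Hi Hle] := H (index_enum _); apply: le_trans Hle; apply: le_Rintegral => //.
  move=> x _; apply: ler_sum => i _; rewrite !mxE mulN1r; exact: ler_normB.
have [s [ks sP]] := rellich_subseq oOm wg v0 gM.
exists s; split=> //; apply: filterS sP => x h Ox.
apply/subr_cvg0; apply: cvg_trans (h Ox); apply: near_eq_cvg; apply: nearW => k.
by rewrite /v /= mulN1r.
Qed.

End weak_limits.
End sobolev_functions.

(** * Limits along subsequences *)
Lemma limn_einf_lt (R : realType) (F : nat -> \bar R) (c : \bar R) :
  (limn_einf F < c)%E -> forall m, exists k, (m <= k)%N /\ (F k < c)%E.
Proof.
rewrite limn_einf_lim (cvg_lim _ (@cvg_einfs_sup _ F))// => supc m.
have : (einfs F m < c)%E.
  by apply: le_lt_trans supc; apply: ereal_sup_ubound; exists m.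
by move=> /ereal_inf_lt[_ [k /= mk <-] Fk]; exists k.
Qed.

Lemma limn_esup_lt (R : realType) (F : nat -> \bar R) (c : \bar R) :
  (limn_esup F < c)%E -> \forall k \near \oo, (F k < c)%E.
Proof.
rewrite limn_esup_lim (cvg_lim _ (@cvg_esups_inf _ F))//.
move=> /ereal_inf_lt[_ [m _ <-] mc]; exists m => // k /= mk; apply: le_lt_trans mc.
by apply: ereal_sup_ubound; exists k.
Qed.

(** A sequence converges as soon as each of its subsequences has a convergent further
    subsequence.  Subsequences are given by index maps with [k <= s k]
    instead of increasing ones, which keeps diagonal choices simple. *)
Lemma cvge0_subseq (R : realType) (F : nat -> \bar R) : (forall k, (0 <= F k)%E) ->
  (forall s : nat -> nat, (forall k, (k <= s k)%N) -> exists t : nat -> nat,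
     (fun k => F (s (t k))) @ \oo --> 0%E) ->
  F @ \oo --> 0%E.
Proof.
move=> F0 sub; apply: cvge0P => // e e0; apply: contrapT => nF.
have bad N : exists k, (N <= k)%N /\ (e%:E < F k)%E.
  apply: contrapT => /forallNP h; apply: nF; exists N => // k /= Nk.
  by rewrite leNgt; apply/negP => Fk; exact: (h k).
have [s sP] := choice bad; have [t tP] := sub s (fun k => (sP k).1).
have [N _ /(_ N (leqnn N))] := cvge0_lt tP e0.
by move=> /lt_trans/(_ (sP (t N)).2); rewrite ltxx.
Qed.

Lemma cvg_powR0 (R : realType) (r : R) (a : nat -> R) : 0 < r -> a @ \oo --> (0 : R) ->
  (fun k => `|a k| `^ r) @ \oo --> (0 : R).
Proof.
move=> r0 a0; apply/cvgr0Pnorm_le => e e0.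
have e'0 : 0 < e `^ r^-1 by rewrite powR_gt0.
have /cvgr0Pnorm_le/(_ _ e'0) := a0; apply: filterS => k ak.
rewrite ger0_norm ?powR_ge0// -[leRHS]powRr1 ?(ltW e0)// -(mulVf (lt0r_neq0 r0)) powRrM.
by apply: ge0_ler_powR; rewrite ?nnegrE ?(ltW r0) ?powR_ge0.
Qed.

Lemma cvg_enorm_sub (R : realType) (N : nat) (w_ : nat -> 'rV[R]_N) (w : 'rV[R]_N) :
  w_ @ \oo --> w -> (fun k => enorm (w_ k - w)) @ \oo --> (0 : R).
Proof.
move=> ww.
have S0 : (fun k => \sum_i `|(w_ k - w) 0 i|) @ \oo --> (0 : R).
  have := @cvg_sumr R nat _ \oo (index_enum 'I_N) (fun i k => `|(w_ k - w) 0 i|) (fun=> 0).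
  rewrite big1// => H; apply: H => i.
  rewrite -[X in _ --> X](normr0 R); apply: cvg_norm.
  under eq_fun do rewrite !mxE; apply/subr_cvg0.
  exact: (cvg_comp _ _ ww (@coord_continuous R 1 N 0 i w)).
apply: (@squeeze_cvgr _ _ _ _ (fun=> 0) (fun k => \sum_i `|(w_ k - w) 0 i|)) => //.
  by apply: nearW => k; rewrite enorm_ge0 enorm_le_sum.
exact: cvg_cst.
Qed.

Section integrals.
Context d (T : measurableType d) (R : realType).
Variable mu : {measure set T -> \bar R}.
Local Open Scope ereal_scope.

Lemma integral_setD_null (A Z : set T) (f : T -> \bar R) : measurable A -> measurable Z ->
  mu Z = 0 -> measurable_fun A f -> \int[mu]_(x in A) f x = \int[mu]_(x in A `\` Z) f x.
Proof.
move=> mA mZ Z0 mf; rewrite integral_mkcond [RHS]integral_mkcond.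
have mAZ : measurable (A `\` Z) by exact: measurableD.
apply: ae_eq_integral => //.
- exact/(measurable_restrictT _ mA).
- by apply/(measurable_restrictT _ mAZ); apply: measurable_funS mf.
exists Z; split=> // x /=; apply: contra_notP => nZ _; rewrite !patchE.
have [xA|xA] := pselect (A x); first by rewrite !mem_set.
by rewrite !memNset// => -[].
Qed.

(** The lower bound makes the negative part integrable, so a finite integral leaves
    no room for an infinite positive part. *)
Lemma integrable_lower_bound (D : set T) (f l : T -> R) : measurable D ->
  measurable_fun D f -> mu.-integrable D (EFin \o l) -> (forall x, D x -> - l x <= f x)%R ->
  \int[mu]_(x in D) (f x)%:E < +oo -> mu.-integrable D (EFin \o f).
Proof.
move=> mD mf il lf foo.
have mfE : measurable_fun D (EFin \o f) by exact/measurable_EFinP.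
have mp := measurable_funepos mfE; have mn := measurable_funeneg mfE.
have negoo : \int[mu]_(x in D) (EFin \o f)^\- x < +oo.
  have /integrableP[ml] := il; apply: le_lt_trans.
  apply: ge0_le_integral => //.
    by apply: measurableT_comp.
  move=> x Dx; rewrite /= funenegE ge_max; apply/andP; split; rewrite lee_fin//.
  by rewrite lerNl (le_trans _ (lf x Dx))// lerN2 ler_norm.
have posoo : \int[mu]_(x in D) (EFin \o f)^\+ x < +oo.
  move: foo; rewrite [X in X < _](_ : _ = \int[mu]_(x in D) (EFin \o f) x)// integralE.
  have : 0 <= \int[mu]_(x in D) (EFin \o f)^\- x by exact: integral_ge0.
  move: negoo; case: (\int[mu]_(x in D) (EFin \o f)^\- x) => // r _ _.
  by case: (\int[mu]_(x in D) (EFin \o f)^\+ x) => [s _|h|_]; [exact: ltry|exact: h|by []].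
apply/integrableP; split=> //.
rewrite (_ : \int[mu]_(x in D) _ =
  \int[mu]_(x in D) ((EFin \o f)^\+ x + (EFin \o f)^\- x)); last first.
  by apply: eq_integral => x _; rewrite -[LHS]/((abse \o (EFin \o f)) x) fune_abse.
by rewrite ge0_integralD// lte_add_pinfty.
Qed.

End integrals.

Lemma Lp_norm_cvg0 (R : realType) (n : nat) (Om : set 'rV[R]_n.+1) (r : R)
    (f : nat -> 'rV[R]_n.+1 -> R) : 0 < r ->
  (fun k => \int[leb]_(x in (Om : set (Rn R n))) (`|f k x| `^ r)%:E)%E @ \oo --> 0%E ->
  (fun k => Lp_norm Om r (f k)) @ \oo --> 0%E.
Proof.
move=> r0 f0; apply: cvge0P => [k|e e0]; first exact: Lp_norm_ge0.
have er0 : 0 < e `^ r by rewrite powR_gt0.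
apply: filterS (cvge0_lt f0 er0) => k /ltW.
exact: Lp_norm_le (ltW e0).
Qed.

Section local_convergence.
Variables (R : realType) (n : nat) (Om : set 'rV[R]_n.+1) (p : R).
Local Notation E := (Rn R n).
Local Notation mu := (@leb R n).
Hypotheses (oOm : open Om) (p1 : 1 < p).

(** Over a relatively compact set [L^p] controls [L^1], by Hoelder's inequality.  The
    weak gradient over the smaller set is a restriction of the one over [Om] up to a
    null set, by uniqueness. *)
Lemma W11_loc_of_Lp (u_ : nat -> 'rV[R]_n.+1 -> R) u :
  (forall k, W1p Om p (u_ k)) -> W1p Om p u ->
  (fun k => Lp_norm Om p (fun x => enorm (wgrad Om (u_ k) x - wgrad Om u x))) @ \oo --> 0%E ->
  (fun k => Lp_norm Om p (u_ k \- u)) @ \oo --> 0%E ->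
  W11_loc_cvg Om u_ u.
Proof.
move=> wu_ wu g0 v0 Om' oOm' cK KOm.
have mOm : measurable (Om : set E) by exact: open_measurable_Rn.
have mOm' : measurable (Om' : set E) by exact: open_measurable_Rn.
have OmOm : Om' `<=` Om by apply: subset_trans KOm; exact: subset_closure.
have Om'oo : (mu Om' < +oo)%E.
  apply: le_lt_trans (compact_leb_lty cK); apply: le_measure; rewrite ?inE//.
    exact: compact_measurable_Rn.
  exact: subset_closure.
have p0 : 0 < p by exact: lt_trans p1.
have [C C0 CP] := holder_finite mOm p1 mOm' OmOm Om'oo.
have L1 f : in_Lp Om p f -> (Lp_norm Om' 1 f <= C%:E * Lp_norm Om p f)%E.
  move=> lf; have [_] := CP _ lf; apply: le_trans.
  rewrite -[leLHS]poweRe1 ?Lp_norm_ge0// Lp_norm_powR// le_eqVlt; apply/orP; left.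
  by apply/eqP; apply: eq_integral => x _; rewrite powRr1.
pose W k x := wgrad Om (u_ k) x + (- 1) *: wgrad Om u x.
have WE k x : W k x = wgrad Om (u_ k) x - wgrad Om u x by rewrite /W scaleN1r.
have uE k : u_ k \- u = u_ k \+ (fun x => - 1 * u x).
  by apply/funext => x; rewrite /= mulN1r.
have wuk k : W1p Om p (u_ k \- u) by rewrite uE; exact: W1pD (wu_ k) (W1pZ _ _ _ wu).
have wW k : weak_gradient Om (u_ k \- u) (W k).
  rewrite uE; apply: weak_gradientD oOm (wgrad_weak (wu_ k)) _.
  exact: weak_gradientZ oOm (wgrad_weak wu).
have wW' k : weak_gradient Om' (u_ k \- u) (W k) by exact: weak_gradient_sub (wW k).
have lW k : in_Lp Om p (fun x => enorm (W k x)).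
  apply: in_Lp_enorm => // i; have lg : in_Lp Om p (fun x => wgrad Om (u_ k \- u) x 0 i).
    exact: wgrad_Lp.
  apply: (in_Lp_ae mOm p0 _ _ lg); first by have [_ lW _] := wW k; have [] := lW i.
  have := weak_gradient_unique oOm (wgrad_weak (wuk k)) (wW k).
  by apply: filterS => x h Ox; rewrite h.
have normE k : Lp_norm Om' 1 (fun x => enorm (wgrad Om' (u_ k \- u) x)) =
    Lp_norm Om' 1 (fun x => enorm (W k x)).
  have wg' := xget_weak_gradient (wW' k).
  apply: (Lp_norm_ae mOm' ltr01).
  - by apply: measurable_enorm => i; have [_ l _] := wg'; have [] := l i.
  - by apply: measurable_enorm => i; have [_ l _] := wW' k; have [] := l i.
  - have := weak_gradient_unique oOm' wg' (wW' k).
    by apply: filterS => x h Ox; rewrite h.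
apply: cvge0P => [k|e e0]; first by rewrite /W1p_norm adde_ge0// Lp_norm_ge0.
have C10 : 0 < 2 * (C + 1) by rewrite mulr_gt0// ltr_wpDl.
have e'0 : 0 < e / (2 * (C + 1)) by rewrite divr_gt0.
apply: filterS2 (cvge0_lt g0 e'0) (cvge0_lt v0 e'0) => k gk vk.
rewrite /W1p_norm normE; apply: (@le_trans _ _
    (C%:E * (e / (2 * (C + 1)))%:E + C%:E * (e / (2 * (C + 1)))%:E)%E).
  apply: leeD.
    apply: le_trans (L1 _ (W1p_Lp (wuk k))) _; apply: lee_wpmul2l; last exact: ltW.
    by rewrite lee_fin.
  apply: le_trans (L1 _ (lW k)) _; apply: lee_wpmul2l; first by rewrite lee_fin.
  apply: ltW; apply: le_lt_trans gk; rewrite le_eqVlt; apply/orP; left; apply/eqP.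
  by congr (Lp_norm Om p _); apply/funext => x; rewrite WE.
rewrite -EFinM -EFinD lee_fin.
have -> : C * (e / (2 * (C + 1))) + C * (e / (2 * (C + 1))) = e * (C / (C + 1)).
  by field; rewrite gt_eqF// ltr_wpDl.
by rewrite ler_piMr ?(ltW e0)// ler_pdivrMr ?mul1r ?lerDl// ltr_wpDl.
Qed.

End local_convergence.

(** * The integral functional *)
Lemma lte_real_between (R : realType) (a b : \bar R) : (a < b)%E ->
  exists c : R, (a < c%:E)%E /\ (c%:E < b)%E.
Proof.
case: a => [a| |]; case: b => [b| |]//.
- by rewrite lte_fin => ab; exists ((a + b) / 2); rewrite !lte_fin; split; lra.
- by move=> _; exists (a + 1); rewrite lte_fin ltrDl ltr01 ltry.
- by move=> _; exists (b - 1); rewrite ltNyr lte_fin gtrBl ltr01.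
- by move=> _; exists 0; rewrite ltNyr ltry.
Qed.

Section integral_functional.
Variables (R : realType) (n : nat).
Local Notation V := 'rV[R]_n.+1.
Local Notation E := (Rn R n).
Local Notation mu := (@leb R n).
Variables (Om : set V) (p ps : R) (j : V -> R -> V -> R) (C : R) (h : V -> R).
Hypotheses (oOm : open Om) (p1 : 1 < p) (ps0 : 0 < ps) (emb : W1p_embedded_Lp Om p ps).
Hypotheses (j_car : caratheodory_function Om j) (C0 : 0 < C) (h1 : in_Lp Om 1 h).
Hypothesis j_lb : \forall x \ae mu, Om x -> forall (m : R) (xi : V),
  j x m xi >= - C * (enorm xi `^ p + `|m| `^ ps + `|m| `^ p) - `|h x|.
Hypothesis j_convex : \forall x \ae mu, Om x -> forall m : R, strictly_convex (j x m).
Implicit Types (u w : V -> R) (v : nat -> V -> R).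

Let mOm : measurable (Om : set E). Proof. exact: open_measurable_Rn. Qed.
Let p0 : 0 < p. Proof. exact: lt_trans p1. Qed.

Let grad_power w x := `|enorm (wgrad Om w x)| `^ p.
Let lower w x := C * (grad_power w x + `|w x| `^ ps + `|w x| `^ p) + `|h x| `^ 1.

Let W1p_ps w : W1p Om p w -> in_Lp Om ps w.
Proof. by have [K KP] := emb; move=> /KP[]. Qed.

Let mW w : W1p Om p w -> measurable_fun (Om : set E) w.
Proof. by move=> /W1p_Lp; exact: measurable_Lp. Qed.

Let menorm w : W1p Om p w -> measurable_fun (Om : set E) (fun x => enorm (wgrad Om w x)).
Proof. by move=> ww; apply: measurable_enorm => i; exact: (measurable_wgrad (p := p)). Qed.

Let integrable_powp w : W1p Om p w -> mu.-integrable Om (EFin \o (fun x => `|w x| `^ p)).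
Proof. by move=> /W1p_Lp/(in_LpP _ mOm p0)[]. Qed.

Let integrable_powps w : W1p Om p w -> mu.-integrable Om (EFin \o (fun x => `|w x| `^ ps)).
Proof. by move=> /W1p_ps/(in_LpP _ mOm ps0)[]. Qed.

Let integrable_grad w : W1p Om p w -> mu.-integrable Om (EFin \o grad_power w).
Proof.
move=> ww; have lw : in_Lp Om p (fun x => enorm (wgrad Om w x)).
  by apply: in_Lp_enorm mOm p0 _ => i; exact: wgrad_Lp.
by have /(in_LpP _ mOm p0)[] := lw.
Qed.

Let integrable_h : mu.-integrable Om (EFin \o (fun x => `|h x| `^ 1)).
Proof. by have /(in_LpP _ mOm ltr01)[] := h1. Qed.

Let integrable_lower w : W1p Om p w -> mu.-integrable Om (EFin \o lower w).
Proof.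
move=> ww; have i1 := integrableD mOm (integrable_grad ww) (integrable_powps ww).
have i2 := integrableZ_EFin C mOm (integrableD mOm i1 (integrable_powp ww)).
exact: (integrableD mOm i2 integrable_h).
Qed.

Let mjw w : W1p Om p w -> measurable_fun (Om : set E) (fun x => j x (w x) (wgrad Om w x)).
Proof.
move=> ww; apply: (@measurable_caratheodory _ E R mu (@leb_complete R n) Om mOm n.+1 j).
- by case: j_car.
- by case: j_car.
- exact: mW.
- by move=> i; exact: (measurable_wgrad (p := p)).
Qed.

Let exceptional : exists Z : set E, [/\ measurable Z, mu Z = 0%E &
  forall x, Om x -> ~ Z x -> [/\ continuous (fun z : R * V => j x z.1 z.2),
    forall w, - lower w x <= j x (w x) (wgrad Om w x) &
    forall m, strictly_convex (j x m)]].
Proof.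
have [_ cj] := j_car.
have : {ae mu, forall x : E, Om x -> [/\ continuous (fun z : R * V => j x z.1 z.2),
    forall (m : R) (xi : V),
      j x m xi >= - C * (enorm xi `^ p + `|m| `^ ps + `|m| `^ p) - `|h x| &
    forall m, strictly_convex (j x m)]}.
  have cj' : {ae mu, forall x : E, Om x -> continuous (fun z : R * V => j x z.1 z.2)} := cj.
  have lb' : {ae mu, forall x : E, Om x -> forall (m : R) (xi : V),
    j x m xi >= - C * (enorm xi `^ p + `|m| `^ ps + `|m| `^ p) - `|h x|} := j_lb.
  have sj' : {ae mu, forall x : E, Om x -> forall m : R, strictly_convex (j x m)} := j_convex.
  apply: filterS3 cj' lb' sj' => x cx lx sx Ox.
  by split; [exact: cx|exact: lx|exact: sx].
move=> [Z [mZ Z0 ZP]].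
exists Z; split=> // x Ox nZ.
have [cx lx sx] := contrapT (fun nP => nZ (ZP x nP)) Ox.
split=> // w; apply: le_trans (lx (w x) (wgrad Om w x)).
by rewrite /lower /grad_power powRr1// ger0_norm ?enorm_ge0// opprD mulNr.
Qed.

Let Jset_null w (Z : set E) : W1p Om p w -> measurable Z -> mu Z = 0%E ->
  Jfun j Om w = (\int[mu]_(x in (Om : set E) `\` Z) (j x (w x) (wgrad Om w x))%:E)%E.
Proof.
by move=> ww mZ Z0; apply: integral_setD_null => //; apply/measurable_EFinP; exact: mjw.
Qed.

Lemma Jfun_fin_num w : W1p Om p w -> (Jfun j Om w < +oo)%E -> Jfun j Om w \is a fin_num.
Proof.
have [Z [mZ Z0 ZP]] := exceptional; move=> ww; rewrite (Jset_null ww mZ Z0) => joo.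
have mD : measurable ((Om : set E) `\` Z) by exact: measurableD.
have DOm : (Om : set E) `\` Z `<=` Om by move=> x [].
apply: (integrable_fin_num mD); apply: (@integrable_lower_bound _ E R mu _ _ (lower w) mD _ _ _ joo).
- by apply: measurable_funS (mjw ww).
- by apply: integrableS (integrable_lower ww).
- by move=> x [Ox nZ]; have [_ lx _] := ZP x Ox nZ; exact: lx.
Qed.

(** What the hypotheses on the sequence amount to, in a form inherited by
    subsequences. *)
Definition tight v u : Prop :=
  [/\ forall k, W1p Om p (v k), W1p_bounded Om p v, W1p_weak_cvg Om p v u &
   [/\ unif_small mu (Om : set E) (fun k x => `|v k x| `^ p),
       unif_small mu (Om : set E) (fun k x => `|v k x| `^ ps) &
       unif_small mu (Om : set E) (fun k => grad_power (v k))]].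

Lemma tight_sub v u (s : nat -> nat) : (forall k, (k <= s k)%N) -> tight v u ->
  tight (fun k => v (s k)) u.
Proof.
move=> ks [wv [M bv] cv [e1 e2 e3]]; split.
- by move=> k; exact: wv.
- by exists M => k; exact: bv.
- by move=> F dF; exact: (cvg_comp _ _ (cvg_subseq_oo ks) (cv F dF)).
- by split; [exact: unif_small_sub e1|exact: unif_small_sub e2|exact: unif_small_sub e3].
Qed.

(** All exceptional null sets are removed from [Om], which leaves a set [D] where the
    hypotheses hold at every point; the functional does not see the difference. *)
Lemma semicontinuity_ae v u : tight v u -> W1p Om p u ->
  {ae mu, forall x : E, Om x -> (fun k => v k x) @ \oo --> u x} ->
  (forall k, (Jfun j Om (v k) < +oo)%E) ->
  (forall c : R, (forall k, (Jfun j Om (v k) <= c%:E)%E) -> (Jfun j Om u <= c%:E)%E) /\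
  ((Jfun j Om u < +oo)%E ->
   (forall e : R, 0 < e -> \forall k \near \oo, (Jfun j Om (v k) <= Jfun j Om u + e%:E)%E) ->
   exists s : nat -> nat, (forall k, (k <= s k)%N) /\
     {ae mu, forall x : E, Om x -> (fun k => wgrad Om (v (s k)) x) @ \oo --> wgrad Om u x}).
Proof.
move=> [wv _ cv [e1 e2 e3]] wu [Z2 [mZ2 Z20 Z2P]] Jv.
have [Z1 [mZ1 Z10 Z1P]] := exceptional.
pose Z := Z1 `|` Z2; have mZ : measurable Z by exact: measurableU.
have Z0 : mu Z = 0%E by exact: null_set_setU.
pose D : set E := (Om : set E) `\` Z; have mD : measurable D by exact: measurableD.
have DOm : D `<=` Om by move=> x [].
have ofD (f : E -> R) : measurable_fun (Om : set E) f -> measurable_fun D f.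
  by move=> mf; exact: measurable_funS mf.
have iD (f : E -> R) : mu.-integrable Om (EFin \o f) -> mu.-integrable D (EFin \o f).
  by move=> if_; exact: integrableS if_.
have uD (Phi : nat -> E -> R) : unif_small mu (Om : set E) Phi -> unif_small mu D Phi.
  by move=> uP; exact: unif_smallS uP.
have D1 x : D x -> [/\ continuous (fun z : R * V => j x z.1 z.2),
    forall w, - lower w x <= j x (w x) (wgrad Om w x) & forall m, strictly_convex (j x m)].
  by move=> [Ox nZ]; apply: Z1P => // Z1x; apply: nZ; left.
have mj m xi : measurable_fun D (fun x => j x m xi) by have [mj _] := j_car; exact: ofD.
have cj x : D x -> continuous (fun z : R * V => j x z.1 z.2) by move=> /D1[].
have sj x : D x -> forall m, strictly_convex (j x m) by move=> /D1[].
have exhD : D `<=` \bigcup_k bigbox k by rewrite bigcup_bigbox.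
have mexh k : measurable (bigbox k : set E) by exact: measurable_box.
have exhoo k : (mu (bigbox k) < +oo)%E by exact: leb_box_lty.
have mv k : measurable_fun D (v k) by apply/ofD/mW.
have mu_ : measurable_fun D u by apply/ofD/mW.
have mwv k i : measurable_fun D (fun x : E => wgrad Om (v k) x 0 i).
  by apply: ofD; exact: (measurable_wgrad (p := p)).
have mwu i : measurable_fun D (fun x : E => wgrad Om u x 0 i).
  by apply: ofD; exact: (measurable_wgrad (p := p)).
have vu x : D x -> v ^~ x @ \oo --> u x.
  move=> [Ox nZ]; have nZ2 : ~ Z2 x by move=> Z2x; apply: nZ; right.
  exact: (contrapT (fun nP => nZ2 (Z2P x nP))) Ox.
have npow (f : nat -> E -> R) (r : R) : (forall k, measurable_fun D (f k)) ->
    nonneg_mfun D (fun k x => `|f k x| `^ r).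
  by move=> mf; split=> [k|k x _]; [exact: measurable_normX|exact: powR_ge0].
have h1p := npow _ p mv; have hps := npow _ ps mv.
have hgr : nonneg_mfun D (fun k => grad_power (v k)).
  by apply: (npow (fun k x => enorm (wgrad Om (v k) x)) p) => k; apply/ofD/menorm.
have mh : measurable_fun D (h : E -> R) by apply: ofD; have /(in_LpP _ mOm ltr01)[] := h1.
have hh := npow (fun _ => h) 1 (fun _ => mh).
have uh : unif_small mu D (fun _ x => `|h x| `^ 1).
  apply: (unif_small_integrable mD) => //; exact: iD.
have h2 := nonneg_mfunD hgr hps; have h3 := nonneg_mfunD h2 h1p.
have u2 := unif_smallD mD hgr hps (uD _ e3) (uD _ e2).
have u3 := unif_smallD mD h2 h1p u2 (uD _ e1).
have h4 := nonneg_mfunZ (ltW C0) h3; have u4 := unif_smallZ mD (ltW C0) h3 u3.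
have hl : nonneg_mfun D (fun k => lower (v k)) := nonneg_mfunD h4 hh.
have ul : unif_small mu D (fun k => lower (v k)) := unif_smallD mD h4 hh u4 uh.
have il k : mu.-integrable D (EFin \o lower (v k)) by apply/iD/integrable_lower.
have iK k : mu.-integrable D (EFin \o grad_power (v k)) by apply/iD/integrable_grad.
have jl k x : D x -> - lower (v k) x <= j x (v k x) (wgrad Om (v k) x) by move=> /D1[].
have wK k x i : D x -> `|wgrad Om (v k) x 0 i| <= 1 + grad_power (v k) x.
  move=> _; apply: le_trans (coord_le_enorm _ i) _; rewrite /grad_power.
  have := ler_norm (enorm (wgrad Om (v k) x)); set y := `|_| => /le_trans; apply.
  have [y1|/ltW y1] := leP y 1; first by rewrite (le_trans y1)// lerDl powR_ge0.
  rewrite -[leLHS]add0r lerD//; rewrite -[leLHS]powRr1 ?normr_ge0//.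
  by apply: ler_powR => //; exact: ltW.
have weak (A : set E) (a : E -> V) (M : R) : measurable A -> A `<=` D -> (mu A < +oo)%E ->
    (forall i, measurable_fun D (fun x => a x 0 i)) -> (forall x i, A x -> `|a x 0 i| <= M) ->
    (fun k => \int[mu]_(x in A) (\sum_i a x 0 i * (wgrad Om (v k) x - wgrad Om u x) 0 i))
      @ \oo --> (0 : R).
  move=> mA AD Aoo ma aM.
  have maA i : measurable_fun A (fun x : E => a x 0 i) by exact: measurable_funS (ma i).
  exact: (weak_cvg_wgrad_sum oOm p1 wv wu cv mA (subset_trans AD DOm) Aoo maA aM).
have JE w : W1p Om p w -> Jfun j Om w = (\int[mu]_(x in D) (j x (w x) (wgrad Om w x))%:E)%E.
  by move=> ww; exact: Jset_null.
have ij w : W1p Om p w -> (Jfun j Om w < +oo)%E ->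
    mu.-integrable D (EFin \o (fun x => j x (w x) (wgrad Om w x))).
  move=> ww; rewrite JE// => joo; apply: (integrable_lower_bound mD (ofD _ (mjw ww))
    (iD _ (integrable_lower ww))) => // x /D1[_ lx _]; exact: lx.
have JR w : W1p Om p w -> (Jfun j Om w < +oo)%E ->
    Jfun j Om w = (\int[mu]_(x in D) (j x (w x) (wgrad Om w x)))%:E.
  by move=> ww joo; rewrite JE// fineK// integrable_fin_num//; exact: ij.
have ijv k := ij (v k) (wv k) (Jv k).
have ilu : mu.-integrable D (EFin \o lower u) by apply/iD/integrable_lower.
have lu0 x : D x -> 0 <= lower u x.
  move=> _; rewrite addr_ge0 ?powR_ge0// mulr_ge0 ?(ltW C0)//.
  by rewrite !addr_ge0 ?powR_ge0.
have lu x : D x -> - lower u x <= j x (u x) (wgrad Om u x) by move=> /D1[].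
split=> [c Jc|Ju limsup].
  have jc : \forall k \near \oo, \int[mu]_(x in D) j x (v k x) (wgrad Om (v k) x) <= c.
    by apply: nearW => k; rewrite -lee_fin -JR.
  have [iu uc] := semicontinuity_integral (@leb_complete R n) mD mj cj sj mexh (@bigbox_nd R n)
    exhoo exhD mv mu_ mwv mwu vu hl ul il hgr (uD _ e3) iK jl wK weak ijv lu0 ilu lu jc.
  rewrite JE// -(fineK (integrable_fin_num mD iu)) lee_fin; exact: uc.
have lim e : 0 < e -> \forall k \near \oo, \int[mu]_(x in D) j x (v k x) (wgrad Om (v k) x) <=
    \int[mu]_(x in D) j x (u x) (wgrad Om u x) + e.
  by move=> /limsup; apply: filterS => k; rewrite (JR _ wu Ju) (JR _ (wv k) (Jv k)) lee_fin.
have [s [ks sP]] := semicontinuity_strong (@leb_complete R n) mD mj cj sj mexh (@bigbox_nd R n)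
    exhoo exhD mv mu_ mwv mwu vu hl ul il hgr (uD _ e3) iK jl wK weak ijv (ij u wu Ju) lim.
exists s; split=> //; have [Y [mY Y0 YP]] := sP.
exists (Y `|` Z); split; [exact: measurableU|exact: null_set_setU|] => x /= nx.
have [Zx|nZ] := pselect (Z x); first by right.
by left; apply: YP => /= H; apply: nx => Ox; exact: H.
Qed.

(** Both [v] and its gradients converge almost everywhere along a subsequence, and the
    powers of the differences inherit uniform smallness from [v], its gradients and
    the single function [u]. *)
Lemma strong_subseq v u : tight v u -> W1p Om p u ->
  (forall k, (Jfun j Om (v k) < +oo)%E) -> (Jfun j Om u < +oo)%E ->
  (forall e : R, 0 < e -> \forall k \near \oo, (Jfun j Om (v k) <= Jfun j Om u + e%:E)%E) ->
  exists t : nat -> nat, [/\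
    (fun k => \int[mu]_(x in (Om : set E))
       (`|enorm (wgrad Om (v (t k)) x - wgrad Om u x)| `^ p)%:E)%E @ \oo --> 0%E,
    (fun k => \int[mu]_(x in (Om : set E)) (`|(v (t k) \- u) x| `^ ps)%:E)%E @ \oo --> 0%E &
    (fun k => \int[mu]_(x in (Om : set E)) (`|(v (t k) \- u) x| `^ p)%:E)%E @ \oo --> 0%E].
Proof.
move=> tv wu Jv Ju limsup; have [wv bv cv _] := tv.
have [s [ks sP]] := weak_cvg_ae_subseq oOm p1 wv wu cv bv.
have tvs := tight_sub ks tv.
have limsup' (e : R) : 0 < e ->
    \forall k \near \oo, (Jfun j Om (v (s k)) <= Jfun j Om u + e%:E)%E.
  move=> e0; have [N _ NP] := limsup e e0; exists N => [//|k Nk].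
  exact: (NP (s k) (leq_trans Nk (ks k))).
have [_ H] := semicontinuity_ae tvs wu sP (fun k => Jv (s k)).
have [s' [ks' s'P]] := H Ju limsup'.
have [wt _ _ [e1 e2 e3]] := tight_sub ks' tvs.
exists (fun k => s (s' k)).
have npow (f : nat -> E -> R) (r : R) : (forall k, measurable_fun (Om : set E) (f k)) ->
    nonneg_mfun (Om : set E) (fun k x => `|f k x| `^ r).
  by move=> mf; split=> [k|k x _]; [exact: measurable_normX|exact: powR_ge0].
have small (f : nat -> E -> R) (g : E -> R) (F : nat -> E -> R) (c r : R) : 0 < r -> 0 <= c ->
    (forall k, measurable_fun (Om : set E) (f k)) -> measurable_fun (Om : set E) g ->
    (forall k, measurable_fun (Om : set E) (F k)) ->
    mu.-integrable Om (EFin \o (fun x => `|g x| `^ r)) ->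
    unif_small mu (Om : set E) (fun k x => `|f k x| `^ r) ->
    (forall k x, `|F k x| <= c * `| `|f k x| + `|g x| |) ->
    {ae mu, forall x : E, Om x -> (fun k => F k x) @ \oo --> (0 : R)} ->
    (fun k => \int[mu]_(x in (Om : set E)) (`|F k x| `^ r)%:E)%E @ \oo --> 0%E.
  move=> r0 c0 mf mg mF ig uf Fle Fae.
  apply: (unif_small_vitali mOm (npow _ r mF)); last first.
    by apply: filterS Fae => x Fx Ox; apply: cvg_powR0 => //; exact: Fx.
  have hg := npow (fun _ => g) r (fun _ => mg).
  have hf := npow f r mf.
  have ug : unif_small mu (Om : set E) (fun _ x => `|g x| `^ r).
    by apply: unif_small_integrable => // x _; exact: powR_ge0.
  have cc0 : 0 <= c `^ r * 2 `^ r by rewrite mulr_ge0 ?powR_ge0.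
  apply: (unif_small_le mOm (npow _ r mF) (nonneg_mfunZ cc0 (nonneg_mfunD hf hg)) _
    (unif_smallZ mOm cc0 (nonneg_mfunD hf hg) (unif_smallD mOm hf hg uf ug))) => k x _ /=.
  rewrite -mulrA; apply: (@le_trans _ _ ((c * `| `|f k x| + `|g x| |) `^ r)).
    by apply: ge0_ler_powR; rewrite ?nnegrE ?(ltW r0) ?mulr_ge0.
  rewrite powRM//; apply: ler_wpM2l; first exact: powR_ge0.
  by have := powR_normD `|f k x| `|g x| (ltW r0); rewrite !normr_id.
have vB k x : `|(v (s (s' k)) \- u) x| <= 1 * `| `|v (s (s' k)) x| + `|u x| |.
  by rewrite mul1r [leRHS]ger0_norm ?addr_ge0// ler_normB.
have mB k : measurable_fun (Om : set E) (v (s (s' k)) \- u).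
  by apply: measurable_funB; exact: mW.
have aeB : {ae mu, forall x : E, Om x -> (fun k => (v (s (s' k)) \- u) x) @ \oo --> (0 : R)}.
  apply: filterS sP => x vx Ox; apply/subr_cvg0.
  exact: (cvg_comp _ _ (cvg_subseq_oo ks') (vx Ox)).
have mWB k i : measurable_fun (Om : set E)
    (fun x : E => (wgrad Om (v (s (s' k))) x - wgrad Om u x) 0 i).
  rewrite (_ : (fun x => _) = fun x => wgrad Om (v (s (s' k))) x 0 i - wgrad Om u x 0 i).
    by apply: measurable_funB; exact: (measurable_wgrad (p := p)).
  by apply/funext => x; rewrite !mxE.
split.
- apply: (small (fun k x => enorm (wgrad Om (v (s (s' k))) x))
    (fun x => enorm (wgrad Om u x))
    (fun k x => enorm (wgrad Om (v (s (s' k))) x - wgrad Om u x)) n.+1%:R p p0 (ler0n _ _)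
    (fun k => menorm (wt k)) (menorm wu) (fun k => measurable_enorm (mWB k))
    (integrable_grad wu) e3) => [k x|].
    rewrite (ger0_norm (enorm_ge0 _)) (ger0_norm (enorm_ge0 (wgrad Om u x))).
    rewrite (ger0_norm (enorm_ge0 (wgrad Om (v (s (s' k))) x))).
    by rewrite ger0_norm ?addr_ge0 ?enorm_ge0// enorm_sub_le.
  by apply: filterS s'P => x wx Ox; apply: cvg_enorm_sub; exact: wx.
- exact: (small (fun k => v (s (s' k))) u (fun k => v (s (s' k)) \- u) 1 ps ps0 ler01
    (fun k => mW (wt k)) (mW wu) mB (integrable_powps wu) e2 vB aeB).
- exact: (small (fun k => v (s (s' k))) u (fun k => v (s (s' k)) \- u) 1 p p0 ler01
    (fun k => mW (wt k)) (mW wu) mB (integrable_powp wu) e1 vB aeB).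
Qed.

Lemma J_lower_semicontinuous v u : tight v u -> W1p Om p u ->
  (limn_einf (fun k => Jfun j Om (v k)) >= Jfun j Om u)%E.
Proof.
move=> tv wu; rewrite leNgt; apply/negP => lt.
have [c [lc cJ]] := lte_real_between lt.
have [s sP] := choice (limn_einf_lt lc).
have ks k : (k <= s k)%N by have [] := sP k.
have tvs := tight_sub ks tv; have [wvs bvs cvs _] := tvs.
have [s' [ks' s'P]] := weak_cvg_ae_subseq oOm p1 wvs wu cvs bvs.
have Jc k : (Jfun j Om (v (s (s' k))) < c%:E)%E by have [] := sP (s' k).
have [H _] := semicontinuity_ae (tight_sub ks' tvs) wu s'P (fun k => lt_trans (Jc k) (ltry c)).
by have := H c (fun k => ltW (Jc k)); rewrite leNgt cJ.
Qed.

End integral_functional.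

Theorem theorem7 (R : realType) (n : nat) (p ps : R)
    (Om : set 'rV[R]_n.+1) (j : 'rV[R]_n.+1 -> R -> 'rV[R]_n.+1 -> R)
    (C : R) (h : 'rV[R]_n.+1 -> R)
    (u_ : nat -> 'rV[R]_n.+1 -> R) (u : 'rV[R]_n.+1 -> R)
    (p_gt1 : 1 < p) (ps_exp : sobolev_exponent n.+1 p ps)
    (Om_open : open Om) (Om_emb : W1p_embedded_Lp Om p ps)
    (j_car : caratheodory_function Om j)
    (C_gt0 : 0 < C) (h_L1 : in_Lp Om 1 h)
    (j_lb : \forall x \ae leb, Om x -> forall (mu : R) (xi : 'rV[R]_n.+1),
       j x mu xi >=
         - C * (enorm xi `^ p + `|mu| `^ ps + `|mu| `^ p) - `|h x|)
    (j_convex : \forall x \ae leb, Om x ->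
       forall mu : R, strictly_convex (j x mu))
    (u_W1p : forall k, W1p Om p (u_ k)) (uW1p : W1p Om p u)
    (u_bounded : W1p_bounded Om p u_) (u_cvg : W1p_weak_cvg Om p u_ u)
    (u_equi_p : equiintegrable Om p u_) (u_equi_ps : equiintegrable Om ps u_)
    (Du_equi_p : equiintegrable Om p (fun k x => enorm (wgrad Om (u_ k) x))) :
  (limn_einf (fun k => Jfun j Om (u_ k)) >= Jfun j Om u)%E /\
  ((limn_esup (fun k => Jfun j Om (u_ k)) <= Jfun j Om u)%E ->
   (Jfun j Om u < +oo)%E ->
   [/\ W11_loc_cvg Om u_ u,
       Lp_norm Om p (fun x => enorm (wgrad Om (u_ k) x - wgrad Om u x))
         @[k --> \oo] --> 0%E,
       Lp_norm Om ps (u_ k \- u) @[k --> \oo] --> 0%E &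
       Lp_norm Om p (u_ k \- u) @[k --> \oo] --> 0%E]).
Proof.
have p0 : 0 < p by exact: lt_trans p_gt1.
have ps0 : 0 < ps.
  move: ps_exp; rewrite /sobolev_exponent; case: ifPn => [pN ->|_ /(lt_trans p0)//].
  by rewrite divr_gt0 ?mulr_gt0 ?ltr0n ?subr_gt0.
have mOm : measurable (Om : set (Rn R n)) by exact: open_measurable_Rn.
have mu_ k : measurable_fun (Om : set (Rn R n)) (u_ k).
  exact: (measurable_Lp Om_open p0 (W1p_Lp (u_W1p k))).
have tu : tight Om p ps u_ u.
  split; [exact: u_W1p|exact: u_bounded|exact: u_cvg|split]; [exact: equiintegrable_unif_small u_equi_p|
    exact: equiintegrable_unif_small u_equi_ps|].
  apply: (equiintegrable_unif_small mOm _ Du_equi_p) => k.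
  by apply: measurable_enorm => i; exact: (measurable_wgrad Om_open p_gt1 i (u_W1p k)).
split.
  exact: (J_lower_semicontinuous Om_open p_gt1 ps0 Om_emb j_car C_gt0 h_L1 j_lb j_convex).
move=> limsup Ju.
have Jfin := Jfun_fin_num Om_open p_gt1 ps0 Om_emb j_car h_L1 j_lb j_convex uW1p Ju.
have limsup' e : 0 < e -> \forall k \near \oo, (Jfun j Om (u_ k) < Jfun j Om u + e%:E)%E.
  by move=> e0; apply: limn_esup_lt; apply: le_lt_trans limsup _; rewrite lteDl// lte_fin.
(* The energies are finite from some index on, to which the subsequences are shifted. *)
have [N _ NP] := limsup' 1 ltr01.
have Joo k : (N <= k)%N -> (Jfun j Om (u_ k) < +oo)%E.
  by move=> /NP /lt_trans; apply; rewrite -(fineK Jfin) -EFinD ltry.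
have sub (s : nat -> nat) : (forall k, (k <= s k)%N) -> exists t : nat -> nat, [/\
    (fun k => \int[leb]_(x in (Om : set (Rn R n)))
       (`|enorm (wgrad Om (u_ (s (t k))) x - wgrad Om u x)| `^ p)%:E)%E @ \oo --> 0%E,
    (fun k => \int[leb]_(x in (Om : set (Rn R n))) (`|(u_ (s (t k)) \- u) x| `^ ps)%:E)%E
      @ \oo --> 0%E &
    (fun k => \int[leb]_(x in (Om : set (Rn R n))) (`|(u_ (s (t k)) \- u) x| `^ p)%:E)%E
      @ \oo --> 0%E].
  move=> ks; pose s' k := s (k + N)%N.
  have ks' k : (k <= s' k)%N by exact: leq_trans (leq_addr N k) (ks _).
  have Joo' k : (Jfun j Om (u_ (s' k)) < +oo)%E.
    by apply: Joo; exact: leq_trans (leq_addl k N) (ks _).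
  have lim (e : R) : 0 < e ->
      \forall k \near \oo, (Jfun j Om (u_ (s' k)) <= Jfun j Om u + e%:E)%E.
    move=> e0; have [M _ MP] := limsup' e e0; exists M => [//|k Mk]; apply: ltW.
    exact: (MP (s' k) (leq_trans Mk (ks' k))).
  have [t [t1 t2 t3]] := strong_subseq Om_open p_gt1 ps0 Om_emb j_car C_gt0 h_L1 j_lb j_convex
    (tight_sub ks' tu) uW1p Joo' Ju lim.
  by exists (fun k => t k + N)%N; split; [exact: t1|exact: t2|exact: t3].
have int0 (f : 'rV[R]_n.+1 -> R) (r : R) :
    (0 <= \int[leb]_(x in (Om : set (Rn R n))) (`|f x| `^ r)%:E)%E.
  by apply: integral_ge0 => x _; rewrite lee_fin powR_ge0.
have g0 : Lp_norm Om p (fun x => enorm (wgrad Om (u_ k) x - wgrad Om u x))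
         @[k --> \oo] --> 0%E.
  apply: (Lp_norm_cvg0 p0); apply: (cvge0_subseq (fun k => int0 _ _)) => s ks.
  by have [t [t1 _ _]] := sub s ks; exists t; assumption.
have v0 : Lp_norm Om p (u_ k \- u) @[k --> \oo] --> 0%E.
  apply: (Lp_norm_cvg0 p0); apply: (cvge0_subseq (fun k => int0 _ _)) => s ks.
  by have [t [_ _ t3]] := sub s ks; exists t; assumption.
split; [exact: (W11_loc_of_Lp Om_open p_gt1 u_W1p uW1p g0 v0)|exact: g0| |exact: v0].
apply: (Lp_norm_cvg0 ps0); apply: (cvge0_subseq (fun k => int0 _ _)) => s ks.
by have [t [_ t2 _]] := sub s ks; exists t; assumption.
Qed.
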